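(* Let $\mathcal{C}$ be a cooperad in chain complexes over a commutative ring $\Bbbk$. Let $f\colon A\to B$, $g\colon B\to A$, $h\colon A\to A$ be a contraction of chain complexes, and let $\mathbf{f}_n=f^{\otimes n}$, $\mathbf{g}_n=g^{\otimes n}$. (a) For any choice of symmetric pseudo-derivation $\mathbf{h}\colon A\to A$ such that $\mathbf{h}_1=h$, $\partial(\mathbf{h})=\mathbf{g}\mathbf{f}-\mathbf{1}$, $\mathbf{h}\mathbf{h}=\mathbf{0}$, $\mathbf{f}\mathbf{h}=\mathbf{0}$, $\mathbf{h}\mathbf{g}=\mathbf{0}$, the maps $$\mathcal{C}_\bullet[\mathbf{f}]\colon\mathcal{C}[A]\to\mathcal{C}[B],\quad \mathcal{C}_\bullet[\mathbf{g}]\colon\mathcal{C}[B]\to\mathcal{C}[A],\quad \mathcal{C}_\bullet[\mathbf{h}]\colon\mathcal{C}[A]\to\mathcal{C}[A]$$ form a contraction of $\mathcal{C}$-coalgebras. (b) If $\mathcal{C}$ is a non-symmetric cooperad, then one may drop the condition that $\mathbf{h}$ be symmetric. (c) There is always a (non-symmetric) pseudo-derivation $\mathbf{h}$ with the properties required in (a) apart from symmetry, namely $$\mathbf{h}_n=\sum_{p+1+q=n}1^{\otimes p}\otimes h\otimes(gf)^{\otimes q}.$$ (d) If $\mathbb{Q}\subseteq\Bbbk$ then, with $\mathbf{h}_n$ as in (c), $\mathbf{h}_n^\Sigma=\frac1{n!}\sum_{\sigma\in\Sigma_n}\sigma^{-1}\mathbf{h}_n\sigma$ defines a symmetric pseudo-derivation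 $\mathbf{h}^\Sigma$ with all the properties required in (a).
   Context: Chain complexes are unbounded complexes over $\Bbbk$ with differential of degree $-1$; the Koszul sign rule is used. A contraction of chain complexes consists of maps $f\colon A\to B$, $g\colon B\to A$ of degree $0$ and $h\colon A\to A$ of degree $1$ with $\partial(f)=0$, $\partial(g)=0$, $\partial(h)=gf-1_A$, $fg=1_B$, $fh=0$, $hh=0$, $hg=0$. A thick map $\mathbf{f}\colon A\to B$ is a sequence of maps $\mathbf{f}_n\colon A^{\otimes n}\to B^{\otimes n}$, $n\ge0$, all of the same degree; it is symmetric if each $\mathbf{f}_n$ is $\Sigma_n$-equivariant. Composition, sums and $\partial(\mathbf{f})_n=d_{B^{\otimes n}}\mathbf{f}_n-(-1)^{|\mathbf{f}|}\mathbf{f}_nd_{A^{\otimes n}}$ are levelwise; $\mathbf{1}_n=1$, $\mathbf{0}_n=0$. A thick map is a morphism if $\mathbf{f}_{p+q}=\mathbf{f}_p\otimes\mathbf{f}_q$ for all $p,q\ge0$. A thick map $\mathbf{h}\colon A\to A$ (of degree $1$) is a pseudo-derivation if for all $p,q\ge0$ $$(\mathbf{h}_p\otimes 1-1\otimes\mathbf{h}_q)\mathbf{h}_{p+q}=\mathbf{h}_p\otimes\mathbf{h}_q,\qquad \mathbf{h}_{p+q}(\mathbf{h}_p\otimes 1-1\otimes\mathbf{h}_q)=-\mathbf{h}_p\otimes\mathbf{h}_q .$$ Put $\mathcal{C}[A]=\bigoplus_{n\ge0}\mathcal{C}(n)\otimes_{\Sigma_n}A^{\otimes n}$ (with $\otimes$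 instead of $\otimes_{\Sigma_n}$ for non-symmetric $\mathcal{C}$), the cofree $\mathcal{C}$-coalgebra, and $\mathcal{C}[\mathbf{f}]=\bigoplus_n1\otimes_{\Sigma_n}\mathbf{f}_n$. The thick map $\mathcal{C}_\bullet[\mathbf{f}]\colon\mathcal{C}[A]\to\mathcal{C}[B]$ has $n$-th level acting as $1\otimes\mathbf{f}_{r_1+\cdots+r_n}$ on the summand $(\mathcal{C}(r_1)\otimes\cdots\otimes\mathcal{C}(r_n))\otimes_{\Sigma_{r_1}\times\cdots\times\Sigma_{r_n}}A^{\otimes(r_1+\cdots+r_n)}$ of $\mathcal{C}[A]^{\otimes n}$. A $\mathcal{C}$-coalgebra is a coalgebra $\Delta_A\colon A\to\mathcal{C}[A]$ over the comonad $\mathcal{C}[-]$. A thick map of $\mathcal{C}$-coalgebras $A\to B$ is a symmetric thick map with $\Delta_B\mathbf{f}_1=\mathcal{C}[\mathbf{f}]\Delta_A$ (symmetry dropped in the non-symmetric case). A contraction of $\mathcal{C}$-coalgebras consists of thick maps of $\mathcal{C}$-coalgebras $\mathbf{f}\colon A\to B$, $\mathbf{g}\colon B\to A$, $\mathbf{h}\colon A\to A$ of degrees $0,0,1$ with $\partial(\mathbf{f})=\mathbf{0}$, $\partial(\mathbf{g})=\mathbf{0}$, $\partial(\mathbf{h})=\mathbf{g}\mathbf{f}-\mathbf{1}$, $\mathbf{f}\mathbf{g}=\mathbf{1}$, $\mathbf{f}\mathbf{h}=\mathbf{0}$, $\mathbf{h}\mathbf{h}=\mathbf{0}$, $\mathbf{h}\mathbf{g}=\mathbf{0}$,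 where $\mathbf{f},\mathbf{g}$ are morphisms and $\mathbf{h}$ is a pseudo-derivation. *)

(* Defs.v *)
From HB Require Import structures.
From mathcomp Require Import all_boot all_order all_algebra all_fingroup.
From mathcomp Require Import zify ring.
From mathcomp Require Import boolp.

Set Implicit Arguments.
Unset Strict Implicit.
Unset Printing Implicit Defensive.

Import Order.TTheory GRing.Theory Num.Theory.
Local Open Scope ring_scope.

Section Linear.
Variable K : comPzRingType.

Lemma linD (V W : lmodType K) (u : V -> W) :
  linear u -> forall x y, u (x + y) = u x + u y.
Proof. by move=> lu x y; have := lu 1 x y; rewrite !scale1r. Qed.

Lemma lin0 (V W : lmodType K) (u : V -> W) : linear u -> u 0 = 0.
Proof. by move=> lu; apply: (addrI (u 0)); rewrite -linD // !addr0. Qed.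

Lemma linZ (V W : lmodType K) (u : V -> W) :
  linear u -> forall a x, u (a *: x) = a *: u x.
Proof. by move=> lu a x; have := lu a x 0; rewrite !addr0 lin0 // addr0. Qed.

Lemma lin_comp (U V W : lmodType K) (u : V -> W) (v : U -> V) :
  linear u -> linear v -> linear (u \o v).
Proof. by move=> lu lv a x y /=; rewrite lv lu. Qed.

Lemma linS (V W : lmodType K) (u : V -> W) (I : Type) (s : seq I) (F : I -> V) :
  linear u -> u (\sum_(i <- s) F i) = \sum_(i <- s) u (F i).
Proof.
move=> lu; elim: s => [|i s IH]; first by rewrite !big_nil lin0.
by rewrite !big_cons linD // IH.
Qed.

End Linear.

Section Presentation.
Variables (K : comPzRingType) (X : Type).

Definition ev (W : lmodType K) (F : X -> W) (e : seq (K * X)) : W :=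
  \sum_(kx <- e) kx.1 *: F kx.2.

Lemma ev_cat (W : lmodType K) (F : X -> W) e e' :
  ev F (e ++ e') = ev F e + ev F e'.
Proof. exact: big_cat. Qed.

Lemma ev_scale (W : lmodType K) (F : X -> W) a e :
  ev F [seq (a * kx.1, kx.2) | kx <- e] = a *: ev F e.
Proof.
rewrite /ev big_map scaler_sumr; apply: eq_bigr => kx _ /=.
by rewrite scalerA.
Qed.

Lemma ev_lin (W W' : lmodType K) (u : W -> W') (F : X -> W) e :
  linear u -> u (ev F e) = ev (u \o F) e.
Proof.
by move=> lu; rewrite /ev linS //; apply: eq_bigr => kx _; rewrite linZ.
Qed.

Variable rel : seq (K * X) -> Prop.

Definition compat (W : lmodType K) (F : X -> W) := forall r, rel r -> ev F r = 0.

Definition eqv (e e' : seq (K * X)) : Prop :=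
  forall (W : lmodType K) (F : X -> W), compat F -> ev F e = ev F e'.

(* The K-module with generators X and relators rel: formal combinations of  *)
(* generators, identified when no map out of X killing the relators         *)
(* separates them.                                                          *)
Record pres := Pres { pcls : seq (K * X) -> Prop; _ : exists e, pcls = eqv e }.

Definition prepr (q : pres) : seq (K * X) :=
  projT1 (cid (let: Pres c p := q return exists e, pcls q = eqv e in p)).

Definition pcl (e : seq (K * X)) : pres := @Pres (eqv e) (ex_intro _ e erefl).

Lemma eqv_refl e : eqv e e. Proof. by []. Qed.

Lemma pclE e e' : eqv e e' -> pcl e = pcl e'.
Proof.
move=> ee'; rewrite /pcl; have E : eqv e = eqv e'.
  apply/funext => e''; apply/propext; split => h W F cF.
    by rewrite -ee' // h.
  by rewrite ee' // h.
move: (ex_intro _ e _) (ex_intro _ e' _); rewrite E => p p'.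
by rewrite (Prop_irrelevance p p').
Qed.

Lemma preprK q : pcl (prepr q) = q.
Proof.
case: q => c p; rewrite /prepr; case: cid => e /= Ee.
move: (p); rewrite Ee => p'; rewrite /pcl.
by congr Pres; apply: Prop_irrelevance.
Qed.

Lemma pcl_eqv e : eqv (prepr (pcl e)) e.
Proof. by rewrite /prepr; case: cid => e' /= Ee; rewrite -Ee. Qed.

HB.instance Definition _ := gen_eqMixin pres.
HB.instance Definition _ := gen_choiceMixin pres.

Definition padd q q' := pcl (prepr q ++ prepr q').
Definition pscale a q := pcl [seq (a * kx.1, kx.2) | kx <- prepr q].

Lemma padd_pcl e e' : padd (pcl e) (pcl e') = pcl (e ++ e').
Proof. by apply: pclE => W F cF; rewrite !ev_cat !pcl_eqv. Qed.

Lemma pscale_pcl a e :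
  pscale a (pcl e) = pcl [seq (a * kx.1, kx.2) | kx <- e].
Proof. by apply: pclE => W F cF; rewrite !ev_scale !pcl_eqv. Qed.

Lemma pind (P : pres -> Prop) : (forall e, P (pcl e)) -> forall q, P q.
Proof. by move=> h q; rewrite -(preprK q). Qed.

Lemma paddA : associative padd.
Proof.
elim/pind=> a; elim/pind=> b; elim/pind=> c.
by rewrite !padd_pcl catA.
Qed.

Lemma paddC : commutative padd.
Proof.
elim/pind=> a; elim/pind=> b; rewrite !padd_pcl.
by apply: pclE => W F _; rewrite !ev_cat addrC.
Qed.

Lemma padd0 : left_id (pcl [::]) padd.
Proof. by elim/pind=> a; rewrite padd_pcl. Qed.

Lemma paddN : left_inverse (pcl [::]) (pscale (-1)) padd.
Proof.
elim/pind=> a; rewrite pscale_pcl padd_pcl.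
by apply: pclE => W F _; rewrite ev_cat ev_scale scaleN1r addNr /ev big_nil.
Qed.

HB.instance Definition _ := GRing.isZmodule.Build pres paddA paddC padd0 paddN.

Lemma pscaleA a b v : pscale a (pscale b v) = pscale (a * b) v.
Proof.
elim/pind: v => e; rewrite !pscale_pcl.
by apply: pclE => W F _; rewrite !ev_scale scalerA.
Qed.

Lemma pscale1 : left_id 1 pscale.
Proof.
elim/pind=> e; rewrite pscale_pcl.
by apply: pclE => W F _; rewrite ev_scale scale1r.
Qed.

Lemma pscaleDr : right_distributive pscale +%R.
Proof.
move=> a; elim/pind=> u; elim/pind=> v.
rewrite [pcl u + _]padd_pcl !pscale_pcl [RHS]padd_pcl.
by apply: pclE => W F _; rewrite ev_cat !ev_scale ev_cat scalerDr.
Qed.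

Lemma pscaleDl v : {morph pscale^~ v : a b / a + b}.
Proof.
move=> a b; elim/pind: v => e; rewrite !pscale_pcl [RHS]padd_pcl.
by apply: pclE => W F _; rewrite ev_cat !ev_scale scalerDl.
Qed.

HB.instance Definition _ :=
  GRing.Zmodule_isLmodule.Build K pres pscaleA pscale1 pscaleDr pscaleDl.

Definition gen (x : X) : pres := pcl [:: (1, x)].

Lemma pcl_gen e : pcl e = ev gen e.
Proof.
elim: e => [|[k x] e IH]; first by rewrite /ev big_nil.
rewrite -cat1s -padd_pcl IH /ev big_cons /=; congr (_ + _).
by rewrite [RHS]pscale_pcl /= mulr1.
Qed.

Lemma gen_compat : compat gen.
Proof.
move=> r rr; rewrite -pcl_gen; apply: pclE => W F cF.
by rewrite cF // /ev big_nil.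
Qed.

(* The linear extension of F : X -> W; it is used for maps F that kill the  *)
(* relators, for which the chosen representative is irrelevant (plift_pcl). *)
Definition plift (W : lmodType K) (F : X -> W) (q : pres) : W := ev F (prepr q).

Lemma plift_pcl (W : lmodType K) (F : X -> W) e :
  compat F -> plift F (pcl e) = ev F e.
Proof. by move=> cF; apply: pcl_eqv. Qed.

Lemma plift_gen (W : lmodType K) (F : X -> W) x :
  compat F -> plift F (gen x) = F x.
Proof. by move=> cF; rewrite plift_pcl // /ev big_seq1 scale1r. Qed.

Lemma plift_linear (W : lmodType K) (F : X -> W) : compat F -> linear (plift F).
Proof.
move=> cF a; elim/pind=> u; elim/pind=> v.
rewrite [_ *: _]pscale_pcl [_ + _]padd_pcl !plift_pcl //.
by rewrite ev_cat ev_scale.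
Qed.

Lemma pres_ext (W : lmodType K) (u v : pres -> W) :
  linear u -> linear v -> (forall x, u (gen x) = v (gen x)) -> u =1 v.
Proof.
move=> lu lv uv; elim/pind=> e; rewrite pcl_gen !ev_lin //.
by apply: eq_bigr => kx _ /=; rewrite uv.
Qed.

End Presentation.

Section Complexes.
Variable K : comPzRingType.

(* A chain complex over K: the module is the direct sum of its homogeneous  *)
(* parts, prj i is the projection onto the part of degree i, and dif is the *)
(* differential.                                                            *)
Record complex := Complex {
  car :> lmodType K;
  prj : int -> car -> car;
  dif : car -> car;
  prj_lin : forall i, linear (prj i);
  prj_prj : forall i j x, prj i (prj j x) = if i == j then prj j x else 0;
  prj_fin : forall x, exists2 s : seq int, uniq s & x = \sum_(i <- s) prj i x;
  dif_lin : linear dif;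
  dif_prj : forall i x, dif (prj i x) = prj (i - 1) (dif x);
  dif_dif : forall x, dif (dif x) = 0 }.

Record cmap (V W : complex) := Cmap {
  cfun :> V -> W;
  cfun_lin : linear cfun;
  cfun_prj : forall i x, cfun (prj i x) = prj i (cfun x);
  cfun_dif : forall x, cfun (dif x) = dif (cfun x) }.

Section GradedPresentation.
Variables (X : Type) (rel : seq (K * X) -> Prop) (deg : X -> int).
Variable dX : X -> pres rel.

Definition gprj i : pres rel -> pres rel :=
  plift (fun x => if deg x == i then gen rel x else 0).

Hypothesis rel_deg :
  forall r, rel r -> exists m, all (fun kx => deg kx.2 == m) r.

Lemma gprj_compat i :
  compat rel (fun x => if deg x == i then gen rel x else 0).
Proof.
move=> r rr; have [m rm] := rel_deg rr.
have -> : ev (fun x => if deg x == i then gen rel x else 0) r =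
          if m == i then ev (gen rel) r else 0.
  rewrite /ev; elim: r {rr} rm => [|kx r IH]; first by rewrite !big_nil if_same.
  rewrite !big_cons => /= /andP[/eqP-> /IH ->].
  by case: ifP => // _; rewrite scaler0 addr0.
by case: ifP => // _; apply: gen_compat.
Qed.

Lemma gprj_gen i x : gprj i (gen rel x) = if deg x == i then gen rel x else 0.
Proof. exact/plift_gen/gprj_compat. Qed.

Lemma gprj_lin i : linear (gprj i).
Proof. exact/plift_linear/gprj_compat. Qed.

Hypothesis dX_compat : compat rel dX.
Hypothesis dX_deg : forall x, gprj (deg x - 1) (dX x) = dX x.
Hypothesis dX_dX : forall x, plift dX (dX x) = 0.

Let d : pres rel -> pres rel := plift dX.

Let d_gen x : d (gen rel x) = dX x. Proof. exact: plift_gen. Qed.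

Let d_lin : linear d. Proof. exact: plift_linear. Qed.

Let id_lin : linear (fun x : pres rel => x). Proof. by []. Qed.

Let zero_lin : linear (fun x : pres rel => 0 : pres rel).
Proof. by move=> a x y; rewrite scaler0 addr0. Qed.

Lemma gprj_gprj i j x :
  gprj i (gprj j x) = if i == j then gprj j x else 0.
Proof.
case: ifP => ij; move: x; apply: pres_ext.
- exact: (lin_comp (gprj_lin i) (gprj_lin j)).
- exact: gprj_lin.
- move=> x; rewrite gprj_gen -(eqP ij); case: ifP => dx; last exact/lin0/gprj_lin.
  by rewrite gprj_gen dx.
- exact: (lin_comp (gprj_lin i) (gprj_lin j)).
- exact: zero_lin.
move=> x; rewrite gprj_gen; case: ifP => dx; last exact/lin0/gprj_lin.
by rewrite gprj_gen (eqP dx) eq_sym ij.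
Qed.

Lemma gprj_fin x : exists2 s : seq int, uniq s & x = \sum_(i <- s) gprj i x.
Proof.
elim/pind: x => e; pose s := undup [seq deg kx.2 | kx <- e].
exists s; rewrite ?undup_uniq // pcl_gen.
have: {subset [seq deg kx.2 | kx <- e] <= s} by move=> i; rewrite mem_undup.
have: uniq s by apply: undup_uniq.
elim: e s => [|[k x] e IH] s us es.
  by rewrite /ev big_nil big1 // => i _; apply/lin0/gprj_lin.
rewrite /ev big_cons -/(ev _ e) /= {1}(IH s) //; last first.
  by move=> i ie; apply: es; rewrite inE ie orbT.
have xE : k *: gen rel x = \sum_(i <- s) gprj i (k *: gen rel x).
  have xs : deg x \in s by apply: es; rewrite inE eqxx.
  rewrite (bigD1_seq (deg x)) //= big1 => [|i ix].
    by rewrite addr0 linZ ?gprj_gen ?eqxx //; apply: gprj_lin.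
  rewrite linZ ?gprj_gen; last exact: gprj_lin.
  by rewrite eq_sym (negbTE ix) scaler0.
rewrite {1}xE -big_split; apply: eq_bigr => i _ /=.
by rewrite (linD (gprj_lin i)).
Qed.

Lemma gdif_prj i x : d (gprj i x) = gprj (i - 1) (d x).
Proof.
move: x; apply: pres_ext; [exact: lin_comp (gprj_lin i) | |] => //.
  exact: (lin_comp (gprj_lin (i - 1)) d_lin).
move=> x; rewrite gprj_gen d_gen; case: ifP => [/eqP <-|ix].
  by rewrite d_gen dX_deg.
rewrite lin0 // -dX_deg gprj_gprj.
by rewrite (inj_eq (addIr _)) eq_sym ix.
Qed.

Lemma gdif_dif x : d (d x) = 0.
Proof.
move: x; apply: pres_ext; [exact: (lin_comp d_lin d_lin) | exact: zero_lin |].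
by move=> x; rewrite d_gen; apply: dX_dX.
Qed.

Definition gcomplex : complex :=
  Complex gprj_lin gprj_gprj gprj_fin d_lin gdif_prj gdif_dif.

End GradedPresentation.

(* (-1)^z *)
Definition ksgn (z : int) : K := (-1) ^+ `|z|%N.

Lemma ksgnD a b : ksgn (a + b) = ksgn a * ksgn b.
Proof.
rewrite /ksgn -signr_odd -[X in X * _]signr_odd -[X in _ * X]signr_odd -signr_addb.
congr (_ ^+ nat_of_bool _); lia.
Qed.

Lemma ksgnN a : ksgn (- a) = ksgn a.
Proof. by rewrite /ksgn abszN. Qed.

Lemma ksgnDD a : ksgn (a + a) = 1.
Proof. by rewrite ksgnD /ksgn -expr2 sqrr_sign. Qed.

Lemma ksgn1 : ksgn 1 = -1. Proof. exact: expr1. Qed.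

Section Tensor.
Variables (n : nat) (V : 'I_n -> complex).

(* The generator (deg, x) stands for the tensor product of the components   *)
(* of degree deg i of the elements x i.                                     *)
Definition tgen : Type := ('I_n -> int) * (forall i, V i).

Inductive trel : seq (K * tgen) -> Prop :=
| trel_lin (deg : 'I_n -> int) (i : 'I_n) (a : K) (x y z : forall i, V i) :
    x i = a *: y i + z i -> (forall j, j != i -> y j = x j) ->
    (forall j, j != i -> z j = x j) ->
    trel [:: (1, (deg, x)); (- a, (deg, y)); (-1, (deg, z))]
| trel_prj (deg : 'I_n -> int) (x : forall i, V i) :
    trel [:: (1, (deg, x)); (-1, (deg, fun i => prj (deg i) (x i)))].

Definition tdeg (g : tgen) : int := \sum_i g.1 i.

Definition tdgen (i : 'I_n) (g : tgen) : tgen :=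
  (fun j => if j == i then g.1 j - 1 else g.1 j,
   fun j => if j == i then dif (g.2 j) else g.2 j).

Definition tdif (g : tgen) : pres trel :=
  \sum_(i < n) ksgn (\sum_(j < n | (j < i)%N) g.1 j) *: gen trel (tdgen i g).

Lemma trel_linP (W : lmodType K) (F : tgen -> W) : 
  (forall deg i a x y z,
    x i = a *: y i + z i -> (forall j, j != i -> y j = x j) ->
    (forall j, j != i -> z j = x j) ->
    F (deg, x) = a *: F (deg, y) + F (deg, z)) ->
  (forall deg x, F (deg, x) = F (deg, fun i => prj (deg i) (x i))) ->
  compat trel F.
Proof.
move=> Flin Fprj r [deg i a x y z xE yE zE|deg x].
  rewrite /ev !big_cons big_nil /= (Flin deg i a x y z) // scale1r scaleNr scaleN1r.
  by rewrite addr0 -opprD subrr.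
by rewrite /ev !big_cons big_nil /= -Fprj scale1r scaleN1r addr0 subrr.
Qed.

Lemma tgen_lin deg i a x y z :
  x i = a *: y i + z i -> (forall j, j != i -> y j = x j) ->
  (forall j, j != i -> z j = x j) ->
  gen trel (deg, x) = a *: gen trel (deg, y) + gen trel (deg, z).
Proof.
move=> xE yE zE; have := gen_compat (trel_lin deg xE yE zE).
rewrite /ev !big_cons big_nil /= scale1r scaleNr scaleN1r addr0 -opprD.
by move/eqP; rewrite subr_eq0 => /eqP.
Qed.

Lemma tgen_prj deg x :
  gen trel (deg, x) = gen trel (deg, fun i => prj (deg i) (x i)).
Proof.
have := gen_compat (trel_prj deg x).
rewrite /ev !big_cons big_nil /= scale1r scaleN1r addr0.
by move/eqP; rewrite subr_eq0 => /eqP.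
Qed.

Lemma tgen0 i deg x : x i = 0 -> gen trel (deg, x) = 0.
Proof.
move=> x0; have := @tgen_lin deg i 1 x x x.
rewrite x0 scaler0 addr0 scale1r => /(_ erefl (fun _ _ => erefl) (fun _ _ => erefl)).
by move/(congr1 (fun t => t - gen trel (deg, x))); rewrite addrK subrr.
Qed.

Lemma trel_deg r : trel r -> exists m, all (fun kx => tdeg kx.2 == m) r.
Proof. by case=> [deg i a x y z _ _ _|deg x]; exists (\sum_i deg i); rewrite /= eqxx. Qed.

Lemma tdif_compat : compat trel tdif.
Proof.
apply: trel_linP => [deg i a x y z xE yE zE|deg x]; rewrite /tdif /tdgen /=.
  rewrite scaler_sumr -big_split; apply: eq_bigr => k _ /=.
  rewrite scalerA [a * _]mulrC -scalerA -scalerDr; congr (_ *: _).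
  apply: (@tgen_lin _ i); rewrite /= ?xE.
  - by case: ifP => // _; rewrite dif_lin.
  - by move=> j ji; rewrite yE.
  by move=> j ji; rewrite zE.
apply: eq_bigr => k _; congr (_ *: _); rewrite tgen_prj [RHS]tgen_prj /=.
congr (gen _ (_, _)); apply: functional_extensionality_dep => j.
case: ifP => _; last by rewrite prj_prj eqxx.
by rewrite dif_prj prj_prj eqxx.
Qed.

Lemma tdeg_tdgen i g : tdeg (tdgen i g) = tdeg g - 1.
Proof.
rewrite /tdeg (bigD1 i) //= eqxx [in RHS](bigD1 i) //= addrAC.
by congr (_ + _ - _); apply: eq_bigr => j /negbTE->.
Qed.

Lemma tdif_deg g : gprj tdeg (tdeg g - 1) (tdif g) = tdif g.
Proof.
rewrite linS; last exact/gprj_lin/trel_deg.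
apply: eq_bigr => i _; rewrite linZ; last exact/gprj_lin/trel_deg.
by rewrite gprj_gen ?tdeg_tdgen ?eqxx //; apply: trel_deg.
Qed.

Lemma tdgenC i j g : i != j -> tdgen i (tdgen j g) = tdgen j (tdgen i g).
Proof.
move=> ij; rewrite /tdgen /=; congr (_, _).
  by apply: functional_extensionality_dep => k; case: eqP => // ->; rewrite (negbTE ij).
apply: functional_extensionality_dep => k.
by case: eqP => // ->; rewrite (negbTE ij).
Qed.

Lemma tdif_tdif g : plift tdif (tdif g) = 0.
Proof.
have tl := plift_linear tdif_compat.
pose s (h : tgen) (i : 'I_n) := ksgn (\sum_(j < n | (j < i)%N) h.1 j).
pose T i j : pres trel := (s g i * s (tdgen i g) j) *: gen trel (tdgen j (tdgen i g)).
have -> : plift tdif (tdif g) = \sum_(i < n) \sum_(j < n) T i j.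
  rewrite {2}/tdif linS //; apply: eq_bigr => i _.
  rewrite linZ // plift_gen; last exact: tdif_compat.
  by rewrite /tdif scaler_sumr; apply: eq_bigr => j _; rewrite scalerA.
have Tii i : T i i = 0.
  by rewrite /T (@tgen0 i) ?scaler0 //= eqxx dif_dif.
have Tij (i j : 'I_n) : (i < j)%N -> T i j = - T j i.
  move=> ij; have nij : i != j by rewrite neq_ltn ij.
  rewrite /T tdgenC 1?eq_sym // -scaleNr; congr (_ *: _).
  have -> : s (tdgen j g) i = s g i.
    congr ksgn; apply: eq_bigr => k ki /=.
    by case: eqP ki => // ->; rewrite ltnNge ltnW.
  have -> : s (tdgen i g) j = - s g j.
    rewrite /s (bigD1 i) //= eqxx addrAC ksgnD ksgnN ksgn1 mulrN1.
    rewrite [in RHS](bigD1 i) //=; congr (- ksgn (_ + _)).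
    by apply: eq_bigr => k /andP[_ /negbTE ->].
  by rewrite mulrN mulrC.
have -> : \sum_(i < n) \sum_(j < n) T i j =
    \sum_(i < n) \sum_(j < n | (i < j)%N) T i j + \sum_(i < n) \sum_(j < n | (j < i)%N) T i j.
  rewrite -big_split; apply: eq_bigr => i _ /=.
  rewrite (bigD1 i) //= Tii add0r (bigID (fun j : 'I_n => (i < j)%N)) /=.
  congr (_ + _); apply: eq_bigl => j.
    by case: eqVneq => // ->; rewrite ltnn.
  by rewrite -leqNgt [RHS]ltn_neqAle -(inj_eq val_inj).
rewrite [X in _ + X](exchange_big_dep predT) //= -big_split big1 // => i _ /=.
by rewrite -big_split big1 // => j ij /=; rewrite Tij // addNr.
Qed.

Definition tens : complex :=
  gcomplex trel_deg tdif_compat tdif_deg tdif_tdif.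

End Tensor.

(* The order-preserving bijections when sym is false (these exist only for  *)
(* m = n, and are identities); all bijections when sym is true.             *)
Record obij (sym : bool) m n := Obij {
  ofun :> 'I_m -> 'I_n;
  oinv : 'I_n -> 'I_m;
  ofunK : cancel ofun oinv;
  oinvK : cancel oinv ofun;
  omono : ~~ sym -> forall i j : 'I_m, (i < j)%N -> (ofun i < ofun j)%N }.

Section TensorMap.
Variables (m n : nat) (V : 'I_m -> complex) (W : 'I_n -> complex).
Variable c : 'I_n -> 'I_m.

(* The Koszul sign of x_0 ... x_(m-1) |-> x_(c 0) ... x_(c (n-1)).          *)
Definition koszul (deg : 'I_m -> int) : K :=
  ksgn (\sum_(i < n) \sum_(j < n | (i < j)%N && (c j < c i)%N)
          deg (c i) * deg (c j)).

(* x_0 ... x_(m-1) |-> x_(c 0) ... x_(c (n-1)) followed by the tensor       *)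
(* product of the maps u i, where u i has degree e i.                       *)
Definition tmap (e : 'I_n -> int) (u : forall i, V (c i) -> W i) :
    tens V -> tens W :=
  plift (fun g : tgen V =>
    (koszul g.1 * ksgn (\sum_(i < n) \sum_(j < n | (i < j)%N) e j * g.1 (c i)))
    *: gen (@trel n W) (fun i => g.1 (c i) + e i, fun i => u i (g.2 (c i)))).

Hypothesis c_bij : bijective c.
Variable u : forall i, cmap (V (c i)) (W i).

Let F (g : tgen V) : tens W :=
  koszul g.1 *: gen (@trel n W) (fun i => g.1 (c i), fun i => u i (g.2 (c i))).

Let tmapE : tmap (fun=> 0) u = plift F.
Proof.
congr plift; apply: functional_extensionality_dep => g; rewrite /F.
rewrite [X in ksgn X]big1 => [|i _]; last by apply: big1 => j _; rewrite mul0r.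
rewrite [ksgn 0]expr0 mulr1; congr (_ *: gen _ (_, _)).
by apply: functional_extensionality_dep => i; rewrite addr0.
Qed.

Let F_compat : compat (@trel m V) F.
Proof.
apply: trel_linP => [deg i a x y z xE yE zE|deg x]; rewrite /F /=.
  have [k ki] : exists k, c k = i by have [c' _ c'K] := c_bij; exists (c' i).
  rewrite -{i}ki in xE yE zE.
  rewrite scalerA [a * _]mulrC -scalerA -scalerDr; congr (_ *: _).
  have jk j : j != k -> c j != c k by rewrite (inj_eq (bij_inj c_bij)).
  apply: (@tgen_lin _ _ _ k) => /= [|j /jk cj|j /jk cj].
  - by rewrite xE cfun_lin.
  - by rewrite yE.
  by rewrite zE.
congr (_ *: _); rewrite tgen_prj /=; congr (gen _ (_, _)).
by apply: functional_extensionality_dep => i; rewrite cfun_prj.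
Qed.

Let koszul_dif (i0 : 'I_n) (deg : 'I_m -> int) :
  ksgn (\sum_(j < m | (j < c i0)%N) deg j)
    * koszul (fun j => if j == c i0 then deg j - 1 else deg j) =
  koszul deg * ksgn (\sum_(j < n | (j < i0)%N) deg (c j)).
Proof.
pose D' (j : 'I_m) := if j == c i0 then deg j - 1 else deg j.
rewrite -/D'; pose inv (i j : 'I_n) := (i < j)%N && (c j < c i)%N.
pose P := \sum_(j < n | (j < i0)%N && (c j < c i0)%N) deg (c j).
pose Q := \sum_(j < n | inv i0 j) deg (c j).
pose R := \sum_(j < n | inv j i0) deg (c j).
have -> : \sum_(j < m | (j < c i0)%N) deg j = P + Q.
  rewrite (reindex c) /=; last exact: onW_bij.
  rewrite (bigID (fun j : 'I_n => (j < i0)%N)) /=; congr (_ + _).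
    by apply: eq_bigl => j; rewrite andbC.
  apply: eq_bigl => j; rewrite /inv andbC.
  by case: (ltngtP j i0) => //= /ord_inj ->; rewrite ltnn.
have -> : \sum_(j < n | (j < i0)%N) deg (c j) = P + R.
  rewrite (bigID (fun j : 'I_n => (c j < c i0)%N)) /=; congr (_ + _).
  apply: eq_bigl => j; rewrite /inv.
  by case: (ltngtP (c j) (c i0)) => //= /ord_inj /(bij_inj c_bij) ->; rewrite ltnn.
have -> : koszul deg = koszul D' * ksgn (Q + R).
  rewrite -ksgnD; congr ksgn.
  have -> : Q + R = \sum_(i < n) \sum_(j < n | inv i j)
      ((if i == i0 then deg (c j) else 0) + if j == i0 then deg (c i) else 0).
    under [RHS]eq_bigr do rewrite big_split /=.
    rewrite big_split /=; congr (_ + _).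
      rewrite (bigD1 i0) //= eqxx [X in _ = _ + X]big1 ?addr0 // => i /negbTE ->.
      by rewrite big1.
    rewrite [RHS](exchange_big_dep predT) //= (bigD1 i0) //= eqxx.
    rewrite [X in _ = _ + X]big1 ?addr0 // => i /negbTE ->.
    by rewrite big1.
  rewrite -big_split; apply: eq_bigr => i _; rewrite -big_split.
  apply: eq_bigr => j /andP[ij _]; rewrite /D' /= !(inj_eq (bij_inj c_bij)).
  case: eqVneq ij => [->|_]; case: eqVneq => [->|_]; rewrite ?ltnn // => _; ring.
rewrite mulrC -[RHS]mulrA -ksgnD; congr (_ * _).
have -> : Q + R + (P + R) = P + Q + (R + R) by ring.
by rewrite [RHS]ksgnD ksgnDD mulr1.
Qed.

Lemma tmap_lin : linear (tmap (fun=> 0) u).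
Proof. by rewrite tmapE; apply/plift_linear/F_compat. Qed.

Lemma tmap_prj i x : tmap (fun=> 0) u (prj i x) = prj i (tmap (fun=> 0) u x).
Proof.
move: x; apply: pres_ext.
- exact: (lin_comp tmap_lin (@prj_lin (tens V) i)).
- exact: (lin_comp (@prj_lin (tens W) i) tmap_lin).
move=> g; rewrite [prj _ _]gprj_gen; last exact: trel_deg.
rewrite tmapE plift_gen; last exact: F_compat.
rewrite [RHS](linZ (@prj_lin (tens W) i)).
rewrite [prj _ _]gprj_gen; last exact: trel_deg.
have -> : tdeg (fun i => g.1 (c i), fun i => u i (g.2 (c i))) = tdeg g.
  by rewrite /tdeg /= [RHS](reindex c) //; apply: onW_bij.
case: ifP => _; first by rewrite plift_gen //; apply: F_compat.
rewrite scaler0; apply/lin0/plift_linear/F_compat.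
Qed.

Lemma tmap_dif x : tmap (fun=> 0) u (dif x) = dif (tmap (fun=> 0) u x).
Proof.
move: x; apply: pres_ext.
- exact: (lin_comp tmap_lin (@dif_lin (tens V))).
- exact: (lin_comp (@dif_lin (tens W)) tmap_lin).
move=> g; rewrite [dif _]plift_gen; last exact: tdif_compat.
rewrite tmapE plift_gen; last exact: F_compat.
rewrite [RHS](linZ (@dif_lin (tens W))).
rewrite [dif _]plift_gen; last exact: tdif_compat.
rewrite linS; last exact/plift_linear/F_compat.
rewrite (reindex c) /=; last exact: onW_bij.
rewrite scaler_sumr; apply: eq_bigr => i _.
rewrite linZ; last exact/plift_linear/F_compat.
rewrite plift_gen; last exact: F_compat.
rewrite /F !scalerA koszul_dif; congr (_ *: gen _ (_, _)).
  apply: functional_extensionality_dep => j.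
  by rewrite /= (inj_eq (bij_inj c_bij)).
apply: functional_extensionality_dep => j /=.
by rewrite (inj_eq (bij_inj c_bij)); case: ifP => // _; rewrite cfun_dif.
Qed.

End TensorMap.

(* The direct sum of the P i (x) Q i, where p (x) q and u p (x) v q are     *)
(* identified for all pairs (u, v) in arr.                                  *)
Section QuotientTensor.
Variables (I : Type) (P Q : I -> complex).
Variable arr : forall i j, cmap (P i) (P j) -> cmap (Q i) (Q j) -> Prop.

(* QGen i a b p q stands for the tensor product of the component of degree  *)
(* a of p and the component of degree b of q.                               *)
Record qgen := QGen { qi : I; qa : int; qb : int; qp : P qi; qq : Q qi }.

Inductive qrel : seq (K * qgen) -> Prop :=
| qrel_linl i a b k p p' q :
    qrel [:: (1, @QGen i a b (k *: p + p') q); (- k, QGen a b p q);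
             (-1, QGen a b p' q)]
| qrel_linr i a b k p q q' :
    qrel [:: (1, @QGen i a b p (k *: q + q')); (- k, QGen a b p q);
             (-1, QGen a b p q')]
| qrel_prj i a b p q :
    qrel [:: (1, @QGen i a b p q); (-1, QGen a b (prj a p) (prj b q))]
| qrel_arr i j u v a b p q : @arr i j u v ->
    qrel [:: (1, QGen a b p q); (-1, QGen a b (u p) (v q))].

Definition qdeg (g : qgen) : int := qa g + qb g.

Definition qdif (g : qgen) : pres qrel :=
  let: QGen i a b p q := g in
  gen qrel (QGen (a - 1) b (dif p) q) +
  ksgn a *: gen qrel (QGen a (b - 1) p (dif q)).

Lemma qrelP (W : lmodType K) (F : qgen -> W) :
  (forall i a b (q : Q i), linear (fun p => F (@QGen i a b p q))) ->
  (forall i a b (p : P i), linear (fun q => F (@QGen i a b p q))) ->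
  (forall i a b p q, F (@QGen i a b p q) = F (QGen a b (prj a p) (prj b q))) ->
  (forall i j u v a b p q, @arr i j u v ->
     F (QGen a b p q) = F (QGen a b (u p) (v q))) ->
  compat qrel F.
Proof.
move=> Fl Fr Fp Fa r [i a b k p p' q|i a b k p q q'|i a b p q|i j u v a b p q uv];
  rewrite /ev !big_cons big_nil /= !scaleNr !scale1r addr0.
- by rewrite Fl -opprD subrr.
- by rewrite Fr -opprD subrr.
- by rewrite Fp subrr.
by rewrite (Fa _ _ _ _ _ _ _ _ uv) subrr.
Qed.

Lemma qgen_linl i a b (q : Q i) : linear (fun p => gen qrel (@QGen i a b p q)).
Proof.
move=> k p p'; have := gen_compat (qrel_linl a b k p p' q).
rewrite /ev !big_cons big_nil /= scale1r scaleNr scaleN1r addr0 -opprD.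
by move/eqP; rewrite subr_eq0 => /eqP.
Qed.

Lemma qgen_linr i a b (p : P i) : linear (fun q => gen qrel (@QGen i a b p q)).
Proof.
move=> k q q'; have := gen_compat (qrel_linr a b k p q q').
rewrite /ev !big_cons big_nil /= scale1r scaleNr scaleN1r addr0 -opprD.
by move/eqP; rewrite subr_eq0 => /eqP.
Qed.

Lemma qgen_prj i a b (p : P i) (q : Q i) :
  gen qrel (QGen a b p q) = gen qrel (QGen a b (prj a p) (prj b q)).
Proof.
have := gen_compat (qrel_prj a b p q).
rewrite /ev !big_cons big_nil /= scale1r scaleN1r addr0.
by move/eqP; rewrite subr_eq0 => /eqP.
Qed.

Lemma qgen_arr i j u v a b (p : P i) (q : Q i) : @arr i j u v ->
  gen qrel (QGen a b p q) = gen qrel (QGen a b (u p) (v q)).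
Proof.
move=> uv; have := gen_compat (qrel_arr a b p q uv).
rewrite /ev !big_cons big_nil /= scale1r scaleN1r addr0.
by move/eqP; rewrite subr_eq0 => /eqP.
Qed.

Lemma qrel_deg r : qrel r -> exists m, all (fun kx => qdeg kx.2 == m) r.
Proof.
by case=> [i a b *|i a b *|i a b *|i j u v a b *]; exists (a + b);
  rewrite /= /qdeg /= !eqxx.
Qed.

Lemma lin_add (V W : lmodType K) (u v : V -> W) k :
  linear u -> linear v -> linear (fun x => u x + k *: v x).
Proof.
move=> lu lv a x y; rewrite lu lv !scalerDr !scalerA [k * a]mulrC.
by rewrite !addrA; congr (_ + _); rewrite addrAC.
Qed.

Lemma qdif_compat : compat qrel qdif.
Proof.
apply: qrelP => [i a b q|i a b p|i a b p q|i j u v a b p q uv] /=.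
- apply: lin_add (qgen_linl _ _ _).
  exact: (lin_comp (qgen_linl _ _ _) (@dif_lin _)).
- apply: lin_add; first exact: qgen_linr.
  exact: (lin_comp (qgen_linr _ _ _) (@dif_lin _)).
- congr (_ + _ *: _); rewrite qgen_prj [RHS]qgen_prj.
    by rewrite dif_prj !prj_prj !eqxx.
  by rewrite dif_prj !prj_prj !eqxx.
by rewrite (qgen_arr _ _ _ _ uv) -cfun_dif (qgen_arr _ _ p _ uv) -cfun_dif.
Qed.

Lemma qdif_deg g : gprj qdeg (qdeg g - 1) (qdif g) = qdif g.
Proof.
case: g => i a b p q; have l := gprj_lin qrel_deg.
rewrite (linD (l _)) (linZ (l _)) !gprj_gen; try exact: qrel_deg.
by rewrite /qdeg /= addrAC addrA !eqxx.
Qed.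

Lemma qdif_qdif g : plift qdif (qdif g) = 0.
Proof.
case: g => i a b p q; have l := plift_linear qdif_compat.
rewrite (linD l) (linZ l) !plift_gen; try exact: qdif_compat.
rewrite /= !dif_dif (lin0 (qgen_linl _ _ _)) (lin0 (qgen_linr _ _ _)).
by rewrite add0r scaler0 addr0 -scalerDl ksgnD ksgnN ksgn1 mulrN1 addNr scale0r.
Qed.

Definition qtens : complex := gcomplex qrel_deg qdif_compat qdif_deg qdif_qdif.

End QuotientTensor.

Section QuotientTensorMap.
Variables (I I' : Type) (P Q : I -> complex) (P' Q' : I' -> complex).
Variable arr : forall i j, cmap (P i) (P j) -> cmap (Q i) (Q j) -> Prop.
Variable arr' : forall i j, cmap (P' i) (P' j) -> cmap (Q' i) (Q' j) -> Prop.
Variable f : I -> I'.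

(* The map induced by the u i (x) v i, where v i has degree e.              *)
Definition qmap (e : int) (u : forall i, P i -> P' (f i))
    (v : forall i, Q i -> Q' (f i)) : qtens arr -> qtens arr' :=
  plift (fun g : qgen P Q => let: QGen i a b p q := g in
    ksgn (e * a) *: gen (qrel arr') (QGen a (b + e) (u i p) (v i q))).

Variables (u : forall i, cmap (P i) (P' (f i))) (v : forall i, cmap (Q i) (Q' (f i))).
Hypothesis uv_arr : forall i j u1 v1, @arr i j u1 v1 -> exists u2 v2,
  [/\ @arr' (f i) (f j) u2 v2, forall p, u j (u1 p) = u2 (u i p)
    & forall q, v j (v1 q) = v2 (v i q)].

Let F (g : qgen P Q) : qtens arr' :=
  let: QGen i a b p q := g in gen (qrel arr') (QGen a b (u i p) (v i q)).

Let qmapE : qmap 0 u v = plift F.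
Proof.
congr plift; apply: functional_extensionality_dep => -[i a b p q] /=.
by rewrite mul0r addr0 [ksgn 0]expr0 scale1r.
Qed.

Let F_compat : compat (qrel arr) F.
Proof.
apply: qrelP => [i a b q|i a b p|i a b p q|i j u1 v1 a b p q uv] /=.
- exact: (lin_comp (@qgen_linl _ _ _ _ _ _ _ _) (@cfun_lin _ _ (u i))).
- exact: (lin_comp (@qgen_linr _ _ _ _ _ _ _ _) (@cfun_lin _ _ (v i))).
- by rewrite qgen_prj !cfun_prj.
have [u2 [v2 [uv2 -> ->]]] := uv_arr uv; exact: qgen_arr uv2.
Qed.

Lemma qmap_lin : linear (qmap 0 u v).
Proof. by rewrite qmapE; apply/plift_linear/F_compat. Qed.

Lemma qmap_prj i x : qmap 0 u v (prj i x) = prj i (qmap 0 u v x).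
Proof.
move: x; apply: pres_ext.
- exact: (lin_comp qmap_lin (@prj_lin (qtens arr) i)).
- exact: (lin_comp (@prj_lin (qtens arr') i) qmap_lin).
move=> g; rewrite [prj _ _]gprj_gen; last exact: qrel_deg.
rewrite qmapE plift_gen; last exact: F_compat.
case: g => j a b p q; rewrite [RHS]gprj_gen; last exact: qrel_deg.
rewrite /qdeg /=; case: ifP => _; first by rewrite plift_gen //; apply: F_compat.
exact/lin0/plift_linear/F_compat.
Qed.

Lemma qmap_dif x : qmap 0 u v (dif x) = dif (qmap 0 u v x).
Proof.
move: x; apply: pres_ext.
- exact: (lin_comp qmap_lin (@dif_lin (qtens arr))).
- exact: (lin_comp (@dif_lin (qtens arr')) qmap_lin).
have l := plift_linear F_compat.
case=> i a b p q; rewrite [dif _]plift_gen; last exact: qdif_compat.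
rewrite qmapE plift_gen; last exact: F_compat.
rewrite [RHS]plift_gen; last exact: qdif_compat.
rewrite (linD l) (linZ l) !plift_gen; try exact: F_compat.
by rewrite /= !cfun_dif.
Qed.

Definition qcmap : cmap (qtens arr) (qtens arr') := Cmap qmap_lin qmap_prj qmap_dif.

Lemma qcmap_gen i a b p q :
  qcmap (gen (qrel arr) (@QGen _ P Q i a b p q)) =
  gen (qrel arr') (QGen a b (u i p) (v i q)).
Proof. by rewrite /= qmapE plift_gen //; apply: F_compat. Qed.

End QuotientTensorMap.
Arguments qmap {I I' P Q P' Q'} arr arr' f e u v _.

Definition idcmap (V : complex) : cmap V V.
Proof. by exists (fun x => x). Defined.

Definition zcmap (V W : complex) : cmap V W.
Proof.
exists (fun=> 0) => [a x y|i x|x]; first by rewrite scaler0 addr0.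
  by rewrite lin0 //; apply: prj_lin.
by rewrite lin0 //; apply: dif_lin.
Defined.

(* K concentrated in degree 0 *)
Definition Kcomplex : complex.
Proof.
exists K^o (fun i x => if i == 0 then x else 0) (fun=> 0) => /=.
- by move=> i a x y; case: ifP => // _; rewrite scaler0 addr0.
- move=> i j x; case: (eqVneq i j) => [->|ij]; first by case: (j == 0).
  by case: (i =P 0) ij => // ->; case: (j =P 0) => // ->.
- by move=> x; exists [:: 0] => //; rewrite big_seq1.
- by move=> a x y; rewrite scaler0 addr0.
- by move=> i x; case: ifP.
by [].
Defined.

Definition zcomplex : complex.
Proof.
exists 'rV[K]_0 (fun=> id) (fun=> 0) => //=.
- by move=> i j x; case: ifP => // _; rewrite [x]thinmx0.
- by move=> x; exists [::]; rewrite ?big_nil ?[x]thinmx0.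
by move=> a x y; rewrite scaler0 addr0.
Defined.

Section Bijections.
Variable sym : bool.

Definition obid n : obij sym n n.
Proof. by exists id id. Defined.

Definition obcast m n (e : m = n) : obij sym m n.
Proof.
exists (cast_ord e) (cast_ord (esym e)) => //.
  exact: cast_ordK.
exact: cast_ordKV.
Defined.

Definition obcomp m n p (b' : obij sym n p) (b : obij sym m n) : obij sym m p.
Proof.
exists (fun i => b' (b i)) (fun i => oinv b (oinv b' i)).
- by move=> i; rewrite !ofunK.
- by move=> i; rewrite !oinvK.
by move=> s i j ij; do 2!apply: omono => //.
Defined.

Lemma obij_eq m n (b b' : obij sym m n) : b =1 b' -> b = b'.
Proof.
case: b b' => f g fK gK mo [f' g' fK' gK' mo'] /= ff'.
have ef : f = f' by apply: functional_extensionality_dep.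
subst f'; have eg : g = g'.
  by apply: functional_extensionality_dep => i; rewrite -{1}(gK' i) fK.
subst g'; congr Obij; exact: Prop_irrelevance.
Qed.

Lemma obij_card m n (b : obij sym m n) : m = n.
Proof.
by rewrite -(card_ord m) -(card_ord n); apply: (bij_eq_card (Bijective (ofunK b) (oinvK b))).
Qed.

Lemma Rank_lt n (p : 'I_n -> nat) i (j : 'I_(p i)) i' (j' : 'I_(p i')) :
  (tagnat.Rank i j < tagnat.Rank i' j')%N = (i < i')%N || (i == i') && (j < j')%N.
Proof.
pose T k := 'I_(p k).
have := tagnat.lt_rank (Tagged T j) (Tagged T j'); rewrite ltEord ltEsig /= => ->.
case: (eqVneq i i') => [e|ne].
  subst i'; by rewrite lexx ltnn /= tagged_asE.
rewrite andFb orbF leEord; case: (ltngtP i i') => //= /ord_inj ii'.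
by rewrite ii' eqxx in ne.
Qed.

(* Regrouping of blocks: given l identifying {(i, k)} with 'I_s, the        *)
(* bijection ((i, k), u) |-> (l (i, k), u).                                 *)
Section Regroup.
Variables (r s : nat) (phi : 'I_r -> nat) (psi : 'I_s -> nat).
Variable l : obij sym (\sum_i phi i)%N s.

Let sz := (\sum_i \sum_(k < phi i) psi (l (tagnat.Rank i k)))%N.

Let rg2 i (p : {k & 'I_(psi (l (tagnat.Rank i k)))}) :
    'I_(\sum_j psi j)%N := tagnat.Rank (l (tagnat.Rank i (tag p))) (tagged p).

Definition rg (z : 'I_sz) : 'I_(\sum_j psi j)%N :=
  let p := tagnat.sig z in rg2 (tagnat.sig (tagged p)).

Lemma rgE i (k : 'I_(phi i)) (u : 'I_(psi (l (tagnat.Rank i k)))) :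
  rg (tagnat.Rank i (tagnat.Rank k u)) = tagnat.Rank (l (tagnat.Rank i k)) u.
Proof. by rewrite /rg {1}/tagnat.Rank tagnat.rankK /= {1}/tagnat.Rank tagnat.rankK. Qed.

Let rg_ind (P : 'I_sz -> Prop) :
  (forall i k u, P (tagnat.Rank i (tagnat.Rank k u))) -> forall z, P z.
Proof. by move=> h z; rewrite -(tagnat.sig2K z) -(tagnat.sig2K (tagnat.sig2 z)). Qed.

Lemma rg_inj : injective rg.
Proof.
elim/rg_ind=> i k u; elim/rg_ind=> i' k' u'; rewrite !rgE => /(congr1 val)/eqP.
rewrite /= tagnat.eq_Rank => /andP[/eqP /(can_inj (ofunK l)) /(congr1 val)/eqP].
rewrite /= tagnat.eq_Rank => /andP[/eqP ii']; subst i' => /eqP/ord_inj kk'.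
by subst k' => /eqP/ord_inj ->.
Qed.

Lemma rg_surj v : exists z, rg z = v.
Proof.
rewrite -(tagnat.sig2K v); move: (tagnat.sig1 v) (tagnat.sig2 v) => j.
rewrite -(oinvK l j) -(tagnat.sig2K (oinv l j)) => u.
by eexists; apply: rgE.
Qed.

Definition obregroup : obij sym sz (\sum_j psi j)%N.
Proof.
exists rg (fun v => projT1 (cid (rg_surj v))).
- by move=> z; apply: rg_inj; case: cid.
- by move=> v; case: cid.
move=> s0; elim/rg_ind=> i k u; elim/rg_ind=> i' k' u'; rewrite !rgE !Rank_lt.
case/orP=> [ii'|/andP[/eqP ii']].
  by apply/orP; left; apply: omono => //; rewrite Rank_lt ii'.
subst i'; rewrite Rank_lt => /orP[kk'|/andP[/eqP kk']].
  by apply/orP; left; apply: omono => //; rewrite Rank_lt eqxx kk' orbT.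
by subst k' => uu'; rewrite eqxx uu' orbT.
Defined.

End Regroup.
End Bijections.

(* The component of x_0 (x) ... (x) x_(n-1) of multidegree deg, and maps     *)
(* given on such elements                                                   *)
Definition tpure n (V : 'I_n -> complex) (deg : 'I_n -> int)
  (x : forall i, V i) : tens V := gen (@trel n V) (deg, x).

Definition tlift n (V : 'I_n -> complex) (W : lmodType K)
  (F : ('I_n -> int) -> (forall i, V i) -> W) : tens V -> W :=
  plift (fun g : tgen V => F g.1 (fun i => prj (g.1 i) (g.2 i))).

Section TensorPowers.
Variable sym : bool.

Definition tcmap m n (V : 'I_m -> complex) (W : 'I_n -> complex)
    (b : obij sym m n) (u : forall i, cmap (V (oinv b i)) (W i)) :
    cmap (tens V) (tens W) :=
  let bb := Bijective (oinvK b) (ofunK b) in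
  Cmap (tmap_lin bb u) (tmap_prj bb u) (tmap_dif bb u).

End TensorPowers.

Definition tpow (A : complex) n : complex := tens (fun _ : 'I_n => A).

(* The left action of bijections on tensor powers, with the Koszul sign.    *)
Definition tpact sym (A : complex) m n (b : obij sym m n) :
    cmap (tpow A m) (tpow A n) :=
  @tcmap sym m n (fun=> A) (fun=> A) b (fun=> idcmap A).

Definition pact (A : complex) n (s : 'S_n) : tpow A n -> tpow A n :=
  @tmap n n (fun=> A) (fun=> A) (fun i => (s^-1)%g i) (fun=> 0) (fun=> id).

(* A^{(x) 1} = A *)
Definition tpow1 (A : complex) : tpow A 1 -> A :=
  tlift (fun deg x => x ord0).

Definition tpurec (A : complex) n (deg : 'I_n -> int) (x : 'I_n -> A) : tpow A n :=
  tpure deg x.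

(* A^{(x) p} x A^{(x) q} -> A^{(x) (p + q)} *)
Definition tcat (A : complex) p q (s : tpow A p) (t : tpow A q) : tpow A (p + q) :=
  tlift (fun ds x => tlift (fun dt y =>
      tpurec
        (fun i => match fintype.split i with inl j => ds j | inr j => dt j end)
        (fun i => match fintype.split i with inl j => x j | inr j => y j end))
    t) s.

(* u (x) v : A^{(x) (p + q)} -> B^{(x) (p + q)}, where v has degree e.      *)
Definition tprod (A B : complex) p q (e : int) (u : tpow A p -> tpow B p)
    (v : tpow A q -> tpow B q) : tpow A (p + q) -> tpow B (p + q) :=
  tlift (fun deg (x : 'I_(p + q) -> A) => ksgn (e * \sum_(i < p) deg (lshift q i)) *:
    tcat (u (tpurec (deg \o @lshift p q) (x \o @lshift p q)))
         (v (tpurec (deg \o @rshift p q) (x \o @rshift p q)))).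

Section Sequences.
Variable sym : bool.

(* For sym = true, a symmetric sequence, given as a functor on the groupoid *)
(* of the 'I_n and their bijections (so that 'S_n acts on the left on       *)
(* C n); for sym = false, a sequence of chain complexes.                    *)
Record sseq := SSeq {
  sob :> nat -> complex;
  sact : forall m n, obij sym m n -> cmap (sob m) (sob n);
  sact_id : forall n (b : obij sym n n) x, b =1 id -> sact b x = x;
  sact_comp : forall m n p (b : obij sym m n) (b' : obij sym n p) x,
    sact (obcomp b' b) x = sact b' (sact b x) }.

Record smap (M N : sseq) := SMap {
  sfun :> forall n, cmap (M n) (N n);
  sfun_act : forall m n (b : obij sym m n) x, sfun n (sact M b x) = sact N b (sfun m x) }.

(* M[A] = \bigoplus_n M(n) (x)_{Sigma_n} A^{(x) n}, the coinvariants of the *)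
(* diagonal action.                                                         *)
Inductive schur_arr (M : sseq) (A : complex) :
    forall m n, cmap (M m) (M n) -> cmap (tpow A m) (tpow A n) -> Prop :=
| SchurArr m n (b : obij sym m n) : schur_arr (sact M b) (tpact A b).

Definition schur (M : sseq) (A : complex) : complex :=
  qtens (@schur_arr M A).

(* The component of degree (a, b) of the class of m (x) t, and maps given   *)
(* on such elements                                                         *)
Definition spure (M : sseq) (A : complex) n (a b : int) (m : M n) (t : tpow A n) :
  schur M A := gen (qrel (@schur_arr M A)) (QGen a b m t).

Definition slift (M : sseq) (A : complex) (W : lmodType K)
  (F : forall n, int -> int -> M n -> tpow A n -> W) : schur M A -> W :=
  plift (fun g : qgen M (tpow A) =>
    F (qi g) (qa g) (qb g) (prj (qa g) (qp g)) (prj (qb g) (qq g))).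

(* The summands of (M o N)(n): the r-tuples of elements of N of arities     *)
(* cbr i, whose inputs, in lexicographic order, are labelled by clab.       *)
Record cidx n := CIdx {
  cr : nat;
  cbr : 'I_cr -> nat;
  clab : obij sym (\sum_i cbr i)%N n }.
Arguments cbr {n} c i.

Section Composition.
Variables M N : sseq.

Inductive comp_arr n (s t : cidx n) : cmap (M (cr s)) (M (cr t)) ->
    cmap (tens (fun i => N (cbr s i))) (tens (fun i => N (cbr t i))) -> Prop :=
| CompArr (b : obij sym (cr s) (cr t))
    (rho : forall i, obij sym (cbr s (oinv b i)) (cbr t i)) :
    (forall i k, clab t (tagnat.Rank i (rho i k)) =
                 clab s (tagnat.Rank (oinv b i) k)) ->
    comp_arr (sact M b) 
      (@tcmap sym _ _ (fun i => N (cbr s i)) (fun i => N (cbr t i)) b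
         (fun i => sact N (rho i))).

(* (M o N)(n) *)
Definition comp_ob n : complex := qtens (@comp_arr n).

Definition crelab m n (b : obij sym m n) (s : cidx m) : cidx n :=
  CIdx (obcomp b (clab s)).

Lemma crelab_arr m n (b : obij sym m n) (s t : cidx m) u v :
  @comp_arr m s t u v -> exists u2 v2,
  [/\ @comp_arr n (crelab b s) (crelab b t) u2 v2,
      forall p, idcmap _ (u p) = u2 (idcmap _ p)
    & forall q, idcmap _ (v q) = v2 (idcmap _ q)].
Proof.
case=> c rho h; exists (sact M c).
exists (@tcmap sym _ _ (fun i => N (cbr s i)) (fun i => N (cbr t i)) c
         (fun i => sact N (rho i))).
split=> //; apply: (@CompArr n (crelab b s) (crelab b t)) => i k /=.
by rewrite h.
Qed.

Definition comp_act m n (b : obij sym m n) : cmap (comp_ob m) (comp_ob n) :=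
  @qcmap _ _ _ _ _ _ _ _ (crelab b) (fun=> idcmap _) (fun=> idcmap _) (crelab_arr b).

Lemma comp_act_gen m n (b : obij sym m n) (s : cidx m) x y p q :
  comp_act b (gen (qrel (@comp_arr m)) (@QGen _ _ _ s x y p q)) =
  gen (qrel (@comp_arr n)) (@QGen _ _ _ (crelab b s) x y p q).
Proof. exact: qcmap_gen. Qed.

Lemma comp_act_id n (b : obij sym n n) x : b =1 id -> comp_act b x = x.
Proof.
move=> b1; move: x; apply: pres_ext.
- exact: (@cfun_lin _ _ (comp_act b)).
- by [].
case=> s x y p q; rewrite comp_act_gen; congr gen.
case: s p q => r phi l p q; rewrite /crelab /= (_ : obcomp b l = l) //.
by apply: obij_eq => i /=.
Qed.

Lemma comp_act_comp m n p (b : obij sym m n) (b' : obij sym n p) x :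
  comp_act (obcomp b' b) x = comp_act b' (comp_act b x).
Proof.
move: x; apply: pres_ext; first exact: (@cfun_lin _ _ (comp_act (obcomp b' b))).
  exact: (lin_comp (@cfun_lin _ _ (comp_act b')) (@cfun_lin _ _ (comp_act b))).
case=> s x y u v; rewrite !comp_act_gen; congr gen.
rewrite /crelab /=.
have -> // : obcomp (obcomp b' b) (clab s) = obcomp b' (obcomp b (clab s)).
exact: obij_eq.
Qed.

Definition scomp : sseq := SSeq comp_act_id comp_act_comp.

End Composition.

Definition cpure (M N : sseq) n (s : cidx n) (a b : int) (m : M (cr s))
  (x : tens (fun i => N (cbr s i))) : scomp M N n :=
  gen (qrel (@comp_arr M N n)) (@QGen _ _ _ s a b m x).

Definition clift (M N : sseq) n (W : lmodType K)
  (F : forall s : cidx n, int -> int -> M (cr s) ->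
       tens (fun i => N (cbr s i)) -> W) : scomp M N n -> W :=
  plift (fun g : qgen (fun s : cidx n => M (cr s))
                      (fun s => tens (fun i => N (cbr s i))) =>
    F (qi g) (qa g) (qb g) (prj (qa g) (qp g)) (prj (qb g) (qq g))).

(* The unit of the composition product: K in arity 1. *)
Definition unit_ob n : complex :=
  match n with 1%N => Kcomplex | _ => zcomplex end.

Definition unit_act m n (b : obij sym m n) : cmap (unit_ob m) (unit_ob n) :=
  match m, n return cmap (unit_ob m) (unit_ob n) with
  | 1%N, 1%N => idcmap Kcomplex
  | _, _ => zcmap _ _
  end.

Lemma unit_ob0 n (x : unit_ob n) : n != 1%N -> x = 0.
Proof. by case: n x => [|[|n]] x //= _; rewrite [LHS]thinmx0. Qed.

Lemma unit_act_id n (b : obij sym n n) x : b =1 id -> unit_act b x = x.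
Proof.
by case: (eqVneq n 1%N) b x => [->|n1] b x // _; rewrite [LHS]unit_ob0 // [RHS]unit_ob0.
Qed.

Lemma unit_act_comp m n p (b : obij sym m n) (b' : obij sym n p) x :
  unit_act (obcomp b' b) x = unit_act b' (unit_act b x).
Proof.
have nm := obij_card b; have np := obij_card b'; subst n p.
case: (eqVneq m 1%N) b b' x => [->|n1] b b' x //.
by rewrite [LHS]unit_ob0 // [RHS]unit_ob0.
Qed.

Definition sunit : sseq := SSeq unit_act_id unit_act_comp.

(* u o v : M o N -> M' o N' *)
Definition comp_map (M M' N N' : sseq) (u : forall n, M n -> M' n)
    (v : forall n, N n -> N' n) n : scomp M N n -> scomp M' N' n :=
  qmap (@comp_arr M N n) (@comp_arr M' N' n) id 0
    (fun s : cidx n => u (cr s))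
    (fun s : cidx n => @tmap _ _ (fun i => N (cbr s i)) (fun i => N' (cbr s i))
                         id (fun=> 0) (fun i => v (cbr s i))).

(* The Koszul sign of reordering x_0 ... x_(r-1) y_0 ... y_(s-1) into      *)
(* x_0 Y_0 ... x_(r-1) Y_(r-1), where Y_i consists of the y_(l (i, k)) for  *)
(* k < phi i.                                                               *)
Definition shuffle_sign r (phi : 'I_r -> nat) s (l : 'I_(\sum_i phi i)%N -> 'I_s)
    (dx : 'I_r -> int) (dy : 'I_s -> int) : K :=
  koszul l dy *
  ksgn (\sum_(i < r) \sum_(i' < r | (i < i')%N)
          dx i' * \sum_(k < phi i) dy (l (tagnat.Rank i k))).

(* The associator (M o N) o P -> M o (N o P) sends ((m; x_i); y_j) to       *)
(* (m; (x_i; y_j, where j runs over the inputs of x_i)).                    *)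
Section Associator.
Variables (M N P : sseq) (n : nat).

Definition assoc_inner (s : cidx n) (t : cidx (cr s)) (i : 'I_(cr t)) :
    cidx (\sum_(k < cbr t i) cbr s (clab t (tagnat.Rank i k)))%N :=
  CIdx (obid sym (\sum_(k < cbr t i) cbr s (clab t (tagnat.Rank i k)))%N).

Definition assoc_outer (s : cidx n) (t : cidx (cr s)) : cidx n :=
  CIdx (obcomp (clab s) (obregroup (cbr s) (clab t))).

Definition assoc : scomp (scomp M N) P n -> scomp M (scomp N P) n :=
  clift (fun s a b q y => clift (fun t a' b' m x =>
  tlift (fun dx x => tlift (fun dy y =>
    let l i k := clab t (tagnat.Rank i k) in
    let D i := \sum_(k < cbr t i) dy (l i k) in
    shuffle_sign (clab t) dx dy *:
    @cpure M (scomp N P) n (assoc_outer t) a' (b' + b) m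
      (tpure (fun i => dx i + D i) (fun i =>
        @cpure N P _ (assoc_inner i) (dx i) (D i) (x i)
          (tpure (fun k => dy (l i k)) (fun k => y (l i k))))))
    y) x) q).

End Associator.

(* The comparison (M o N)[A] -> M[N[A]] *)
Definition schur_comp (M N : sseq) (A : complex) :
    schur (scomp M N) A -> schur M (schur N A) :=
  slift (fun n a b (q : scomp M N n) y => clift (fun (t : cidx n) a' b' m x =>
  tlift (fun dx x => tlift (fun dy (y : 'I_n -> A) =>
    let l i k := clab t (tagnat.Rank i k) in
    let D i := \sum_(k < cbr t i) dy (l i k) in
    shuffle_sign (clab t) dx dy *:
    spure a' (b' + b) m
      (tpurec (fun i => dx i + D i) (fun i =>
        spure (dx i) (D i) (x i)
          (tpurec (fun k => dy (l i k)) (fun k => y (l i k))))))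
    y) x) q).

Lemma ord_sum1 n : (\sum_(i < n) 1)%N = n.
Proof. by rewrite sum1_card card_ord. Qed.

(* A comonoid for the composition product; the right-hand sides of counit_l *)
(* and counit_r are the images of c in (unit o C)(n) and (C o unit)(n).     *)
Record cooperad := Cooperad {
  coop :> sseq;
  comult : smap coop (scomp coop coop);
  counit : smap coop sunit;
  comult_assoc : forall n (c : coop n),
    assoc (comp_map (fun k => comult k) (fun=> id) (comult n c)) =
    comp_map (fun=> id) (fun k => comult k) (comult n c);
  counit_l : forall n b (c : coop n), prj b c = c ->
    comp_map (fun k => counit k) (fun=> id) (comult n c) =
    @cpure sunit coop n (@CIdx n 1 (fun=> n) (obcast sym (big_ord1 _ _))) 0 b
      (1 : Kcomplex) (tpure (fun=> b) (fun=> c));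
  counit_r : forall n a (c : coop n), prj a c = c ->
    comp_map (fun=> id) (fun k => counit k) (comult n c) =
    @cpure coop sunit n (@CIdx n n (fun=> 1%N) (obcast sym (ord_sum1 n))) a 0
      c (tpure (fun=> 0) (fun=> (1 : Kcomplex))) }.

End Sequences.

(* u is a graded map of degree e.                                           *)
Definition graded (V W : complex) (e : int) (u : V -> W) : Prop :=
  linear u /\ forall i x, u (prj i x) = prj (i + e) (u x).

(* The boundary of a map of degree e in the complex of maps                 *)
Definition bdry (V W : complex) (e : int) (u : V -> W) (x : V) : W :=
  dif (u x) - ksgn e *: u (dif x).

Record contraction (A B : complex) (f : A -> B) (g : B -> A) (h : A -> A) : Prop := {
  contr_f_deg : graded 0 f;
  contr_g_deg : graded 0 g;
  contr_h_deg : graded 1 h;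
  contr_f_bdry : forall x, bdry 0 f x = 0;
  contr_g_bdry : forall x, bdry 0 g x = 0;
  contr_h_bdry : forall x, bdry 1 h x = g (f x) - x;
  contr_fg : forall x, f (g x) = x;
  contr_fh : forall x, f (h x) = 0;
  contr_hh : forall x, h (h x) = 0;
  contr_hg : forall x, h (g x) = 0 }.

Definition thick (A B : complex) : Type := forall n, tpow A n -> tpow B n.

Definition is_thick (A B : complex) (e : int) (F : thick A B) : Prop :=
  forall n, graded e (F n).

Definition symmetric_thick (A B : complex) (F : thick A B) : Prop :=
  forall n (s : 'S_n) t, F n (pact s t) = pact s (F n t).

(* For a thick map of degree 0 *)
Definition is_morphism (A B : complex) (F : thick A B) : Prop :=
  forall p q t, F (p + q)%N t = tprod 0 (F p) (F q) t.

(* For a thick map of degree 1 *)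
Definition pseudo_derivation (A : complex) (H : thick A A) : Prop :=
  forall p q t,
    tprod 0 (H p) id (H (p + q)%N t) - tprod 1 id (H q) (H (p + q)%N t)
      = tprod 1 (H p) (H q) t
    /\ H (p + q)%N (tprod 0 (H p) id t - tprod 1 id (H q) t)
      = - tprod 1 (H p) (H q) t.

(* f^{(x) n}, for f of degree 0 *)
Definition tpower (A B : complex) (f : A -> B) : thick A B := fun n =>
  @tmap n n (fun=> A) (fun=> B) id (fun=> 0) (fun=> f).

(* H is a pseudo-derivation extending h and compatible with the f^{(x) n}   *)
(* and g^{(x) n}; symmetry is not required.                                 *)
Record good_pseudo_derivation (A B : complex) (f : A -> B) (g : B -> A)
    (h : A -> A) (H : thick A A) : Prop := {
  gpd_deg : is_thick 1 H;
  gpd_pseudo : pseudo_derivation H;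
  gpd_1 : forall t : tpow A 1, tpow1 (H 1%N t) = h (tpow1 t);
  gpd_bdry : forall n t, bdry 1 (H n) t = tpower g (tpower f t) - t;
  gpd_hh : forall n t, H n (H n t) = 0;
  gpd_fh : forall n t, tpower f (H n t) = 0;
  gpd_hg : forall n t, H n (tpower g t) = 0 }.

(* h_n = \sum_(p + 1 + q = n) 1^{(x) p} (x) h (x) (g f)^{(x) q} *)
Definition tensor_trick (A B : complex) (f : A -> B) (g : B -> A) (h : A -> A) :
    thick A A := fun n t =>
  \sum_(p < n) @tmap n n (fun=> A) (fun=> A) id
    (fun i => if i == p then 1 else 0)
    (fun i => if (i < p)%N then id else if i == p then h else g \o f) t.

(* (1 / n!) \sum_s s^-1 H_n s, for Q -> K *)
Definition symmetrization (iota : {rmorphism rat -> K}) (A : complex)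
    (H : thick A A) : thick A A := fun n t =>
  iota (n`!%:R^-1) *: \sum_(s : 'S_n) pact (s^-1)%g (H n (pact s t)).

Section CoalgebraMaps.
Variable sym : bool.

(* C[F] = \bigoplus_n 1 (x)_{Sigma_n} F_n, for F of degree e               *)
Definition schur_map (M : sseq sym) (A B : complex) (e : int) (F : thick A B) :
    schur M A -> schur M B :=
  qmap (@schur_arr _ M A) (@schur_arr _ M B) id e (fun=> id) F.

Section Blocks.
Variables (M : sseq sym) (A : complex) (n : nat).

(* \bigoplus_r (M(r_0) (x) ... (x) M(r_(n-1)))                              *)
(*    (x)_{Sigma_{r_0} x ... x Sigma_{r_(n-1)}} A^{(x) (r_0 + ... + r_(n-1))} *)
Inductive blocks_arr (r s : 'I_n -> nat) :
    cmap (tens (fun i => M (r i))) (tens (fun i => M (s i))) ->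
    cmap (tpow A (\sum_i r i)%N) (tpow A (\sum_i s i)%N) -> Prop :=
| BlocksArr (rho : forall i, obij sym (r i) (s i))
    (b : obij sym (\sum_i r i)%N (\sum_i s i)%N) :
    (forall i k, b (tagnat.Rank i k) = tagnat.Rank i (rho i k)) ->
    blocks_arr
      (@tcmap sym _ _ (fun i => M (r i)) (fun i => M (s i)) (obid sym n)
         (fun i => sact M (rho i)))
      (tpact A b).

Definition blocks : complex := qtens blocks_arr.

(* The canonical isomorphism of the above with M[A]^{(x) n}, which sends    *)
(* (c_0 ... c_(n-1)) x_0 ... to (c_0 X_0) ... (c_(n-1) X_(n-1)), where X_i  *)
(* is the i-th block of the x's                                             *)
Definition blocks_iso : blocks -> tpow (schur M A) n :=
  plift (fun g : qgen (fun r => tens (fun i => M (r i)))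
                      (fun r => tpow A (\sum_i r i)%N) =>
    tlift (fun dc c => tlift (fun dx (x : 'I_(\sum_i qi g i)%N -> A) =>
      let D i := \sum_(k < qi g i) dx (tagnat.Rank i k) in
      shuffle_sign id dc dx *:
      tpurec (fun i => dc i + D i) (fun i =>
        spure (dc i) (D i) (c i)
          (tpurec (fun k => dx (tagnat.Rank i k)) (fun k => x (tagnat.Rank i k)))))
      (prj (qb g) (qq g))) (prj (qa g) (qp g))).

(* The inverse of the bijection blocks_iso                                  *)
Definition blocks_inv (y : tpow (schur M A) n) : blocks :=
  if pselect (exists x, blocks_iso x = y) is left p then projT1 (cid p) else 0.

End Blocks.

(* The thick map C_\bullet[F], for F of degree e: under the isomorphism     *)
(* blocks_iso, its level n is 1 (x) F_(r_0 + ... + r_(n-1)) on the summand  *)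
(* indexed by r.                                                            *)
Definition thick_schur_map (M : sseq sym) (A B : complex) (e : int)
    (F : thick A B) : thick (schur M A) (schur M B) := fun n y =>
  blocks_iso (qmap (@blocks_arr M A n) (@blocks_arr M B n) id e (fun=> id)
                (fun r => F (\sum_i r i)%N) (blocks_inv y)).

Variable C : cooperad sym.

(* The comonad structure of C[-] *)
Definition schur_comult (A : complex) (x : schur C A) : schur C (schur C A) :=
  schur_comp (qmap (@schur_arr _ C A) (@schur_arr _ (scomp C C) A) id 0
                (fun n => comult C n) (fun=> id) x).

Definition schur_counit (A : complex) : schur C A -> A :=
  slift (fun n a b => match n return C n -> tpow A n -> A with
    | 1%N => fun c t => (counit C 1%N c : K) *: tpow1 t
    | _ => fun _ _ => 0
    end).

Record is_coalgebra (A : complex) (D : A -> schur C A) : Prop := {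
  coalg_deg : graded 0 D;
  coalg_bdry : forall x, bdry 0 D x = 0;
  coalg_assoc : forall x, schur_comult (D x) = schur_map 0 (tpower D) (D x);
  coalg_counit : forall x, schur_counit (D x) = x }.

Record coalgebra_thick_map (A B : complex) (DA : A -> schur C A)
    (DB : B -> schur C B) (e : int) (F : thick A B) : Prop := {
  ctm_deg : is_thick e F;
  ctm_sym : sym -> symmetric_thick F;
  ctm_comult : forall t : tpow A 1,
    DB (tpow1 (F 1%N t)) = schur_map e F (DA (tpow1 t)) }.

Record coalgebra_contraction (A B : complex) (DA : A -> schur C A)
    (DB : B -> schur C B) (F : thick A B) (G : thick B A) (H : thick A A) :
    Prop := {
  cc_A : is_coalgebra DA;
  cc_B : is_coalgebra DB;
  cc_f : coalgebra_thick_map DA DB 0 F;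
  cc_g : coalgebra_thick_map DB DA 0 G;
  cc_h : coalgebra_thick_map DA DA 1 H;
  cc_f_bdry : forall n t, bdry 0 (F n) t = 0;
  cc_g_bdry : forall n t, bdry 0 (G n) t = 0;
  cc_h_bdry : forall n t, bdry 1 (H n) t = G n (F n t) - t;
  cc_fg : forall n t, F n (G n t) = t;
  cc_fh : forall n t, F n (H n t) = 0;
  cc_hh : forall n t, H n (H n t) = 0;
  cc_hg : forall n t, H n (G n t) = 0;
  cc_f_morphism : is_morphism F;
  cc_g_morphism : is_morphism G;
  cc_h_pseudo : pseudo_derivation H }.

End CoalgebraMaps.

End Complexes.

Arguments schur_comult {K sym} C A x.
Arguments thick_schur_map {K sym} M {A B} e F n y.

(* Main.v *)
(* Under blocks_iso, the n-th level of C_bullet[F] is 1 (x) F, so every identity  *)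
(* between thick maps that holds level by level, or that compares F_(p + q) with  *)
(* F_p and F_q, passes from F to C_bullet[F]. Since all structure maps of the     *)
(* cofree coalgebra only regroup tensor factors, C_bullet[F] commutes with them;  *)
(* this gives (a) and (b).                                                        *)
(*                                                                                *)
(* For (c) and (d), A is the direct sum of ker (g f) and im (g f), so A^{(x) n}   *)
(* is the direct sum over R \subset {0, ..., n - 1} of the parts with i-th factor *)
(* in ker (g f) for i in R and in im (g f) otherwise. Write hat_i for h acting on *)
(* the i-th factor; these maps anticommute and square to zero. Both homotopies    *)
(* act on the R-part as \sum_(i in R) w(R, i) hat_i: for the tensor trick w(R, -) *)
(* is the indicator of max R, and averaging over Sigma_n turns it into 1 / #|R|.  *)
(* All required identities become identities between the weights w; for           *)
(* w = 1 / #|R| the pseudo-derivation identity is                                 *)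
(* 1 / (a (a + b)) + 1 / (b (a + b)) = 1 / (a b).                                 *)

From mathcomp Require Import all_boot all_order all_algebra all_fingroup.
From mathcomp Require Import zify ring.
From mathcomp Require Import boolp.
Require Import Defs.

Set Implicit Arguments.
Unset Strict Implicit.
Unset Printing Implicit Defensive.

Import Order.TTheory GRing.Theory Num.Theory.
Local Open Scope ring_scope.

(** * Parity and Koszul signs *)

(** For (a) and (b), [blocks_iso] identifies the n-th tensor power of [C[A]] with operations
    tensored with one long tensor of elements of [A]; its inverse is [blocks_split], by
    [blocks_isoK] and [blocks_splitK]. In this form the n-th level of [thick_schur_map] is 1 (x) F
    ([tsm_pure]), so boundaries, composites and vanishing are inherited from [F], with signs that
    depend only on the degree of the operations ([tsm_bdry], [tsm_comp]). Concatenation in powers of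
    [C[A]] corresponds to concatenation in powers of [A] ([tcat_iso]), which carries over the
    morphism and pseudo-derivation identities ([tprod_tsm]).

    The comultiplication of the cofree coalgebra is that of the cooperad followed by [schur_comp],
    which only separates a tensor into blocks. Hence it is compatible with [F] ([schur_comp_thick]),
    and it is coassociative because [schur_comp] is compatible with the associator ([assoc_schur]).
    All of this requires [F] to commute with the bijections that are divided out ([thick_tpact]):
    every permutation in the symmetric case, only identities in the non-symmetric case. This
    difference is (b).

    For (c) and (d), [sel R] projects onto the part of the tensor power where the factors in [R] lie
    in the kernel of [g f] and the others in its image. On this part the homotopies are weighted
    sums of the operators [hat i], that is, of [h] in one place. For [i] in [R] the graded
    commutator of [hat i] with the differential is -1 ([dif_hat]), so a total weight of 1 gives the
    required boundary ([weight_bdry]). The operators [hat i] anticommute and square to zero, so the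
    pseudo-derivation identities reduce to identities between products of weights ([weight_pseudo]).
    The tensor trick puts all weight on the maximum of [R] ([tensor_trick_sel]). Averaging over
    permutations makes the weight constant on [R] ([mean_weightE], [symmetrization_sel]). *)

Section Parity.

(** Signs are compared through the parities of their exponents, as booleans under [addb], so that a
    sign identity becomes a finite check by cases. *)
Definition par (z : int) : bool := odd `|z|.

Lemma parD a b : par (a + b) = par a (+) par b.
Proof. rewrite /par; lia. Qed.

Lemma parN a : par (- a) = par a.
Proof. by rewrite /par abszN. Qed.

Lemma parM a b : par (a * b) = par a && par b.
Proof. by rewrite /par abszM oddM. Qed.

Lemma par_sum (I : Type) (r : seq I) (P : pred I) (F : I -> int) :
  par (\sum_(i <- r | P i) F i) = \big[addb/false]_(i <- r | P i) par (F i).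
Proof. exact: (big_morph par parD). Qed.

Definition xsum n (F : 'I_n -> bool) := \big[addb/false]_(i < n) F i.
Definition xsum2 n (E : 'I_n -> 'I_n -> bool) := xsum (fun i => xsum (E i)).

Lemma par_xsum n (P : pred 'I_n) (F : 'I_n -> int) :
  par (\sum_(i < n | P i) F i) = xsum (fun i => P i && par (F i)).
Proof. by rewrite par_sum big_mkcond; apply: eq_bigr => i _; case: (P i). Qed.

Lemma par_xsumT n (F : 'I_n -> int) :
  par (\sum_(i < n) F i) = xsum (fun i => par (F i)).
Proof. by rewrite par_xsum. Qed.

Lemma eq_xsum n (F G : 'I_n -> bool) : F =1 G -> xsum F = xsum G.
Proof. by move=> FG; apply: eq_bigr => i _. Qed.

Lemma eq_xsum2 n (E E' : 'I_n -> 'I_n -> bool) : E =2 E' -> xsum2 E = xsum2 E'.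
Proof. by move=> EE'; apply: eq_xsum => i; apply: eq_xsum. Qed.

Lemma xsum0 n : xsum (fun _ : 'I_n => false) = false.
Proof. by rewrite /xsum big1. Qed.

Lemma xsumD n (F G : 'I_n -> bool) :
  xsum (fun i => F i (+) G i) = xsum F (+) xsum G.
Proof. exact: big_split. Qed.

Lemma xsum2D n (E E' : 'I_n -> 'I_n -> bool) :
  xsum2 (fun i j => E i j (+) E' i j) = xsum2 E (+) xsum2 E'.
Proof. by rewrite -xsumD; apply: eq_xsum => i; rewrite -xsumD. Qed.

Lemma xsum_andl n (F : 'I_n -> bool) b : b && xsum F = xsum (fun i => b && F i).
Proof. by case: b => //=; rewrite xsum0. Qed.

Lemma xsum_andr n (F : 'I_n -> bool) b : xsum F && b = xsum (fun i => F i && b).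
Proof. by rewrite andbC xsum_andl; apply: eq_xsum => i; rewrite andbC. Qed.

Lemma xsumC m n (E : 'I_m -> 'I_n -> bool) :
  xsum (fun i => xsum (E i)) = xsum (fun j => xsum (fun i => E i j)).
Proof. exact: exchange_big. Qed.

Lemma xsum_bij m n (c : 'I_m -> 'I_n) (F : 'I_n -> bool) :
  bijective c -> xsum F = xsum (F \o c).
Proof. by move=> cb; rewrite /xsum (reindex c) //; apply: onW_bij. Qed.

Lemma xsum2_bij m n (c : 'I_m -> 'I_n) (E : 'I_n -> 'I_n -> bool) :
  bijective c -> xsum2 E = xsum2 (fun i j => E (c i) (c j)).
Proof.
by move=> cb; rewrite /xsum2 (xsum_bij _ cb); apply: eq_xsum => i; apply: xsum_bij.
Qed.

Lemma big_Rank (R : Type) (idx : R) (op : Monoid.com_law idx) n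
    (p : 'I_n -> nat) (F : 'I_(\sum_i p i)%N -> R) :
  \big[op/idx]_w F w = \big[op/idx]_(i < n) \big[op/idx]_(k < p i) F (tagnat.Rank i k).
Proof.
rewrite (reindex _ tagnat.rank_bij_on) sig_big_dep.
by apply: eq_bigr => q _; rewrite tagnat.rankE.
Qed.

Lemma xsum_Rank n (p : 'I_n -> nat) (F : 'I_(\sum_i p i)%N -> bool) :
  xsum F = xsum (fun i => xsum (fun k : 'I_(p i) => F (tagnat.Rank i k))).
Proof. exact: (big_Rank _ F). Qed.

Lemma xsum2_Rank n (p : 'I_n -> nat) (E : 'I_(\sum_i p i)%N -> 'I_(\sum_i p i)%N -> bool) :
  xsum2 E = xsum2 (fun i i' => xsum (fun k : 'I_(p i) => xsum (fun k' : 'I_(p i') =>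
    E (tagnat.Rank i k) (tagnat.Rank i' k')))).
Proof.
rewrite /xsum2 xsum_Rank; apply: eq_xsum => i; rewrite xsumC.
by rewrite xsum_Rank; apply: eq_xsum => i'; rewrite xsumC.
Qed.

Lemma xsum1 n (i : 'I_n) F : xsum (fun j => (j == i) && F j) = F i.
Proof.
rewrite /xsum (bigD1 i) //= eqxx /= big1 ?addbF // => j ji.
by rewrite (negbTE ji).
Qed.

Lemma xsum2_diag n (F : 'I_n -> bool) : xsum2 (fun i j => (j == i) && F i) = xsum F.
Proof. by apply: eq_xsum => i; rewrite (xsum1 i (fun=> F i)). Qed.

Lemma xsum2_lt n (E : 'I_n -> 'I_n -> bool) :
  xsum2 E = xsum2 (fun i j => (i < j)%N && (E i j (+) E j i)) (+) xsum (fun i => E i i).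
Proof.
rewrite -xsum2_diag -[RHS]addbF.
(* These two sums are transposes of each other and cancel mod 2; adding them allows a comparison
   term by term. *)
have <- : xsum2 (fun i j => (i < j)%N && E j i) (+) xsum2 (fun i j => (j < i)%N && E i j) = false.
  by rewrite /xsum2 xsumC addbb.
rewrite -!xsum2D; apply: eq_xsum2 => i j.
rewrite -(val_eqE j) /=.
by case: (ltngtP i j) => [||/ord_inj ->] /=; rewrite ?addbF //;
  case: (E _ _); case: (E _ _).
Qed.

(** The sign of a reordering is a product over unordered pairs of factors, so only the symmetrized
    summand at each pair matters. This reduces sign identities for permutations to two factors. *)
Lemma xsum2_pair n (E E' : 'I_n -> 'I_n -> bool) :
  (forall i, E i i = E' i i) ->
  (forall i j : 'I_n, (i < j)%N -> E i j (+) E j i = E' i j (+) E' j i) ->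
  xsum2 E = xsum2 E'.
Proof.
move=> Eii Eij; rewrite xsum2_lt [RHS]xsum2_lt; congr (_ (+) _).
  by apply: eq_xsum2 => i j; case: ltnP => // /Eij ->.
exact: eq_xsum.
Qed.

End Parity.

Section Signs.
Variable K : comPzRingType.

Lemma ksgn_par z : ksgn K z = (-1) ^+ par z.
Proof. by rewrite /ksgn /par signr_odd. Qed.

Lemma ksgn_par_eq a b : par a = par b -> ksgn K a = ksgn K b.
Proof. by rewrite !ksgn_par => ->. Qed.

Lemma koszul_par m n (c : 'I_n -> 'I_m) (deg : 'I_m -> int) :
  koszul K c deg = (-1) ^+ xsum2 (fun i j : 'I_n =>
    (i < j)%N && (c j < c i)%N && (par (deg (c i)) && par (deg (c j)))).
Proof.
rewrite /koszul ksgn_par par_xsumT; congr (_ ^+ nat_of_bool _).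
by apply: eq_xsum => i; rewrite par_xsum; apply: eq_xsum => j; rewrite parM.
Qed.

Lemma koszul_mono m n (c : 'I_n -> 'I_m) (deg : 'I_m -> int) :
  (forall i j : 'I_n, (i < j)%N -> (c i <= c j)%N) -> koszul K c deg = 1.
Proof.
move=> mc; rewrite koszul_par [xsum2 _]big1 // => i _; apply: big1 => j _.
by case: ltnP => //= /mc; rewrite leqNgt => /negbTE ->.
Qed.

Lemma sign_sq (b : bool) : (-1) ^+ b * (-1) ^+ b = 1 :> K.
Proof. by rewrite -signr_addb addbb. Qed.

(** A pair is inverted by the composite exactly when one of the two steps inverts it and the other
    does not. *)
Lemma koszul_comp m n p (c : 'I_n -> 'I_m) (c' : 'I_p -> 'I_n) (deg : 'I_m -> int) :
  bijective c -> bijective c' ->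
  koszul K (c \o c') deg = koszul K c deg * koszul K c' (deg \o c).
Proof.
move=> cb c'b; rewrite !koszul_par -signr_addb; congr (_ ^+ nat_of_bool _).
rewrite (xsum2_bij _ c'b) -xsum2D; apply: xsum2_pair => [i|i j ij] /=.
  by rewrite !ltnn.
rewrite (ltnNge j i) (ltnW ij) ij /= addbF.
have : c (c' i) != c (c' j) by rewrite (inj_eq (bij_inj cb)) (inj_eq (bij_inj c'b)) neq_ltn ij.
have : c' i != c' j by rewrite (inj_eq (bij_inj c'b)) neq_ltn ij.
rewrite -!val_eqE /=.
by case: (ltngtP (c' i) (c' j)) => //; case: (ltngtP (c (c' i)) (c (c' j))) => //=;
  case: (par _); case: (par _).
Qed.

End Signs.

(** * Tensor products of complexes *)

Notation dfunext := functional_extensionality_dep (only parsing).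
Arguments cfun_lin {K V W c}.
Arguments qmap {K I I' P Q P' Q'} arr arr' f e u v _.

Section LinearMaps.
Variable K : comPzRingType.

Lemma lin_id (V : lmodType K) : linear (fun x : V => x).
Proof. by []. Qed.

Lemma lin_zero (V W : lmodType K) : linear (fun _ : V => 0 : W).
Proof. by move=> a x y; rewrite scaler0 addr0. Qed.

Lemma lin_scale (V W : lmodType K) k (u : V -> W) :
  linear u -> linear (fun x => k *: u x).
Proof. by move=> lu; move=> a x y; rewrite lu scalerDr !scalerA mulrC. Qed.

Lemma lin_plus (V W : lmodType K) (u v : V -> W) :
  linear u -> linear v -> linear (fun x => u x + v x).
Proof. by move=> lu lv a x y; rewrite lu lv scalerDr addrACA. Qed.

Lemma lin_opp (V W : lmodType K) (u : V -> W) :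
  linear u -> linear (fun x => - u x).
Proof. by move=> lu a x y; rewrite lu opprD scalerN. Qed.

Lemma lin_minus (V W : lmodType K) (u v : V -> W) :
  linear u -> linear v -> linear (fun x => u x - v x).
Proof. by move=> lu lv; apply: lin_plus lu (lin_opp lv). Qed.

Lemma lin_sum (V W : lmodType K) (I : Type) (r : seq I) (P : pred I) (u : I -> V -> W) :
  (forall i, linear (u i)) -> linear (fun x => \sum_(i <- r | P i) u i x).
Proof.
move=> lu a x y; rewrite scaler_sumr -big_split; apply: eq_bigr => i _; exact: lu.
Qed.

Lemma linN (V W : lmodType K) (u : V -> W) : linear u -> forall x, u (- x) = - u x.
Proof. by move=> lu x; rewrite -scaleN1r linZ // scaleN1r. Qed.

Lemma linB (V W : lmodType K) (u : V -> W) :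
  linear u -> forall x y, u (x - y) = u x - u y.
Proof. by move=> lu x y; rewrite linD // linN. Qed.

Lemma lin_sumE (V W : lmodType K) (u : V -> W) (I : Type) (r : seq I) (P : pred I)
  (F : I -> V) : linear u -> u (\sum_(i <- r | P i) F i) = \sum_(i <- r | P i) u (F i).
Proof. by move=> lu; rewrite -big_filter linS // big_filter. Qed.

Lemma scaleCA (V : lmodType K) (a b : K) (v : V) : a *: (b *: v) = b *: (a *: v).
Proof. by rewrite !scalerA mulrC. Qed.

(* plift F is computed on representatives, so F may fail to kill the relators. *)
Lemma plift_transfer (X : Type) (rel : seq (K * X) -> Prop) (W W' : lmodType K)
    (F : X -> W) (u : W -> W') (v : pres rel -> W') :
  linear u -> linear v -> (forall x, u (F x) = v (gen rel x)) ->
  forall q, u (plift F q) = v q.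
Proof.
move=> lu lv uv q; rewrite -[in RHS](preprK q) pcl_gen !ev_lin //.
by apply: eq_bigr => kx _ /=; rewrite uv.
Qed.

End LinearMaps.

Arguments prj_lin {K c i}.
Arguments dif_lin {K c}.

Section Tens.
Variable K : comPzRingType.

Definition homog (V : complex K) a (x : V) := prj a x = x.

Lemma prj_homog (V : complex K) a (x : V) : homog a (prj a x).
Proof. by rewrite /homog prj_prj eqxx. Qed.

Lemma homog_prj (V : complex K) a b (x : V) :
  homog a x -> prj b x = if b == a then x else 0.
Proof. by move=> hx; rewrite -hx prj_prj; case: ifP. Qed.

Lemma graded_homog (V W : complex K) e (u : V -> W) a x :
  graded e u -> homog a x -> homog (a + e) (u x).
Proof. by case=> _ ue hx; rewrite /homog -ue hx. Qed.

Lemma dif_homog (V : complex K) a (x : V) : homog a x -> homog (a - 1) (dif x).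
Proof. by move=> hx; rewrite /homog -dif_prj hx. Qed.

Lemma cmap_homog (V W : complex K) (u : cmap V W) a x :
  homog a x -> homog a (u x).
Proof. by move=> hx; rewrite /homog -cfun_prj hx. Qed.

Lemma cmap_graded (V W : complex K) (u : cmap V W) : graded 0 u.
Proof. by split=> [|i x]; [apply: cfun_lin | rewrite addr0 cfun_prj]. Qed.

Lemma graded_id (V : complex K) : graded 0 (fun x : V => x).
Proof. by split=> [|i x]; [exact: lin_id | rewrite addr0]. Qed.

Lemma graded_comp (U V W : complex K) e e' (u : V -> W) (v : U -> V) :
  graded e u -> graded e' v -> graded (e' + e) (u \o v).
Proof.
move=> [lu ue] [lv ve]; split=> [|i x /=]; first exact: lin_comp.
by rewrite ve ue addrA.
Qed.

Lemma graded_cast (V W : complex K) e e' (u : V -> W) :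
  e = e' -> graded e u -> graded e' u.
Proof. by move=> ->. Qed.

Variable n : nat.
Implicit Types V W : 'I_n -> complex K.

Definition multilin V (W : lmodType K) (F : ('I_n -> int) -> (forall i, V i) -> W) :=
  forall deg i a (x y z : forall i, V i), x i = a *: y i + z i ->
  (forall j, j != i -> y j = x j) -> (forall j, j != i -> z j = x j) ->
  F deg x = a *: F deg y + F deg z.

Lemma tlift_compat V (W : lmodType K) (F : ('I_n -> int) -> (forall i, V i) -> W) :
  multilin F ->
  compat (@trel K n V) (fun g => F g.1 (fun i => prj (g.1 i) (g.2 i))).
Proof.
move=> mF; apply: trel_linP => [deg i a x y z xE yE zE|deg x] /=.
  apply: (mF _ i) => [|j ji|j ji]; first by rewrite xE prj_lin.
    by rewrite yE.
  by rewrite zE.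
congr F; apply: dfunext => i.
by rewrite prj_prj eqxx.
Qed.

Lemma tlift_lin V (W : lmodType K) (F : ('I_n -> int) -> (forall i, V i) -> W) :
  multilin F -> linear (tlift F).
Proof. by move=> mF; apply/plift_linear/tlift_compat. Qed.

Lemma tlift_pure V (W : lmodType K) (F : ('I_n -> int) -> (forall i, V i) -> W) deg x :
  multilin F -> tlift F (tpure deg x) = F deg (fun i => prj (deg i) (x i)).
Proof. by move=> mF; rewrite /tlift /tpure plift_gen //; apply: tlift_compat. Qed.

Lemma funext_homog V (deg : 'I_n -> int) (x : forall i, V i) :
  (forall i, homog (deg i) (x i)) -> (fun i => prj (deg i) (x i)) = x.
Proof. by move=> hx; apply: dfunext => i; apply: hx. Qed.

Lemma tlift_pureh V (W : lmodType K) (F : ('I_n -> int) -> (forall i, V i) -> W) deg x :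
  multilin F -> (forall i, homog (deg i) (x i)) -> tlift F (tpure deg x) = F deg x.
Proof. by move=> mF hx; rewrite tlift_pure // funext_homog. Qed.

Lemma tpure_prj V deg (x : forall i, V i) :
  tpure deg x = tpure deg (fun i => prj (deg i) (x i)).
Proof. exact: tgen_prj. Qed.

Lemma tens_ext V (W : lmodType K) (u v : tens V -> W) :
  linear u -> linear v ->
  (forall deg x, (forall i, homog (deg i) (x i)) -> u (tpure deg x) = v (tpure deg x)) ->
  u =1 v.
Proof.
move=> lu lv uv; apply: pres_ext => // -[deg x].
rewrite -/(tpure deg x) tpure_prj uv // => i; exact: prj_homog.
Qed.

(** The value of [tlift F] is computed from a chosen representative; after [u], agreement with the
    linear map [v] on homogeneous pure tensors determines it. *)
Lemma tlift_transfer V (W W' : lmodType K) (F : ('I_n -> int) -> (forall i, V i) -> W)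
    (u : W -> W') (v : tens V -> W') :
  linear u -> linear v ->
  (forall deg x, (forall i, homog (deg i) (x i)) -> u (F deg x) = v (tpure deg x)) ->
  forall t, u (tlift F t) = v t.
Proof.
move=> lu lv uv; apply: plift_transfer => // -[deg x] /=.
rewrite uv => [|i]; last exact: prj_homog.
by rewrite -tpure_prj.
Qed.

Lemma prj_tpure V deg (x : forall i, V i) a :
  prj a (tpure deg x) = if \sum_i deg i == a then tpure deg x else 0.
Proof. by rewrite [prj _ _]gprj_gen //; apply: trel_deg. Qed.

Lemma tens_exth V (W : lmodType K) (u v : tens V -> W) a :
  linear u -> linear v ->
  (forall deg x, (forall i, homog (deg i) (x i)) -> \sum_i deg i = a ->
     u (tpure deg x) = v (tpure deg x)) ->
  forall t, homog a t -> u t = v t.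
Proof.
move=> lu lv uv t <-; move: t; apply: tens_ext.
- exact: lin_comp lu prj_lin.
- exact: lin_comp lv prj_lin.
move=> deg x hx; cbv beta; rewrite prj_tpure; case: eqP => [dE|_]; first exact: uv.
by rewrite (lin0 lu) (lin0 lv).
Qed.

Lemma homog_tpure V deg (x : forall i, V i) : homog (\sum_i deg i) (tpure deg x).
Proof. by rewrite /homog prj_tpure eqxx. Qed.

Lemma dif_tpure V deg (x : forall i, V i) : dif (tpure deg x) =
  \sum_(i < n) ksgn K (\sum_(j < n | (j < i)%N) deg j) *:
    tpure (fun j => if j == i then deg j - 1 else deg j)
          (fun j => if j == i then dif (x j) else x j).
Proof. by rewrite [dif _]plift_gen //; apply: tdif_compat. Qed.

End Tens.
Arguments multilin {K n V W} F.

Section TmapPure.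
Variables (K : comPzRingType) (m n : nat).
Variables (V : 'I_m -> complex K) (W : 'I_n -> complex K) (c : 'I_n -> 'I_m).
Variables (e : 'I_n -> int) (u : forall i, V (c i) -> W i).
Hypothesis c_bij : bijective c.
Hypothesis u_gr : forall i, graded (e i) (@u i).

Lemma tmap_compat : compat (@trel K m V) (fun g : tgen V =>
    (koszul K c g.1 * ksgn K (\sum_(i < n) \sum_(j < n | (i < j)%N) e j * g.1 (c i)))
    *: gen (@trel K n W) (fun i => g.1 (c i) + e i, fun i => u (g.2 (c i)))).
Proof.
apply: trel_linP => [deg i a x y z xE yE zE|deg x] /=.
  have [k ki] : exists k, c k = i by have [c' _ c'K] := c_bij; exists (c' i).
  rewrite -{i}ki in xE yE zE.
  rewrite scaleCA -scalerDr; congr (_ *: _).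
  have jk j : j != k -> c j != c k by rewrite (inj_eq (bij_inj c_bij)).
  apply: (@tgen_lin _ _ _ _ k) => /= [|j /jk cj|j /jk cj].
  - by rewrite xE (u_gr k).1.
  - by rewrite yE.
  by rewrite zE.
congr (_ *: _); rewrite tgen_prj /=; congr (gen _ (_, _)).
by apply: dfunext => i; rewrite (u_gr i).2.
Qed.

Lemma tmap_linear : linear (tmap e u).
Proof. exact/plift_linear/tmap_compat. Qed.

Lemma tmap_pure deg x : tmap e u (tpure deg x) =
  (koszul K c deg * ksgn K (\sum_(i < n) \sum_(j < n | (i < j)%N) e j * deg (c i)))
    *: tpure (fun i => deg (c i) + e i) (fun i => u (x (c i))).
Proof. by rewrite /tmap /tpure plift_gen //; apply: tmap_compat. Qed.

Lemma tmap_graded : graded (\sum_i e i) (tmap e u).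
Proof.
split=> [|a]; first exact: tmap_linear.
apply: tens_ext.
- exact: lin_comp tmap_linear prj_lin.
- exact: lin_comp prj_lin tmap_linear.
move=> deg x hx; rewrite prj_tpure !tmap_pure (linZ prj_lin) prj_tpure.
rewrite big_split /= (inj_eq (addIr _)).
have <- : \sum_i deg i = \sum_i deg (c i) by rewrite (reindex c) //; apply: onW_bij.
by case: ifP => _; rewrite ?tmap_pure ?scaler0 ?(lin0 tmap_linear).
Qed.

End TmapPure.

Lemma tmap0_pure (K : comPzRingType) m n (V : 'I_m -> complex K) (W : 'I_n -> complex K)
  (c : 'I_n -> 'I_m) (u : forall i, V (c i) -> W i) deg x :
  bijective c -> (forall i, graded 0 (@u i)) ->
  tmap (fun=> 0) u (tpure deg x) =
    koszul K c deg *: tpure (fun i => deg (c i)) (fun i => u i (x (c i))).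
Proof.
move=> cb ug; rewrite tmap_pure //.
rewrite [X in ksgn K X]big1 => [|i _]; last by apply: big1 => j _; rewrite mul0r.
rewrite ksgn_par mulr1; congr (_ *: tpure _ _).
by apply: dfunext => i; rewrite addr0.
Qed.

(** * Sums of tensor products modulo arrows *)

Section Qtens.
Variables (K : comPzRingType) (I : Type) (P Q : I -> complex K).
Variable arr : forall i j, cmap (P i) (P j) -> cmap (Q i) (Q j) -> Prop.

Definition qpure i a b (p : P i) (q : Q i) : qtens arr := gen (qrel arr) (QGen a b p q).

Definition qlift (W : lmodType K) (F : forall i, int -> int -> P i -> Q i -> W) :
    qtens arr -> W :=
  plift (fun g : qgen P Q =>
    F (qi g) (qa g) (qb g) (prj (qa g) (qp g)) (prj (qb g) (qq g))).

(** The conditions under which [F] descends to the quotient. Homogeneity may be assumed because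
    [qlift] projects its arguments before applying [F]. *)
Definition qbilin (W : lmodType K) (F : forall i, int -> int -> P i -> Q i -> W) :=
  [/\ forall i a b (q : Q i), homog b q -> linear (fun p => F i a b p q),
      forall i a b (p : P i), homog a p -> linear (fun q => F i a b p q)
    & forall i j u v a b p q, @arr i j u v -> homog a p -> homog b q ->
        F j a b (u p) (v q) = F i a b p q].

Lemma qlift_compat (W : lmodType K) (F : forall i, int -> int -> P i -> Q i -> W) :
  qbilin F -> compat (qrel arr) (fun g : qgen P Q =>
    F (qi g) (qa g) (qb g) (prj (qa g) (qp g)) (prj (qb g) (qq g))).
Proof.
case=> Fl Fr Fa; apply: qrelP => [i a b q|i a b p|i a b p q|i j u v a b p q uv] /=.
- exact: (lin_comp (Fl i a b _ (prj_homog _ _)) prj_lin).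
- exact: (lin_comp (Fr i a b _ (prj_homog _ _)) prj_lin).
- by rewrite !prj_prj !eqxx.
by rewrite -!cfun_prj (Fa _ _ _ _ _ _ _ _ uv) //; apply: prj_homog.
Qed.

Lemma qlift_lin (W : lmodType K) (F : forall i, int -> int -> P i -> Q i -> W) :
  qbilin F -> linear (qlift F).
Proof. by move=> Fb; apply/plift_linear/qlift_compat. Qed.

Lemma qlift_pure (W : lmodType K) (F : forall i, int -> int -> P i -> Q i -> W)
  i a b p q : qbilin F ->
  qlift F (@qpure i a b p q) = F i a b (prj a p) (prj b q).
Proof. by move=> Fb; rewrite /qlift /qpure plift_gen //; apply: qlift_compat. Qed.

Lemma qlift_pureh (W : lmodType K) (F : forall i, int -> int -> P i -> Q i -> W)
  i a b p q : qbilin F -> homog a p -> homog b q ->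
  qlift F (@qpure i a b p q) = F i a b p q.
Proof. by move=> Fb hp hq; rewrite qlift_pure // hp hq. Qed.

Lemma qtens_ext (W : lmodType K) (u v : qtens arr -> W) :
  linear u -> linear v ->
  (forall i a b p q, homog a p -> homog b q -> u (@qpure i a b p q) = v (qpure a b p q)) ->
  u =1 v.
Proof.
move=> lu lv uv; apply: pres_ext => // -[i a b p q].
by rewrite qgen_prj uv //; apply: prj_homog.
Qed.

Lemma qlift_transfer (W W' : lmodType K) (F : forall i, int -> int -> P i -> Q i -> W)
    (u : W -> W') (v : qtens arr -> W') :
  linear u -> linear v ->
  (forall i a b p q, homog a p -> homog b q -> u (F i a b p q) = v (qpure a b p q)) ->
  forall t, u (qlift F t) = v t.
Proof.
move=> lu lv uv; apply: plift_transfer => // -[i a b p q] /=.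
by rewrite uv; [rewrite /qpure -qgen_prj|exact: prj_homog..].
Qed.

Lemma qpure_linl i a b q : linear (fun p => @qpure i a b p q).
Proof. exact: qgen_linl. Qed.

Lemma qpure_linr i a b p : linear (fun q => @qpure i a b p q).
Proof. exact: qgen_linr. Qed.

Lemma qpure_prj i a b p q : @qpure i a b p q = qpure a b (prj a p) (prj b q).
Proof. exact: qgen_prj. Qed.

Lemma qpure_arr i j u v a b p q : @arr i j u v ->
  @qpure j a b (u p) (v q) = @qpure i a b p q.
Proof. by move=> uv; rewrite /qpure -(qgen_arr _ _ _ _ uv). Qed.

Lemma prj_qpure i a b p q c :
  prj c (@qpure i a b p q) = if a + b == c then qpure a b p q else 0.
Proof. by rewrite [prj _ _]gprj_gen //; apply: qrel_deg. Qed.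

Lemma homog_qpure i a b p q : homog (a + b) (@qpure i a b p q).
Proof. by rewrite /homog prj_qpure eqxx. Qed.

Lemma dif_qpure i a b p q : dif (@qpure i a b p q) =
  qpure (a - 1) b (dif p) q + ksgn K a *: qpure a (b - 1) p (dif q).
Proof. by rewrite [dif _]plift_gen //; apply: qdif_compat. Qed.

(** The labels [a] and [b] select components, so labels that differ from the actual degrees select
    zero. *)
Lemma qpure0 i a b p q a' b' : homog a' p -> homog b' q ->
  (a, b) != (a', b') -> @qpure i a b p q = 0.
Proof.
move=> hp hq ab; rewrite qpure_prj (homog_prj a hp) (homog_prj b hq).
move: ab; rewrite xpair_eqE negb_and; case: eqP => //= _; first last.
  by move=> _; rewrite (lin0 (qpure_linl a b _)).
by case: eqP => //= _ _; rewrite (lin0 (qpure_linr a b _)).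
Qed.

End Qtens.
Arguments qpure {K I P Q} arr {i} a b p q.

Section Qmap.
Variables (K : comPzRingType) (I I' : Type) (P Q : I -> complex K) (P' Q' : I' -> complex K).
Variable arr : forall i j, cmap (P i) (P j) -> cmap (Q i) (Q j) -> Prop.
Variable arr' : forall i j, cmap (P' i) (P' j) -> cmap (Q' i) (Q' j) -> Prop.
Variables (f : I -> I') (e : int).
Variables (u : forall i, P i -> P' (f i)) (v : forall i, Q i -> Q' (f i)).
Hypothesis u_gr : forall i, graded 0 (@u i).
Hypothesis v_gr : forall i, graded e (@v i).
Hypothesis uv_arr : forall i j u1 v1, @arr i j u1 v1 -> exists u2 v2,
  [/\ @arr' (f i) (f j) u2 v2, forall p, u (u1 p) = u2 (u p)
    & forall q, v (v1 q) = v2 (v q)].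

Lemma qmap_compat : compat (qrel arr) (fun g : qgen P Q => let: QGen i a b p q := g in
    ksgn K (e * a) *: gen (qrel arr') (QGen a (b + e) (u p) (v q))).
Proof.
apply: qrelP => [i a b q|i a b p|i a b p q|i j u1 v1 a b p q uv] /=.
- apply: lin_scale; exact: (lin_comp (@qpure_linl _ _ _ _ _ _ _ _ _) (u_gr i).1).
- apply: lin_scale; exact: (lin_comp (@qpure_linr _ _ _ _ _ _ _ _ _) (v_gr i).1).
- by rewrite qgen_prj (v_gr i).2 (u_gr i).2 addr0.
have [u2 [v2 [uv2 -> ->]]] := uv_arr uv; congr (_ *: _); exact: qgen_arr uv2.
Qed.

Lemma qmap_linear : linear (qmap arr arr' f e u v).
Proof. exact/plift_linear/qmap_compat. Qed.

Lemma qmap_pure i a b p q : qmap arr arr' f e u v (@qpure _ _ _ _ arr i a b p q) =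
  ksgn K (e * a) *: qpure arr' a (b + e) (u p) (v q).
Proof. by rewrite /qmap /qpure plift_gen //; apply: qmap_compat. Qed.

Lemma qmap_graded : graded e (qmap arr arr' f e u v).
Proof.
split=> [|c]; first exact: qmap_linear.
apply: qtens_ext.
- exact: lin_comp qmap_linear prj_lin.
- exact: lin_comp prj_lin qmap_linear.
move=> i a b p q hp hq; rewrite prj_qpure !qmap_pure (linZ prj_lin) prj_qpure.
rewrite addrA (inj_eq (addIr _)).
by case: ifP => _; rewrite ?qmap_pure ?scaler0 ?(lin0 qmap_linear).
Qed.

End Qmap.

(** * Separating a tensor into blocks *)

Section ShuffleSigns.
Variable K : comPzRingType.

(* The sign of a_0 ... a_(n-1) D_0 ... D_(n-1) |-> a_0 D_0 ... a_(n-1) D_(n-1) *)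
Definition interleave n (a D : 'I_n -> int) : K :=
  ksgn K (\sum_(i < n) \sum_(i' < n | (i < i')%N) a i' * D i).

Lemma interleave_par n (a D : 'I_n -> int) : interleave a D =
  (-1) ^+ xsum2 (fun i i' : 'I_n => (i < i')%N && (par (a i') && par (D i))).
Proof.
rewrite /interleave ksgn_par par_xsumT; congr (_ ^+ nat_of_bool _).
by apply: eq_xsum => i; rewrite par_xsum; apply: eq_xsum => j; rewrite parM.
Qed.

Lemma prod_sign n (B : 'I_n -> bool) : \prod_i (-1) ^+ B i = (-1) ^+ xsum B :> K.
Proof. by rewrite (big_morph (fun b : bool => (-1 : K) ^+ b) (@signr_addb _) erefl). Qed.

(** Two ways from a_0 ... a_(m-1) D_0 ... D_(m-1) to the permuted interleaved sequence: permute both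
    halves and then interleave, or interleave and then permute the pairs. *)
Lemma koszul_add m n (c : 'I_n -> 'I_m) (a D : 'I_m -> int) : bijective c ->
  koszul K c a * koszul K c D * interleave (a \o c) (D \o c) =
  interleave a D * koszul K c (fun i => a i + D i).
Proof.
move=> cb; rewrite !koszul_par !interleave_par -!signr_addb.
rewrite [in RHS](xsum2_bij _ cb) -!xsum2D; congr (_ ^+ nat_of_bool _).
apply: xsum2_pair => [i|i j ij] /=; first by rewrite !ltnn.
rewrite (ltnNge j i) (ltnW ij) ij /= !parD.
have : c i != c j by rewrite (inj_eq (bij_inj cb)) neq_ltn ij.
rewrite -!val_eqE /=.
by case: (ltngtP (c i) (c j)) => //= _ _; case: (par (a (c i)));
  case: (par (a (c j))); case: (par (D (c i))); case: (par (D (c j))).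
Qed.

Definition block_deg r (p : 'I_r -> nat) n (l : 'I_(\sum_i p i)%N -> 'I_n)
    (d : 'I_n -> int) (i : 'I_r) : int := \sum_(k < p i) d (l (tagnat.Rank i k)).

Lemma shuffle_signE r (p : 'I_r -> nat) n (l : 'I_(\sum_i p i)%N -> 'I_n) a d :
  shuffle_sign K l a d = koszul K l d * interleave a (block_deg l d).
Proof. by []. Qed.

Lemma koszul_id n (d : 'I_n -> int) : koszul K id d = 1.
Proof. by apply: koszul_mono => i j /ltnW. Qed.

Lemma par_block_deg r (p : 'I_r -> nat) n (l : 'I_(\sum_i p i)%N -> 'I_n) d i :
  par (block_deg l d i) = xsum (fun k => par (d (l (tagnat.Rank i k)))).
Proof. exact: par_xsumT. Qed.

(** Inversions of [C] inside a block are those of [s i]; between two blocks they are governed by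
    [c], and the products of degrees add up to the product of the block degrees. *)
Lemma koszul_blocks r r' (c : 'I_r' -> 'I_r) (p : 'I_r -> nat) (p' : 'I_r' -> nat)
    (s : forall i, 'I_(p' i) -> 'I_(p (c i)))
    (C : 'I_(\sum_i p' i)%N -> 'I_(\sum_i p i)%N) (d : 'I_(\sum_i p i)%N -> int) :
  injective c -> (forall i, bijective (s i)) ->
  (forall i k, C (tagnat.Rank i k) = tagnat.Rank (c i) (s i k)) ->
  koszul K C d = koszul K c (block_deg id d) *
    \prod_i koszul K (s i) (fun k => d (tagnat.Rank (c i) k)).
Proof.
move=> ci sb CE; rewrite [\prod_i _](eq_bigr _ (fun i _ => koszul_par K (s i) _)).
rewrite prod_sign !koszul_par -signr_addb; congr (_ ^+ nat_of_bool _).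
rewrite -xsum2_diag -xsum2D xsum2_Rank; apply: eq_xsum2 => i i'.
case: (eqVneq i' i) => [->|ne].
  rewrite !ltnn /=; apply: eq_xsum => k; apply: eq_xsum => k'.
  by rewrite !CE !Rank_lt !ltnn !eqxx.
rewrite /= addbF !par_block_deg /= xsum_andr xsum_andl.
rewrite [in RHS](xsum_bij _ (sb i)); apply: eq_xsum => k /=.
rewrite !xsum_andl [in RHS](xsum_bij _ (sb i')); apply: eq_xsum => k' /=.
rewrite !CE !Rank_lt (inj_eq ci) (negbTE ne) eq_sym (negbTE ne) /= !orbF.
by rewrite andbC.
Qed.

End ShuffleSigns.

Section Mlin.
Variables (K : comPzRingType) (n : nat).

Definition mlin (V : 'I_n -> lmodType K) (W : lmodType K) (F : (forall i, V i) -> W) :=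
  forall i a (x y z : forall i, V i), x i = a *: y i + z i ->
  (forall j, j != i -> y j = x j) -> (forall j, j != i -> z j = x j) ->
  F x = a *: F y + F z.

Lemma mlin0 (V : 'I_n -> lmodType K) (W : lmodType K) (F : (forall i, V i) -> W) i x :
  mlin F -> x i = 0 -> F x = 0.
Proof.
move=> mF x0; have := mF i 1 x x x; rewrite x0 scaler0 addr0 scale1r.
move=> /(_ erefl (fun _ _ => erefl) (fun _ _ => erefl)).
by move/(congr1 (fun t => t - F x)); rewrite addrK subrr.
Qed.

Lemma mlin_lin (V : 'I_n -> lmodType K) (W W' : lmodType K) (F : (forall i, V i) -> W)
    (u : W -> W') : linear u -> mlin F -> mlin (fun x => u (F x)).
Proof. by move=> lu mF i a x y z xE yE zE; rewrite (mF i a x y z) // lu. Qed.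

Lemma mlin_pre (V V' : 'I_n -> lmodType K) (W : lmodType K) (F : (forall i, V i) -> W)
    (u : forall i, V' i -> V i) : (forall i, linear (u i)) -> mlin F ->
  mlin (fun x => F (fun i => u i (x i))).
Proof.
move=> lu mF i a x y z xE yE zE; apply: (mF i) => [|j ji|j ji].
- by rewrite xE lu.
- by rewrite yE.
by rewrite zE.
Qed.

Lemma mlin_scale (V : 'I_n -> lmodType K) (W : lmodType K) (F : (forall i, V i) -> W)
    (a : 'I_n -> K) x : mlin F -> F (fun i => a i *: x i) = (\prod_i a i) *: F x.
Proof.
move=> mF; suff H (s : seq 'I_n) : uniq s ->
    F (fun i => (if i \in s then a i else 1) *: x i) = (\prod_(i <- s) a i) *: F x.
  have := H _ (enum_uniq 'I_n); rewrite big_enum => <-.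
  by congr F; apply: dfunext => i; rewrite mem_enum.
elim: s => [_|i s IH /= /andP[is0 us]].
  rewrite big_nil scale1r; congr F.
  by apply: dfunext => i; rewrite scale1r.
rewrite big_cons -scalerA -IH //.
(* Multilinearity at [i] with zero as the second summand extracts the scalar [a i]. *)
rewrite (mF i (a i) _
  (fun j => (if j \in s then a j else 1) *: x j)
  (fun j => if j == i then 0 else (if j \in s then a j else 1) *: x j)).
- by rewrite [X in _ + X](@mlin0 _ _ _ i) ?addr0 //= eqxx.
- by rewrite inE eqxx /= (negbTE is0) scale1r addr0.
- by move=> j ji; rewrite inE (negbTE ji).
by move=> j ji; rewrite inE (negbTE ji).
Qed.

Lemma tpure_mlin (V : 'I_n -> complex K) deg : mlin (fun x : forall i, V i => tpure deg x).
Proof. by move=> i a x y z; apply: tgen_lin. Qed.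

Lemma tpure_scale (V : 'I_n -> complex K) (deg : 'I_n -> int) (a : 'I_n -> K)
    (x : forall i, V i) :
  tpure deg (fun i => a i *: x i) = (\prod_i a i) *: tpure deg x.
Proof. exact: (mlin_scale _ _ (@tpure_mlin V deg)). Qed.

End Mlin.

Section Tpact.
Variables (K : comPzRingType) (sym : bool).

Lemma oinv_bij m n (b : obij sym m n) : bijective (oinv b).
Proof. exact: Bijective (oinvK b) (ofunK b). Qed.

Lemma ofun_bij m n (b : obij sym m n) : bijective b.
Proof. exact: Bijective (ofunK b) (oinvK b). Qed.

Definition obinv m n (b : obij sym m n) : obij sym n m.
Proof.
exists (oinv b) b; [exact: oinvK | exact: ofunK |].
move=> s i j ij; case: (ltngtP (oinv b i) (oinv b j)) => // [ji|/ord_inj/(can_inj (oinvK b)) ije].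
  by have := omono b s ji; rewrite !oinvK ltnNge ltnW.
by rewrite ije ltnn in ij.
Defined.

Lemma tcmap_pure m n (V : 'I_m -> complex K) (W : 'I_n -> complex K) (b : obij sym m n)
    (u : forall i, cmap (V (oinv b i)) (W i)) deg x :
  tcmap u (tpure deg x) =
  koszul K (oinv b) deg *: tpure (fun i => deg (oinv b i)) (fun i => u i (x (oinv b i))).
Proof.
apply: tmap0_pure => [|i]; [exact: oinv_bij | exact: cmap_graded].
Qed.

Lemma tpact_pure (A : complex K) m n (b : obij sym m n) deg x :
  tpact A b (tpurec deg x) =
  koszul K (oinv b) deg *: tpurec (fun i => deg (oinv b i)) (fun i => x (oinv b i)).
Proof. exact: tcmap_pure. Qed.

Lemma tpact_id (A : complex K) n (b : obij sym n n) t : b =1 id -> tpact A b t = t.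
Proof.
move=> b1; have b'1 : oinv b =1 id by move=> i; rewrite -[in LHS](b1 i) ofunK.
move: t; apply: tens_ext; [exact: cfun_lin | exact: lin_id |] => deg x hx.
rewrite -/(tpurec deg x) tpact_pure (_ : oinv b = id) ?koszul_id ?scale1r //.
exact: funext.
Qed.

Lemma tpact_comp (A : complex K) m n p (b : obij sym m n) (b' : obij sym n p) t :
  tpact A (obcomp b' b) t = tpact A b' (tpact A b t).
Proof.
move: t; apply: tens_ext; [exact: cfun_lin | |].
  exact: lin_comp (@cfun_lin _ _ _ (tpact A b')) (@cfun_lin _ _ _ (tpact A b)).
move=> deg x hx; rewrite -/(tpurec deg x) !tpact_pure (linZ cfun_lin).
by rewrite tpact_pure scalerA; congr (_ *: _); apply: koszul_comp; apply: oinv_bij.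
Qed.

Lemma tpact_eq (A : complex K) m n (b b' : obij sym m n) t :
  b =1 b' -> tpact A b t = tpact A b' t.
Proof. by move=> bb'; rewrite (obij_eq bb'). Qed.

End Tpact.

Lemma tens_ext2 (K : comPzRingType) m m'
    (V : 'I_m -> complex K) (V' : 'I_m' -> complex K) (W : lmodType K)
    (u v : tens V -> tens V' -> W) :
  (forall t', linear (u^~ t')) -> (forall t, linear (u t)) ->
  (forall t', linear (v^~ t')) -> (forall t, linear (v t)) ->
  (forall d x d' x', (forall i, homog (d i) (x i)) -> (forall i, homog (d' i) (x' i)) ->
     u (tpure d x) (tpure d' x') = v (tpure d x) (tpure d' x')) ->
  u =2 v.
Proof.
move=> ul ur vl vr uv t t'; move: t; apply: tens_ext => // d x hx.
by move: t'; apply: tens_ext => // d' x' hx'; apply: uv.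
Qed.

Lemma tens_ext2h (K : comPzRingType) m m'
    (V : 'I_m -> complex K) (V' : 'I_m' -> complex K) (W : lmodType K)
    (u v : tens V -> tens V' -> W) a :
  (forall t', linear (u^~ t')) -> (forall t, linear (u t)) ->
  (forall t', linear (v^~ t')) -> (forall t, linear (v t)) ->
  (forall d x d' x', (forall i, homog (d i) (x i)) -> (forall i, homog (d' i) (x' i)) ->
     \sum_i d i = a -> u (tpure d x) (tpure d' x') = v (tpure d x) (tpure d' x')) ->
  forall t t', homog a t -> u t t' = v t t'.
Proof.
move=> ul ur vl vr uv t t' ht; move: t'; apply: tens_ext => // d' x' hx'; move: t ht.
by apply: tens_exth => // d x hx dE; apply: uv.
Qed.

Lemma tens_ext2hh (K : comPzRingType) m m'
    (V : 'I_m -> complex K) (V' : 'I_m' -> complex K) (W : lmodType K)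
    (u v : tens V -> tens V' -> W) a b :
  (forall t', linear (u^~ t')) -> (forall t, linear (u t)) ->
  (forall t', linear (v^~ t')) -> (forall t, linear (v t)) ->
  (forall d x d' x', (forall i, homog (d i) (x i)) -> (forall i, homog (d' i) (x' i)) ->
     \sum_i d i = a -> \sum_i d' i = b ->
     u (tpure d x) (tpure d' x') = v (tpure d x) (tpure d' x')) ->
  forall t t', homog a t -> homog b t' -> u t t' = v t t'.
Proof.
move=> ul ur vl vr uv t t' ht; move: t'; apply: tens_exth => // d' x' hx' dE'; move: t ht.
by apply: tens_exth => // d x hx dE; apply: uv.
Qed.

Section BlockSep.
Variables (K : comPzRingType) (sym : bool) (M : sseq K sym) (A : complex K).

Lemma spureE m a b (x : M m) (t : tpow A m) :
  spure a b x t = qpure (@schur_arr K sym M A) a b x t.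
Proof. by []. Qed.

Lemma spure_act m n (b : obij sym m n) a d (x : M m) (t : tpow A m) :
  spure a d (sact M b x) (tpact A b t) = spure a d x t.
Proof. by rewrite !spureE (qpure_arr _ _ _ _ (SchurArr M A b)). Qed.

Lemma spure_linl m a b (t : tpow A m) : linear (fun x : M m => spure a b x t).
Proof. exact: qpure_linl. Qed.

Lemma spure_linr m a b (x : M m) : linear (fun t : tpow A m => spure a b x t).
Proof. exact: qpure_linr. Qed.

Variables (r : nat) (p : 'I_r -> nat) (n : nat).

Definition sep_pure (l : obij sym (\sum_i p i)%N n) (dx : 'I_r -> int)
    (x : forall i, M (p i)) (dy : 'I_n -> int) (y : 'I_n -> A) : tpow (schur M A) r :=
  shuffle_sign K l dx dy *:
  tpurec (fun i => dx i + block_deg l dy i) (fun i => spure (dx i) (block_deg l dy i) (x i)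
    (tpurec (fun k => dy (l (tagnat.Rank i k))) (fun k => y (l (tagnat.Rank i k))))).

(** Common to [blocks_iso], where [l] is the identity, and to [schur_comp], where [l] is the
    labelling of a summand of the composition product. *)
Definition block_sep (l : obij sym (\sum_i p i)%N n) (c : tens (fun i => M (p i)))
    (y : tpow A n) : tpow (schur M A) r :=
  tlift (fun dx x => tlift (sep_pure l dx x) y) c.

Variable l : obij sym (\sum_i p i)%N n.

Lemma sep_pure_multilin dx x : multilin (sep_pure l dx x).
Proof.
move=> dy j a y y1 y2 yE y1E y2E; rewrite /sep_pure scaleCA -scalerDr; congr (_ *: _).
have [[i k] ik] : exists w : {i & 'I_(p i)}, l (tagnat.Rank (tag w) (tagged w)) = j.
  by exists (tagnat.sig (oinv l j)); rewrite tagnat.sig2K oinvK.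
rewrite /= in ik; rewrite -{j}ik in yE y1E y2E.
have neq i' k' : i' != i -> l (tagnat.Rank i' k') != l (tagnat.Rank i k).
  move=> ii'; rewrite (inj_eq (can_inj (ofunK l))) -val_eqE /= tagnat.eq_Rank.
  by rewrite (negbTE ii').
apply: (@tgen_lin _ _ _ _ i) => [|i' ii'|i' ii'].
- rewrite -spure_linr; congr spure; apply: (@tgen_lin _ _ _ _ k) => // k' kk'.
    apply: y1E; rewrite (inj_eq (can_inj (ofunK l))) -val_eqE /= tagnat.eq_Rank eqxx.
    by rewrite val_eqE.
  apply: y2E; rewrite (inj_eq (can_inj (ofunK l))) -val_eqE /= tagnat.eq_Rank eqxx.
  by rewrite val_eqE.
- congr spure; congr tpurec; apply: dfunext => k'.
  by apply: y1E; apply: neq.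
congr spure; congr tpurec; apply: dfunext => k'.
by apply: y2E; apply: neq.
Qed.

Lemma sep_pure_multilin_l dy y : multilin (fun dx x => sep_pure l dx x dy y).
Proof.
move=> dx i a x x1 x2 xE x1E x2E; rewrite /sep_pure scaleCA -scalerDr; congr (_ *: _).
apply: (@tgen_lin _ _ _ _ i) => [|j ji|j ji].
- by rewrite xE spure_linl.
- by rewrite x1E.
by rewrite x2E.
Qed.

(** The extension is linear in [F] itself, because the same representative of [t] is used for every
    [F]. *)
Lemma tlift_linF (m : nat) (V : 'I_m -> complex K) (W : lmodType K)
    (F G H : ('I_m -> int) -> (forall i, V i) -> W) a t :
  (forall d x, F d x = a *: G d x + H d x) ->
  tlift F t = a *: tlift G t + tlift H t.
Proof.
move=> FGH; rewrite /tlift /plift /ev scaler_sumr -big_split; apply: eq_bigr => kx _ /=.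
by rewrite FGH scalerDr scaleCA.
Qed.

Lemma block_sep_multilin y : multilin (fun dx x => tlift (sep_pure l dx x) y).
Proof.
move=> dx i a x x1 x2 xE x1E x2E; apply: tlift_linF => d z.
exact: (@sep_pure_multilin_l d z dx i a x x1 x2).
Qed.

Lemma block_sep_linl y : linear (fun c => block_sep l c y).
Proof. exact/tlift_lin/block_sep_multilin. Qed.

Lemma block_sep_linr c : linear (block_sep l c).
Proof.
move=> a y y'; apply: tlift_linF => d x.
by rewrite (tlift_lin (sep_pure_multilin _ _)).
Qed.

Lemma block_sep_pure dx x dy y : (forall i, homog (dx i) (x i)) ->
  (forall i, homog (dy i) (y i)) ->
  block_sep l (tpure dx x) (tpurec dy y) = sep_pure l dx x dy y.
Proof.
move=> hx hy; rewrite /block_sep tlift_pureh //; last exact: block_sep_multilin.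
by rewrite tlift_pureh //; apply: sep_pure_multilin.
Qed.

End BlockSep.

Section BlockSepAct.
Variables (K : comPzRingType) (sym : bool) (M : sseq K sym) (A : complex K).

(** The Koszul factor in the shuffle sign is exactly the sign of permuting [y] into block order, so
    the labelling can be absorbed into [y]. *)
Lemma block_sep_relabel r (p : 'I_r -> nat) n (l : obij sym (\sum_i p i)%N n)
    (c : tens (fun i => M (p i))) (y : tpow A n) :
  block_sep l c y = block_sep (obid sym _) c (tpact A (obinv l) y).
Proof.
move: c y; apply: tens_ext2; try by move=> ?; apply: block_sep_linl.
- by move=> t; apply: block_sep_linr.
- move=> t; exact: lin_comp (block_sep_linr _ _) cfun_lin.
move=> dx x dy y hx hy; rewrite -/(tpurec dy y) tpact_pure (linZ (block_sep_linr _ _)).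
rewrite !block_sep_pure //= /sep_pure !shuffle_signE koszul_id mul1r scalerA.
by congr (_ *: _).
Qed.

(** Bijections inside the blocks are absorbed by coinvariance in each factor, and only the
    permutation of the blocks survives. The signs agree by [koszul_blocks] and [koszul_add]. *)
Lemma block_sep_act r r' (b : obij sym r r') (p : 'I_r -> nat) (p' : 'I_r' -> nat)
    (rho : forall i, obij sym (p (oinv b i)) (p' i))
    (beta : obij sym (\sum_i p i)%N (\sum_i p' i)%N) c (y : tpow A (\sum_i p i)%N) :
  (forall i k, beta (tagnat.Rank (oinv b i) k) = tagnat.Rank i (rho i k)) ->
  block_sep (obid sym _)
    (@tcmap K sym _ _ (fun i => M (p i)) (fun i => M (p' i)) b (fun i => sact M (rho i)) c)
    (tpact A beta y) =
  tpact (schur M A) b (block_sep (obid sym _) c y).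
Proof.
move=> betaE.
have beta'E i k : oinv beta (tagnat.Rank i k) = tagnat.Rank (oinv b i) (oinv (rho i) k).
  by rewrite -[in LHS](oinvK (rho i) k) -betaE ofunK.
move: c y; apply: tens_ext2.
- move=> t; exact: lin_comp (block_sep_linl _ _) cfun_lin.
- move=> t; exact: lin_comp (block_sep_linr _ _) cfun_lin.
- move=> t; exact: lin_comp cfun_lin (block_sep_linl _ _).
- move=> t; exact: lin_comp cfun_lin (block_sep_linr _ _).
move=> dx x dy y hx hy; rewrite -/(tpurec dy y) tpact_pure tcmap_pure.
rewrite (linZ (block_sep_linl _ _)) (linZ (block_sep_linr _ _)).
rewrite !block_sep_pure //; last by move=> i; apply: cmap_homog.
rewrite /sep_pure (linZ (@cfun_lin _ _ _ (tpact (schur M A) b))) tpact_pure /=.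
pose d i (k : 'I_(p (oinv b i))) := dy (tagnat.Rank (oinv b i) k).
have DE i : block_deg id (fun w => dy (oinv beta w)) i = block_deg id dy (oinv b i).
  rewrite /block_deg [RHS](reindex (oinv (rho i))); last exact/onW_bij/oinv_bij.
  by apply: eq_bigr => k _; rewrite beta'E.
have -> : (fun i => spure (dx (oinv b i)) (block_deg id (fun w => dy (oinv beta w)) i)
      (sact M (rho i) (x (oinv b i)))
      (tpurec (fun k => dy (oinv beta (tagnat.Rank i k)))
              (fun k => y (oinv beta (tagnat.Rank i k))))) =
  (fun i => koszul K (oinv (rho i)) (d i) *:
    spure (dx (oinv b i)) (block_deg id dy (oinv b i)) (x (oinv b i))
      (tpurec (d i) (fun k => y (tagnat.Rank (oinv b i) k)))).
  apply: dfunext => i; rewrite DE.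
  rewrite -(spure_act (rho i)) tpact_pure (linZ (spure_linr _ _ _)) scalerA.
  rewrite koszul_par sign_sq scale1r; congr (spure _ _ _ (tpurec _ _)).
    by apply: dfunext => k; rewrite beta'E.
  by apply: dfunext => k; rewrite beta'E.
rewrite /tpurec tpure_scale !scalerA.
have -> : (fun i => dx (oinv b i) + block_deg id (fun w => dy (oinv beta w)) i) =
    (fun i => dx (oinv b i) + block_deg id dy (oinv b i)).
  by apply: dfunext => i; rewrite DE.
congr (_ *: _); rewrite !shuffle_signE !koszul_id !mul1r.
rewrite (@koszul_blocks K _ _ (oinv b) _ _ (fun i => oinv (rho i))) //; first last.
- by move=> i; apply: oinv_bij.
- exact/bij_inj/oinv_bij.
have -> : block_deg id (fun w => dy (oinv beta w)) = block_deg id dy \o oinv b.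
  exact: funext.
rewrite -koszul_add; last exact: oinv_bij.
set P := \prod_i _.
(* The signs inside the blocks occur twice: once in the sign of [beta] and once from undoing each
   [rho i]. *)
have PP : P * P = 1.
  by rewrite /P (eq_bigr _ (fun i _ => koszul_par K _ _)) prod_sign sign_sq.
set k1 := koszul _ _ _; set k2 := koszul _ _ _; set k3 := interleave _ _ _.
by transitivity (k1 * k2 * k3 * (P * P)); [ring | rewrite PP mulr1].
Qed.

End BlockSepAct.

Section BlocksIso.
Variables (K : comPzRingType) (sym : bool) (M : sseq K sym) (A : complex K).
Variables (r : nat) (p : 'I_r -> nat).
Local Notation l := (obid sym (\sum_i p i)%N).

Lemma big_sum_block_deg (dy : 'I_(\sum_i p i)%N -> int) :
  \sum_i block_deg id dy i = \sum_w dy w.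
Proof. by rewrite big_Rank. Qed.

Lemma block_sep_homog a b (c : tens (fun i => M (p i))) (y : tpow A (\sum_i p i)%N) :
  homog a c -> homog b y -> homog (a + b) (block_sep l c y).
Proof.
move: c y; apply: tens_ext2hh.
- move=> y; exact: lin_comp prj_lin (block_sep_linl _ _).
- move=> c; exact: lin_comp prj_lin (block_sep_linr _ _).
- exact: block_sep_linl.
- exact: block_sep_linr.
move=> dx x dy y hx hy <- <-.
rewrite -/(tpurec dy y) block_sep_pure // (linZ prj_lin) prj_tpure.
by rewrite big_split /= big_sum_block_deg eqxx.
Qed.

Lemma dif_tpurec (B : complex K) m deg (x : 'I_m -> B) : dif (tpurec deg x) =
  \sum_(i < m) ksgn K (\sum_(j < m | (j < i)%N) deg j) *:
    tpurec (fun j => if j == i then deg j - 1 else deg j)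
           (fun j => if j == i then dif (x j) else x j).
Proof. exact: dif_tpure. Qed.

Lemma tpure_set_lin (B : complex K) m (d : 'I_m -> int) (X : 'I_m -> B) i :
  linear (fun z => tpurec d (fun j => if j == i then z else X j)).
Proof.
move=> a z z'; apply: (@tgen_lin _ _ _ _ i) => [|j ji|j ji]; rewrite ?eqxx //.
  by rewrite (negbTE ji).
by rewrite (negbTE ji).
Qed.

(** The degrees after the differential has hit factor [i]. *)
Definition dec (m : nat) (d : 'I_m -> int) (i j : 'I_m) := if j == i then d j - 1 else d j.

Lemma par_dec m (d : 'I_m -> int) i j : par (dec d i j) = par (d j) (+) (j == i).
Proof. by rewrite /dec; case: ifP => _; rewrite ?parD ?parN ?addbF. Qed.

Lemma block_deg_dec (dy : 'I_(\sum_i p i)%N -> int) i k :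
  block_deg id (dec dy (tagnat.Rank i k)) = dec (block_deg id dy) i.
Proof.
apply: funext => j; rewrite /dec /block_deg; case: eqVneq => [->|ji].
  rewrite [in RHS](bigD1 k) //= [in LHS](bigD1 k) //= eqxx addrAC; congr (_ + _ - _).
  apply: eq_bigr => k' kk'; rewrite -val_eqE /= tagnat.eq_Rank eqxx /=.
  by rewrite val_eqE (negbTE kk').
by apply: eq_bigr => k' _; rewrite -val_eqE /= tagnat.eq_Rank (negbTE ji).
Qed.

Lemma dif_sign_left (dx D : 'I_r -> int) (i : 'I_r) :
  interleave K dx D * ksgn K (\sum_(j < r | (j < i)%N) (dx j + D j)) =
  ksgn K (\sum_(j < r | (j < i)%N) dx j) * interleave K (dec dx i) D.
Proof.
rewrite !interleave_par !ksgn_par -!signr_addb !par_xsum; congr (_ ^+ nat_of_bool _).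
have -> : xsum2 (fun j j' : 'I_r => (j < j')%N && (par (dec dx i j') && par (D j))) =
    xsum2 (fun j j' : 'I_r => (j < j')%N && (par (dx j') && par (D j)))
    (+) xsum (fun j : 'I_r => (j < i)%N && par (D j)).
  rewrite -xsumD; apply: eq_xsum => j.
  rewrite -[X in _ (+) X](xsum1 i (fun j' : 'I_r => (j < j')%N && par (D j))) -xsumD.
  apply: eq_xsum => j'; rewrite par_dec.
  by case: (j < j')%N; case: (par (dx j')); case: (j' == i); case: (par (D j)).
have -> : xsum (fun j : 'I_r => (j < i)%N && par (dx j + D j)) =
    xsum (fun j : 'I_r => (j < i)%N && par (dx j)) (+)
    xsum (fun j : 'I_r => (j < i)%N && par (D j)).
  by rewrite -xsumD; apply: eq_xsum => j; rewrite parD; case: ltnP.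
by case: (xsum _); case: (xsum _); case: (xsum2 _).
Qed.

(** The differential hits argument [k] of block [i]. After separation it passes the earlier blocks,
    the i-th operation and the earlier arguments of the block; before separation it passes all
    operations and all earlier arguments, and the interleaving then uses a lowered degree. *)
Lemma dif_sign_right (dx : 'I_r -> int) (dy : 'I_(\sum_i p i)%N -> int) (i : 'I_r) (k : 'I_(p i)) :
  interleave K dx (block_deg id dy) *
    ksgn K (\sum_(j < r | (j < i)%N) (dx j + block_deg id dy j)) *
    ksgn K (dx i) * ksgn K (\sum_(k' < p i | (k' < k)%N) dy (tagnat.Rank i k')) =
  ksgn K (\sum_j dx j) * ksgn K (\sum_(w < (\sum_i p i)%N | (w < tagnat.Rank i k)%N) dy w) *
    interleave K dx (dec (block_deg id dy) i).
Proof.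
rewrite !interleave_par !ksgn_par -!signr_addb (par_xsumT dx) !par_xsum.
congr (_ ^+ nat_of_bool _); set D := block_deg id dy.
have -> : xsum2 (fun j j' : 'I_r => (j < j')%N && (par (dx j') && par (dec D i j))) =
    xsum2 (fun j j' : 'I_r => (j < j')%N && (par (dx j') && par (D j)))
    (+) xsum (fun j : 'I_r => (i < j)%N && par (dx j)).
  rewrite /xsum2 xsumC [in RHS]xsumC -xsumD; apply: eq_xsum => j'.
  rewrite -[X in _ (+) X](xsum1 i (fun j : 'I_r => (j < j')%N && par (dx j'))) -xsumD.
  apply: eq_xsum => j; rewrite par_dec.
  by case: (j < j')%N; case: (par (dx j')); case: (j == i); case: (par (D j)).
have -> : xsum (fun w : 'I_(\sum_i p i)%N => (w < tagnat.Rank i k)%N && par (dy w)) =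
    xsum (fun j : 'I_r => (j < i)%N && par (D j)) (+)
    xsum (fun k' : 'I_(p i) => (k' < k)%N && par (dy (tagnat.Rank i k'))).
  rewrite xsum_Rank.
  rewrite -[X in _ (+) X](xsum1 i (fun _ => xsum (fun k' : 'I_(p i) =>
    (k' < k)%N && par (dy (tagnat.Rank i k'))))) -xsumD; apply: eq_xsum => j.
  case: (eqVneq j i) => [->|ji].
    rewrite ltnn /=; apply: eq_xsum => k'.
    by rewrite Rank_lt ltnn eqxx.
  rewrite addbF par_block_deg xsum_andl; apply: eq_xsum => k'.
  by rewrite Rank_lt (negbTE ji) orbF.
have -> : xsum (fun j : 'I_r => (j < i)%N && par (dx j + D j)) =
    xsum (fun j : 'I_r => (j < i)%N && par (dx j)) (+)
    xsum (fun j : 'I_r => (j < i)%N && par (D j)).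
  by rewrite -xsumD; apply: eq_xsum => j; rewrite parD; case: ltnP.
have -> : xsum (fun j => par (dx j)) = xsum (fun j : 'I_r => (j < i)%N && par (dx j)) (+)
    par (dx i) (+) xsum (fun j : 'I_r => (i < j)%N && par (dx j)).
  rewrite -[par (dx i)](xsum1 i (fun j => par (dx j))) -!xsumD; apply: eq_xsum => j.
  rewrite -val_eqE /=.
  by case: (ltngtP i j) => //= _; case: (par (dx j)).
case: (xsum2 _); do 4!case: (xsum _); by case: (par (dx i)).
Qed.

(** The differential of each block splits into a term on the operation and terms on the arguments;
    these match the two terms on the right by [dif_sign_left] and [dif_sign_right]. *)
Lemma dif_block_sep a (c : tens (fun i => M (p i))) (y : tpow A (\sum_i p i)%N) :
  homog a c -> dif (block_sep l c y) =
  block_sep l (dif c) y + ksgn K a *: block_sep l c (dif y).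
Proof.
move: c y; apply: tens_ext2h.
- move=> y; exact: lin_comp dif_lin (block_sep_linl _ _).
- move=> c; exact: lin_comp dif_lin (block_sep_linr _ _).
- move=> y; apply: lin_plus; last exact: lin_scale (block_sep_linl _ _).
  exact: lin_comp (block_sep_linl _ _) dif_lin.
- move=> c; apply: lin_plus; first exact: block_sep_linr.
  apply: lin_scale; exact: lin_comp (block_sep_linr _ _) dif_lin.
move=> dx x dy y hx hy <-.
rewrite -/(tpurec dy y) block_sep_pure // /sep_pure (linZ dif_lin).
set D := block_deg id dy.
set X := fun i => spure (dx i) (D i) (x i) _.
pose T i z := tpurec (dec (fun j => dx j + D j) i) (fun j => if j == i then z else X j).
pose Y i k := tpurec
  (fun k' => if k' == k then dy (tagnat.Rank i k') - 1 else dy (tagnat.Rank i k'))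
  (fun k' : 'I_(p i) => if k' == k then dif (y (tagnat.Rank i k')) else y (tagnat.Rank i k')).
rewrite shuffle_signE koszul_id mul1r.
rewrite [X in _ *: X = _](_ : _ =
  \sum_(i < r) ksgn K (\sum_(j < r | (j < i)%N) (dx j + D j)) *:
    T i (spure (dx i - 1) (D i) (dif (x i))
       (tpurec (fun k => dy (tagnat.Rank i k)) (fun k => y (tagnat.Rank i k)))) +
  \sum_(i < r) \sum_(k < p i) (ksgn K (\sum_(j < r | (j < i)%N) (dx j + D j)) * ksgn K (dx i) *
     ksgn K (\sum_(k' < p i | (k' < k)%N) dy (tagnat.Rank i k'))) *:
    T i (spure (dx i) (D i - 1) (x i) (Y i k))); last first.
  rewrite dif_tpurec -big_split; apply: eq_bigr => i _ /=.
  have -> : tpurec (fun j => if j == i then dx j + D j - 1 else dx j + D j)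
          (fun j => if j == i then dif (X j) else X j) = T i (dif (X i)).
    congr tpurec; apply: dfunext => j.
    by case: eqP => // ->.
  have lT : linear (T i) by apply: tpure_set_lin.
  rewrite /X spureE dif_qpure (linD lT) (linZ lT) scalerDr; congr (_ + _).
  rewrite dif_tpurec (lin_sumE _ _ _ (qpure_linr _ _ _ _)) (lin_sumE _ _ _ lT) !scaler_sumr.
  apply: eq_bigr => k _.
  rewrite (linZ (qpure_linr _ _ _ _)) (linZ lT) !scalerA; congr (_ *: _).
  by rewrite mulrA.
rewrite scalerDr; congr (_ + _).
  rewrite scaler_sumr.
  rewrite dif_tpure (lin_sumE _ _ _ (block_sep_linl _ _)); apply: eq_bigr => i _.
  rewrite (linZ (block_sep_linl _ _)) block_sep_pure //; last first.
    by move=> j; case: eqP => // _; apply: dif_homog.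
  rewrite scalerA dif_sign_left /sep_pure shuffle_signE koszul_id mul1r scalerA.
  congr (_ *: tpurec _ _); apply: dfunext => j.
    by rewrite /dec /D; case: ifP => //; rewrite addrAC.
  by case: eqP => // ->.
rewrite dif_tpurec (lin_sumE _ _ _ (block_sep_linr _ _)) !scaler_sumr big_Rank.
apply: eq_bigr => i _; rewrite scaler_sumr; apply: eq_bigr => k _.
rewrite (linZ (block_sep_linr _ _)) block_sep_pure //; last first.
  by move=> j; case: eqP => // _; apply: dif_homog.
rewrite /sep_pure shuffle_signE koszul_id mul1r !scalerA !mulrA dif_sign_right.
rewrite -/(dec dy (tagnat.Rank i k)) block_deg_dec.
congr (_ *: tpurec _ _); apply: dfunext => j.
  by rewrite /dec /D; case: ifP => //; rewrite addrA.
case: (eqVneq j i) => [->|ji].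
  rewrite /dec eqxx; congr (spure _ _ _ (tpurec _ _)); apply: dfunext => k'.
    by rewrite -(val_eqE (tagnat.Rank i k')) /= tagnat.eq_Rank eqxx val_eqE.
  by rewrite -(val_eqE (tagnat.Rank i k')) /= tagnat.eq_Rank eqxx val_eqE.
rewrite /X /dec (negbTE ji).
congr (spure _ _ _ (tpurec _ _)); apply: dfunext => k'.
  by rewrite -(val_eqE (tagnat.Rank j k')) /= tagnat.eq_Rank (negbTE ji).
by rewrite -(val_eqE (tagnat.Rank j k')) /= tagnat.eq_Rank (negbTE ji).
Qed.

End BlocksIso.

Section BlocksIsoMap.
Variables (K : comPzRingType) (sym : bool) (M : sseq K sym) (A : complex K) (n : nat).

Lemma blocks_isoE : @blocks_iso K sym M A n =
  qlift (fun (p : 'I_n -> nat) _ _ c y => block_sep (obid sym (\sum_i p i)%N) c y).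
Proof. by []. Qed.

Lemma blocks_qbilin : qbilin (@blocks_arr K sym M A n)
  (fun (p : 'I_n -> nat) _ _ c y => block_sep (obid sym (\sum_i p i)%N) c y).
Proof.
split=> [p a b y _|p a b c _|p p' u v a b c y]; [exact: block_sep_linl | exact: block_sep_linr |].
case=> rho beta betaE _ _.
rewrite (@block_sep_act _ _ _ _ _ _ (obid sym n) p p' rho beta) // tpact_id //.
Qed.

Lemma blocks_iso_pure (p : 'I_n -> nat) a b c y :
  homog a c -> homog b y ->
  blocks_iso (qpure (@blocks_arr K sym M A n) (i := p) a b c y) =
  block_sep (obid sym (\sum_i p i)%N) c y.
Proof. by move=> ha hb; rewrite blocks_isoE qlift_pureh //; apply: blocks_qbilin. Qed.

Lemma blocks_iso_lin : linear (@blocks_iso K sym M A n).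
Proof. rewrite blocks_isoE; apply: qlift_lin; exact: blocks_qbilin. Qed.

Lemma blocks_iso_graded : graded 0 (@blocks_iso K sym M A n).
Proof.
split=> [|i]; first exact: blocks_iso_lin.
rewrite addr0; apply: qtens_ext.
- exact: lin_comp blocks_iso_lin prj_lin.
- exact: lin_comp prj_lin blocks_iso_lin.
move=> p a b c y hc hy; rewrite prj_qpure blocks_iso_pure //.
rewrite (homog_prj i (block_sep_homog hc hy)) eq_sym.
by case: ifP => _; rewrite ?blocks_iso_pure ?(lin0 blocks_iso_lin).
Qed.

Lemma blocks_iso_dif x : blocks_iso (dif x) = dif (@blocks_iso K sym M A n x).
Proof.
move: x; apply: qtens_ext.
- exact: lin_comp blocks_iso_lin dif_lin.
- exact: lin_comp dif_lin blocks_iso_lin.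
move=> p a b c y hc hy; rewrite dif_qpure (linD blocks_iso_lin) (linZ blocks_iso_lin).
rewrite !blocks_iso_pure ?(dif_block_sep _ hc) //; by apply: dif_homog.
Qed.

End BlocksIsoMap.
Arguments blocks_iso_lin {K sym M A n}.

(** * Multilinear extension *)

Section Multilinear.
Variables (K : comPzRingType) (n : nat).

Lemma mlin_dfwith (V : 'I_n -> lmodType K) (W : lmodType K) (F : (forall i, V i) -> W) v i :
  mlin F -> linear (fun x : V i => F (dfwith v x)).
Proof.
move=> mF a x y; apply: (mF i) => [|j ji|j ji]; rewrite ?dfwith_in //.
  by rewrite !dfwith_out // eq_sym.
by rewrite !dfwith_out // eq_sym.
Qed.

(** The coordinates are freed one at a time: with the others fixed, both maps are linear, hence
    determined by their values on the class [S i]. *)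
Lemma mlin_ext (V : 'I_n -> lmodType K) (W : lmodType K) (S : forall i, V i -> Prop)
    (F G : (forall i, V i) -> W) :
  (forall i (u v : V i -> W), linear u -> linear v ->
     (forall x, S i x -> u x = v x) -> u =1 v) ->
  mlin F -> mlin G -> (forall v, (forall i, S i (v i)) -> F v = G v) ->
  forall v, F v = G v.
Proof.
move=> Sext mF mG FG.
suff H (s : seq 'I_n) : forall v, (forall i, i \notin s -> S i (v i)) -> F v = G v.
  by move=> v; apply: (H (enum 'I_n)) => i; rewrite mem_enum.
elim: s => [|i s IH] v Sv; first by apply: FG => i; apply: Sv.
have vE : v = dfwith v (v i).
  apply: dfunext => j.
  case: (eqVneq i j) => [<-|ij]; by rewrite ?dfwith_in ?dfwith_out.
rewrite vE; apply: (Sext i (fun x => F (dfwith v x)) (fun x => G (dfwith v x)));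
  [exact: mlin_dfwith | exact: mlin_dfwith | move=> x Sx].
apply: IH => j js; case: (eqVneq i j) => [<-|ij]; first by rewrite dfwith_in.
by rewrite dfwith_out //; apply: Sv; rewrite inE negb_or eq_sym ij.
Qed.

Variables (X : 'I_n -> Type) (rel : forall i, seq (K * X i) -> Prop) (W : lmodType K).
Variable G : (forall i, X i) -> W.

(** [plift] is applied to one coordinate after another; [g] holds the generators already chosen,
    with arbitrary entries in the coordinates still to come. *)
Fixpoint mlift_rec (s : seq 'I_n) (v : forall i, pres (@rel i)) (g : forall i, X i) : W :=
  if s is i :: s' then plift (fun x => mlift_rec s' v (dfwith g x)) (v i) else G g.

Hypothesis G_compat : forall g i, compat (@rel i) (fun x => G (dfwith g x)).

Lemma dfwithC (g : forall i, X i) i j (x : X i) (y : X j) : i != j ->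
  dfwith (dfwith g x) y = dfwith (dfwith g y) x.
Proof.
move=> ij; apply: dfunext => k.
case: (eqVneq i k) => [<-|ik].
  by rewrite dfwith_in dfwith_out 1?eq_sym // dfwith_in.
case: (eqVneq j k) => [<-|jk]; first by rewrite dfwith_in dfwith_out // dfwith_in.
by rewrite !dfwith_out.
Qed.

(** The extensions in the other coordinates are finite sums, which can be exchanged with the
    evaluation of a relator in coordinate [i]. *)
Lemma mlift_rec_compat s v g i : i \notin s ->
  compat (@rel i) (fun x => mlift_rec s v (dfwith g x)).
Proof.
elim: s g => [|j s IH] g; first by move=> _; apply: G_compat.
rewrite inE negb_or => /andP[ij is0] r rr /=.
rewrite /plift /ev; under eq_bigr do rewrite scaler_sumr.
rewrite exchange_big /= big1 // => kx _.
under eq_bigr do rewrite scaleCA dfwithC //.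
by rewrite -scaler_sumr [X in _ *: X](IH _ is0 _ rr) scaler0.
Qed.

Lemma mlift_rec_ext s v v' g : (forall i, i \in s -> v i = v' i) ->
  mlift_rec s v g = mlift_rec s v' g.
Proof.
elim: s g => [|i s IH] g //= vv'; rewrite vv' ?inE ?eqxx //.
congr plift; apply: dfunext => x; apply: IH => j js.
by rewrite vv' // inE js orbT.
Qed.

Lemma mlift_rec_lin s i a (x y z : forall i, pres (@rel i)) g : uniq s -> i \in s ->
  x i = a *: y i + z i ->
  (forall j, j != i -> y j = x j) -> (forall j, j != i -> z j = x j) ->
  mlift_rec s x g = a *: mlift_rec s y g + mlift_rec s z g.
Proof.
move=> us js xE yE zE; elim: s g us js => [|j s IH] g //= /andP[js us].
rewrite inE; case: (eqVneq i j) => [ij _|ij /= is0]; last first.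
  rewrite yE 1?eq_sym // zE 1?eq_sym //.
  rewrite /plift /ev scaler_sumr -big_split; apply: eq_bigr => kx _ /=.
  by rewrite IH // scalerDr scaleCA.
subst j; rewrite xE plift_linear; last exact: mlift_rec_compat.
have sE w : (forall j, j != i -> w j = x j) ->
    (fun x0 : X i => mlift_rec s x (dfwith g x0)) = (fun x0 => mlift_rec s w (dfwith g x0)).
  move=> wE; apply: dfunext => x0; apply: mlift_rec_ext => j jS.
  by rewrite wE //; apply: contraNneq js => <-.
by rewrite {1}(sE y yE) (sE z zE).
Qed.

Lemma mlift_rec_gen s (x g : forall i, X i) : uniq s ->
  mlift_rec s (fun i => gen (@rel i) (x i)) g =
  G (fun i => if i \in s then x i else g i).
Proof.
elim: s g => [|i s IH] g //= /andP[is0 us].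
rewrite plift_gen; last exact: mlift_rec_compat.
rewrite IH //; congr G; apply: dfunext => j.
rewrite inE; case: (eqVneq j i) => [->|ji] /=; first by rewrite dfwith_in (negbTE is0).
by rewrite dfwith_out // eq_sym.
Qed.

(** Every coordinate occurs in the enumeration, so on generators the starting family [g] is
    completely overwritten ([mlift_gen]). *)
Definition mlift (g : forall i, X i) v := mlift_rec (enum 'I_n) v g.

Lemma mlift_mlin g : mlin (mlift g).
Proof.
move=> i a x y z xE yE zE; apply: (mlift_rec_lin (i := i)) => //.
  exact: enum_uniq.
by rewrite mem_enum.
Qed.

Lemma mlift_gen g x : mlift g (fun i => gen (@rel i) (x i)) = G x.
Proof.
rewrite /mlift mlift_rec_gen ?enum_uniq //; congr G.
by apply: dfunext => i; rewrite mem_enum.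
Qed.

End Multilinear.

(** * Concatenation of a family of tensors *)

Section Tconcat.
Variables (K : comPzRingType) (A : complex K) (r : nat).

Definition unrank (T : Type) (p : 'I_r -> nat) (z : forall i, 'I_(p i) -> T)
  (w : 'I_(\sum_i p i)%N) : T := z (tagnat.sig1 w) (tagnat.sig2 w).

Lemma unrankE (T : Type) (p : 'I_r -> nat) (z : forall i, 'I_(p i) -> T) i k :
  unrank z (tagnat.Rank i k) = z i k.
Proof.
transitivity (z (tag (tagnat.sig (tagnat.Rank i k))) (tagged (tagnat.sig (tagnat.Rank i k)))).
  by [].
by rewrite /tagnat.Rank tagnat.rankK.
Qed.

Lemma Rank_ind (p : 'I_r -> nat) (P : 'I_(\sum_i p i)%N -> Prop) :
  (forall i k, P (tagnat.Rank i k)) -> forall w, P w.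
Proof. by move=> H w; rewrite -(tagnat.sig2K w). Qed.

Variable p : 'I_r -> nat.

Definition tconcat_gen (g : forall i, tgen (fun _ : 'I_(p i) => A)) : tpow A (\sum_i p i)%N :=
  tpurec (unrank (fun i => (g i).1)) (unrank (fun i => (g i).2)).

Lemma tconcat_gen_compat g i :
  compat (@trel K (p i) (fun=> A)) (fun x => tconcat_gen (dfwith g x)).
Proof.
apply: trel_linP => [deg k a x y z xE yE zE|deg x]; rewrite /tconcat_gen.
  have dE (x0 : 'I_(p i) -> A) : unrank (fun i0 => (dfwith g (deg, x0) i0).1) =
      unrank (fun i0 => (dfwith g (deg, x) i0).1).
    apply: dfunext; apply: Rank_ind => j k'; rewrite !unrankE.
    by case: (eqVneq i j) k' => [<-|ij] k'; rewrite ?dfwith_in ?dfwith_out.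
  rewrite (dE y) (dE z); apply: (@tgen_lin _ _ _ _ (tagnat.Rank i k)).
  - by rewrite !unrankE !dfwith_in.
  - apply: Rank_ind => j k' jk; rewrite !unrankE.
    case: (eqVneq i j) k' jk => [<-|ij] k' jk; rewrite ?dfwith_in ?dfwith_out //=.
    by apply: yE; apply: contraNneq jk => ->.
  apply: Rank_ind => j k' jk; rewrite !unrankE.
  case: (eqVneq i j) k' jk => [<-|ij] k' jk; rewrite ?dfwith_in ?dfwith_out //=.
  by apply: zE; apply: contraNneq jk => ->.
rewrite /tpurec tpure_prj [RHS]tpure_prj; congr tpure.
  apply: dfunext; apply: Rank_ind => j k'; rewrite !unrankE.
  by case: (eqVneq i j) k' => [<-|ij] k'; rewrite ?dfwith_in ?dfwith_out.
apply: dfunext; apply: Rank_ind => j k'; rewrite !unrankE.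
case: (eqVneq i j) k' => [<-|ij] k'; rewrite ?dfwith_in ?dfwith_out //=.
by rewrite prj_prj eqxx.
Qed.

Definition tconcat : (forall i, tpow A (p i)) -> tpow A (\sum_i p i)%N :=
  mlift tconcat_gen (fun i => (fun=> 0, fun=> 0)).

Lemma tconcat_mlin : mlin tconcat.
Proof. exact/mlift_mlin/tconcat_gen_compat. Qed.

Lemma tconcat_pure (d : forall i, 'I_(p i) -> int) (x : forall i, 'I_(p i) -> A) :
  tconcat (fun i => tpurec (d i) (x i)) = tpurec (unrank d) (unrank x).
Proof.
exact: (mlift_gen tconcat_gen_compat _ (fun i => (d i, x i))).
Qed.

End Tconcat.

Definition is_tpurec (K : comPzRingType) (A : complex K) n (t : tpow A n) : Prop :=
  exists d x, (forall i, homog (d i) (x i)) /\ t = tpurec d x.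

Lemma is_tpurec_ext (K : comPzRingType) (A : complex K) n (W : lmodType K)
  (u v : tpow A n -> W) : linear u -> linear v ->
  (forall t, is_tpurec t -> u t = v t) -> u =1 v.
Proof. by move=> lu lv uv; apply: tens_ext => // d x hx; apply: uv; exists d, x. Qed.

Section TconcatAct.
Variables (K : comPzRingType) (sym : bool) (A : complex K) (r : nat) (p p' : 'I_r -> nat).
Variable rho : forall i, obij sym (p i) (p' i).

Let bf : 'I_(\sum_i p i)%N -> 'I_(\sum_i p' i)%N :=
  unrank (fun i k => tagnat.Rank i (rho i k)).
Let bg : 'I_(\sum_i p' i)%N -> 'I_(\sum_i p i)%N :=
  unrank (fun i k => tagnat.Rank i (oinv (rho i) k)).

Definition obblocks : obij sym (\sum_i p i)%N (\sum_i p' i)%N.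
Proof.
exists bf bg.
- by elim/Rank_ind=> i k; rewrite /bf /bg !unrankE ofunK.
- by elim/Rank_ind=> i k; rewrite /bf /bg !unrankE oinvK.
move=> s; elim/Rank_ind=> i k; elim/Rank_ind=> i' k'; rewrite /bf !unrankE !Rank_lt.
case/orP=> [->//|/andP[/eqP ii']]; subst i' => kk'.
by rewrite eqxx ltnn /=; apply: omono.
Defined.

Lemma obblocksE i k : obblocks (tagnat.Rank i k) = tagnat.Rank i (rho i k).
Proof. exact: unrankE. Qed.

Lemma obblocks_invE i k : oinv obblocks (tagnat.Rank i k) = tagnat.Rank i (oinv (rho i) k).
Proof. exact: unrankE. Qed.

(** The blocks stay in place, so the Koszul sign of the assembled bijection is the product of the
    signs inside the blocks. *)
Lemma tconcat_act (t : forall i, tpow A (p i)) :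
  tconcat (fun i => tpact A (rho i) (t i)) = tpact A obblocks (tconcat t).
Proof.
move: t; apply: (mlin_ext (S := fun i => @is_tpurec K A (p i))).
- by move=> i u v; apply: is_tpurec_ext.
- apply: (mlin_pre (u := fun i => tpact A (rho i))); last exact: tconcat_mlin.
  by move=> i; apply: cfun_lin.
- by apply: mlin_lin; [exact: cfun_lin | exact: tconcat_mlin].
move=> t /fin_all_exists [d /fin_all_exists [x dx]].
have tE : t = fun i => tpurec (d i) (x i).
  by apply: dfunext => i; have [] := dx i.
rewrite tE tconcat_pure tpact_pure.
rewrite (@koszul_blocks K _ _ id _ _ (fun i => oinv (rho i))) //; first last.
- exact: obblocks_invE.
- by move=> i; apply: oinv_bij.
rewrite koszul_id mul1r.
transitivity (tconcat (fun i => koszul K (oinv (rho i)) (d i) *: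
    tpurec (d i \o oinv (rho i)) (x i \o oinv (rho i)))).
  by congr tconcat; apply: dfunext => i; rewrite tpact_pure.
rewrite (mlin_scale _ _ (@tconcat_mlin _ _ _ _)) tconcat_pure; congr (_ *: tpurec _ _).
- by apply: eq_bigr => i _; congr koszul; apply: funext => k; rewrite /= unrankE.
- apply: dfunext; apply: Rank_ind => i k.
  by rewrite obblocks_invE !unrankE.
apply: dfunext; apply: Rank_ind => i k.
by rewrite obblocks_invE !unrankE.
Qed.

End TconcatAct.

(** * Bijectivity of blocks_iso *)

Section BlocksBijective.
Variables (K : comPzRingType) (sym : bool) (M : sseq K sym) (A : complex K) (n : nat).

Local Notation sgen := (@qgen K nat (sob M) (tpow A)).
Local Notation barr := (@blocks_arr K sym M A n).
Local Notation srel := (qrel (@schur_arr K sym M A)).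

(** The inverse of [blocks_iso] on generators: operations to the left, concatenated arguments to the
    right. The interleaving sign is its own inverse. Projecting each tensor makes the concatenation
    respect the degree labels. *)
Definition join_gen (g : 'I_n -> sgen) : blocks M A n :=
  interleave K (fun i => qa (g i)) (fun i => qb (g i)) *:
  qpure barr (i := fun i => qi (g i)) (\sum_i qa (g i)) (\sum_i qb (g i))
    (tpure (fun i => qa (g i)) (fun i => qp (g i)))
    (tconcat (fun i => prj (qb (g i)) (qq (g i)))).

(* Three generators of a common type; they let relators be substituted in   *)
(* one coordinate of a dependent family of generators.                      *)
Record gen3 := Gen3 { g3m : nat; g3a : int; g3b : int; g3p0 : M g3m; g3p1 : M g3m;
  g3p2 : M g3m; g3q0 : tpow A g3m; g3q1 : tpow A g3m; g3q2 : tpow A g3m }.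

Let pr0 (t : gen3) : sgen := QGen (g3a t) (g3b t) (g3p0 t) (g3q0 t).
Let pr1 (t : gen3) : sgen := QGen (g3a t) (g3b t) (g3p1 t) (g3q1 t).
Let pr2 (t : gen3) : sgen := QGen (g3a t) (g3b t) (g3p2 t) (g3q2 t).
Let diag (g : sgen) : gen3 :=
  Gen3 (qa g) (qb g) (qp g) (qp g) (qp g) (qq g) (qq g) (qq g).

Let dfwith_pr (pr : gen3 -> sgen) (g : 'I_n -> sgen) (i : 'I_n) t :
  (forall g, pr (diag g) = g) ->
  @dfwith 'I_n (fun=> sgen) g i (pr t) =
    fun j => pr (@dfwith 'I_n (fun=> gen3) (fun j => diag (g j)) i t j).
Proof.
move=> prd; apply: dfunext => j.
by case: (eqVneq i j) => [<-|ij]; rewrite ?dfwith_in ?dfwith_out.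
Qed.

Let dfpr0 g (i : 'I_n) t : @dfwith 'I_n (fun=> sgen) g i (pr0 t) =
  fun j => pr0 (@dfwith 'I_n (fun=> gen3) (fun j => diag (g j)) i t j).
Proof. by apply: dfwith_pr; case. Qed.
Let dfpr1 g (i : 'I_n) t : @dfwith 'I_n (fun=> sgen) g i (pr1 t) =
  fun j => pr1 (@dfwith 'I_n (fun=> gen3) (fun j => diag (g j)) i t j).
Proof. by apply: dfwith_pr; case. Qed.
Let dfpr2 g (i : 'I_n) t : @dfwith 'I_n (fun=> sgen) g i (pr2 t) =
  fun j => pr2 (@dfwith 'I_n (fun=> gen3) (fun j => diag (g j)) i t j).
Proof. by apply: dfwith_pr; case. Qed.

(** The same device for action relators: source and target are read off from one record, and the
    remaining coordinates carry the identity bijection. *)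
Record genact := GenAct { gam : nat; gam' : nat; garho : obij sym gam gam'; gaa : int;
  gab : int; gap : M gam; gaq : tpow A gam }.

Let src (t : genact) : sgen := QGen (gaa t) (gab t) (gap t) (gaq t).
Let tgt (t : genact) : sgen :=
  QGen (gaa t) (gab t) (sact M (garho t) (gap t)) (tpact A (garho t) (gaq t)).
Let trivact (g : sgen) : genact := GenAct (obid sym _) (qa g) (qb g) (qp g) (qq g).

(** Each relator in one coordinate follows from the corresponding property of the joined element.
    For an action relator, the bijections of all coordinates are assembled by [obblocks]. *)
Lemma join_gen_compat (g : 'I_n -> sgen) i :
  compat srel (fun x => join_gen (@dfwith 'I_n (fun=> sgen) g i x)).
Proof.
apply: qrelP.
- move=> m a b q k p1 p2; pose t := Gen3 a b (k *: p1 + p2) p1 p2 q q q.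
  rewrite (dfpr0 g i t) (dfpr1 g i t) (dfpr2 g i t) /join_gen /=.
  set W := dfwith _ _; rewrite scaleCA -scalerDr; congr (_ *: _).
  have -> : (fun j => prj (g3b (W j)) (g3q1 (W j))) = (fun j => prj (g3b (W j)) (g3q0 (W j))).
    apply: dfunext => j; rewrite /W.
    by case: (eqVneq i j) => [<-|ij]; rewrite ?dfwith_in ?dfwith_out.
  have -> : (fun j => prj (g3b (W j)) (g3q2 (W j))) = (fun j => prj (g3b (W j)) (g3q0 (W j))).
    apply: dfunext => j; rewrite /W.
    by case: (eqVneq i j) => [<-|ij]; rewrite ?dfwith_in ?dfwith_out.
  rewrite -qpure_linl; congr qpure; apply: (@tgen_lin _ _ _ _ i) => [|j ji|j ji].
  - by rewrite /W dfwith_in.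
  - by rewrite /W dfwith_out 1?eq_sym.
  by rewrite /W dfwith_out 1?eq_sym.
- move=> m a b p k q1 q2; pose t := Gen3 a b p p p (k *: q1 + q2) q1 q2.
  rewrite (dfpr0 g i t) (dfpr1 g i t) (dfpr2 g i t) /join_gen /=.
  set W := dfwith _ _; rewrite scaleCA -scalerDr; congr (_ *: _).
  have -> : (fun j => g3p1 (W j)) = (fun j => g3p0 (W j)).
    apply: dfunext => j; rewrite /W.
    by case: (eqVneq i j) => [<-|ij]; rewrite ?dfwith_in ?dfwith_out.
  have -> : (fun j => g3p2 (W j)) = (fun j => g3p0 (W j)).
    apply: dfunext => j; rewrite /W.
    by case: (eqVneq i j) => [<-|ij]; rewrite ?dfwith_in ?dfwith_out.
  rewrite -qpure_linr; congr qpure; apply: (tconcat_mlin (i := i)) => [|j ji|j ji].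
  - by rewrite /W dfwith_in; apply: prj_lin.
  - by rewrite /W dfwith_out 1?eq_sym.
  by rewrite /W dfwith_out 1?eq_sym.
- move=> m a b p q; pose t := Gen3 a b p (prj a p) 0 q (prj b q) 0.
  rewrite (dfpr0 g i t) (dfpr1 g i t) /join_gen /=.
  set W := dfwith _ _; rewrite tpure_prj.
  have -> : (fun j => prj (g3a (W j)) (g3p0 (W j))) = (fun j => prj (g3a (W j)) (g3p1 (W j))).
    apply: dfunext => j; rewrite /W.
    case: (eqVneq i j) => [<-|ij]; rewrite ?dfwith_in ?dfwith_out //.
    by rewrite [RHS]prj_homog.
  have -> : (fun j => prj (g3b (W j)) (g3q0 (W j))) = (fun j => prj (g3b (W j)) (g3q1 (W j))).
    apply: dfunext => j; rewrite /W.
    case: (eqVneq i j) => [<-|ij]; rewrite ?dfwith_in ?dfwith_out //.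
    by rewrite [RHS]prj_homog.
  by rewrite -tpure_prj.
move=> m0 m0' u v a b p q uv; case: _ _ / uv p q => m m' rho p q.
pose t := GenAct rho a b p q.
have srcE : @dfwith 'I_n (fun=> sgen) g i (QGen a b p q) =
    fun j => src (@dfwith 'I_n (fun=> genact) (fun j => trivact (g j)) i t j).
  apply: dfunext => j.
  by case: (eqVneq i j) => [<-|ij]; rewrite ?dfwith_in ?dfwith_out //; case: (g j).
have tgtE : @dfwith 'I_n (fun=> sgen) g i (QGen a b (sact M rho p) (tpact A rho q)) =
    fun j => tgt (@dfwith 'I_n (fun=> genact) (fun j => trivact (g j)) i t j).
  apply: dfunext => j.
  case: (eqVneq i j) => [<-|ij]; rewrite ?dfwith_in ?dfwith_out //.
  case: (g j) => m1 a1 b1 p1 q1.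
  transitivity (QGen a1 b1 (sact M (obid sym m1) p1) (tpact A (obid sym m1) q1)); last by [].
  by rewrite sact_id // tpact_id.
rewrite srcE tgtE /join_gen; set W := dfwith _ _; congr (_ *: _).
pose R j := garho (W j).
have tE : tpure (fun j => gaa (W j)) (fun j => sact M (R j) (gap (W j))) =
    @tcmap K sym _ _ (fun j => M (gam (W j))) (fun j => M (gam' (W j))) (obid sym n)
      (fun j => sact M (R j)) (tpure (fun j => gaa (W j)) (fun j => gap (W j))).
  by rewrite tcmap_pure koszul_id scale1r.
have cE : tconcat (fun j => prj (gab (W j)) (tpact A (R j) (gaq (W j)))) =
    tpact A (obblocks R) (tconcat (fun j => prj (gab (W j)) (gaq (W j)))).
  rewrite -tconcat_act; congr tconcat; apply: dfunext => j.
  by rewrite cfun_prj.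
have := @qpure_arr K _ _ _ barr (fun j => gam (W j)) (fun j => gam' (W j)) _ _
  (\sum_j gaa (W j)) (\sum_j gab (W j))
  (tpure (fun j => gaa (W j)) (fun j => gap (W j)))
  (tconcat (fun j => prj (gab (W j)) (gaq (W j)))) (BlocksArr M A (obblocksE R)).
by rewrite -tE -cE => /esym.
Qed.

Definition join_all : ('I_n -> schur M A) -> blocks M A n :=
  @mlift K n (fun=> sgen) (fun=> srel) _ join_gen (fun=> QGen 0 0 (0 : M 0%N) 0).

Lemma join_all_mlin : @mlin K n (fun=> schur M A) _ join_all.
Proof. exact/mlift_mlin/join_gen_compat. Qed.

Lemma join_all_spure (m : 'I_n -> nat) (a b : 'I_n -> int) (c : forall i, M (m i))
    (t : forall i, tpow A (m i)) :
  join_all (fun i => spure (a i) (b i) (c i) (t i)) =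
  interleave K a b *: qpure barr (i := m) (\sum_i a i) (\sum_i b i) (tpure a c)
    (tconcat (fun i => prj (b i) (t i))).
Proof.
exact: (mlift_gen join_gen_compat _ (fun i => QGen (a i) (b i) (c i) (t i))).
Qed.

Definition blocks_split : tpow (schur M A) n -> blocks M A n := tlift (fun _ x => join_all x).

Lemma blocks_split_multilin :
  @multilin K n (fun=> schur M A) _ (fun _ x => join_all x).
Proof. by move=> d i a x y z; apply: join_all_mlin. Qed.

Lemma blocks_split_lin : linear blocks_split.
Proof. exact/tlift_lin/blocks_split_multilin. Qed.

Lemma interleave_sq (a b : 'I_n -> int) : interleave K a b * interleave K a b = 1.
Proof. by rewrite interleave_par sign_sq. Qed.

Lemma unrank_Rank (T : Type) (p : 'I_n -> nat) (z : 'I_(\sum_i p i)%N -> T) :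
  unrank (fun i k => z (tagnat.Rank i k)) = z.
Proof. by apply: dfunext; apply: Rank_ind => i k; rewrite unrankE. Qed.

Lemma blocks_isoK : cancel (@blocks_iso K sym M A n) blocks_split.
Proof.
apply: qtens_ext.
- exact: lin_comp blocks_split_lin blocks_iso_lin.
- exact: lin_id.
move=> p a b c y hc hy; rewrite /= blocks_iso_pure //; move: c y hc hy.
apply: tens_ext2hh.
- move=> y; exact: lin_comp blocks_split_lin (block_sep_linl _ _).
- move=> y; exact: lin_comp blocks_split_lin (block_sep_linr _ _).
- move=> y; exact: (@qpure_linl K _ _ _ barr p a b y).
- move=> c; exact: (@qpure_linr K _ _ _ barr p a b c).
move=> dx x dy y hx hy <- <-.
rewrite -/(tpurec dy y) block_sep_pure // /sep_pure shuffle_signE koszul_id mul1r.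
rewrite (linZ blocks_split_lin) /blocks_split tlift_pureh.
- rewrite join_all_spure scalerA interleave_sq scale1r big_sum_block_deg.
  congr qpure; rewrite -[dy in RHS]unrank_Rank -[y in RHS]unrank_Rank -tconcat_pure.
  by congr tconcat; apply: dfunext => i; apply: homog_tpure.
- exact: blocks_split_multilin.
by move=> i; apply: homog_qpure.
Qed.

(** A homogeneous operation with homogeneous arguments: on such data the projections built into the
    lifts act trivially. *)
Record spanning := Spanning { sp_n : nat; sp_a : int; sp_c : M sp_n;
  sp_d : 'I_sp_n -> int; sp_x : 'I_sp_n -> A;
  sp_hc : homog sp_a sp_c; sp_hx : forall k, homog (sp_d k) (sp_x k) }.

Arguments sp_d s k : clear implicits.
Arguments sp_x s k : clear implicits.

Definition sp_elt (s : spanning) : schur M A :=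
  spure (sp_a s) (\sum_k sp_d s k) (sp_c s) (tpurec (sp_d s) (sp_x s)).

Lemma sp_ext (W : lmodType K) (u v : schur M A -> W) : linear u -> linear v ->
  (forall s, u (sp_elt s) = v (sp_elt s)) -> u =1 v.
Proof.
move=> lu lv uv; apply: qtens_ext => // m a b c t hc ht.
move: t ht; apply: tens_exth.
- exact: lin_comp lu (spure_linr _ _ _).
- exact: lin_comp lv (spure_linr _ _ _).
by move=> d x hx <-; apply: (uv (Spanning hc hx)).
Qed.

Lemma sp_homog s : homog (sp_a s + \sum_k sp_d s k) (sp_elt s).
Proof. exact: homog_qpure. Qed.

Lemma join_all_spanning (s : 'I_n -> spanning) :
  blocks_iso (join_all (fun i => sp_elt (s i))) =
  tpurec (fun i => sp_a (s i) + \sum_k sp_d (s i) k) (fun i => sp_elt (s i)).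
Proof.
rewrite join_all_spure (linZ blocks_iso_lin).
have -> : (fun i => prj (\sum_k sp_d (s i) k) (tpurec (sp_d (s i)) (sp_x (s i)))) =
          (fun i => tpurec (sp_d (s i)) (sp_x (s i))).
  by apply: dfunext => i; apply: homog_tpure.
have dE : forall i, \sum_k sp_d (s i) k = block_deg id (unrank (fun i => sp_d (s i))) i.
  by move=> i; apply: eq_bigr => k _; rewrite unrankE.
have homX : homog (\sum_i \sum_k sp_d (s i) k) (tpurec (unrank (fun i => sp_d (s i)))
    (unrank (fun i => sp_x (s i)))).
  have -> : \sum_i \sum_k sp_d (s i) k = \sum_w unrank (fun i => sp_d (s i)) w.
    by rewrite -big_sum_block_deg; apply: eq_bigr => i _; apply: dE.
  exact: homog_tpure.
rewrite tconcat_pure blocks_iso_pure //; last exact: homog_tpure.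
rewrite block_sep_pure //; first last.
- by apply: Rank_ind => i k; rewrite !unrankE; apply: sp_hx.
- by move=> i; apply: sp_hc.
have dE' : (fun i => \sum_k sp_d (s i) k) = block_deg id (unrank (fun i => sp_d (s i))).
  exact: funext.
rewrite /sep_pure shuffle_signE koszul_id mul1r scalerA dE' interleave_sq scale1r.
congr tpurec; apply: dfunext => i; rewrite -?dE //.
congr (spure _ _ _ (tpurec _ _)); apply: dfunext => k.
  exact: unrankE.
exact: unrankE.
Qed.

(** By multilinearity each factor can be taken in the spanning set, after composing with the
    projections to the prescribed degrees; there [join_all_spanning] applies. *)
Lemma blocks_splitK : cancel blocks_split (@blocks_iso K sym M A n).
Proof.
apply: tens_ext.
- exact: lin_comp blocks_iso_lin blocks_split_lin.
- exact: lin_id.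
move=> d x hx; rewrite /= /blocks_split tlift_pureh //; last exact: blocks_split_multilin.
have : forall x : 'I_n -> schur M A, blocks_iso (join_all (fun i => prj (d i) (x i))) =
    tpurec d (fun i => prj (d i) (x i)).
  apply: (@mlin_ext K n (fun=> schur M A) _ (fun _ x => exists s, x = sp_elt s)).
  - by move=> _ u v lu lv uv; apply: sp_ext => // s; apply: uv; exists s.
  - apply: mlin_lin; first exact: blocks_iso_lin.
    apply: (@mlin_pre K n (fun=> schur M A) (fun=> schur M A) _ join_all (fun i => prj (d i))).
      by move=> i; apply: prj_lin.
    exact: join_all_mlin.
  - apply: (@mlin_pre K n (fun=> schur M A) (fun=> schur M A) _ (tpure d) (fun i => prj (d i))).
      by move=> i; apply: prj_lin.
    exact: tpure_mlin.
  move=> v /fin_all_exists [s sE]; have {sE} -> : v = fun i => sp_elt (s i) by exact: funext.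
  (* If some prescribed degree is not the actual one, that factor projects to zero and both sides
     vanish. *)
  have [ds|/existsNP [i ds]] := pselect (forall i, d i = sp_a (s i) + \sum_k sp_d (s i) k).
    have -> : (fun i => prj (d i) (sp_elt (s i))) = (fun i => sp_elt (s i)).
      by apply: dfunext => i; rewrite ds; apply: sp_homog.
    by rewrite join_all_spanning; congr tpurec; apply: funext => i; rewrite ds.
  have e0 : prj (d i) (sp_elt (s i)) = 0.
    by rewrite (homog_prj _ (@sp_homog (s i))); case: eqP.
  rewrite (mlin0 (i := i) join_all_mlin e0) (lin0 blocks_iso_lin).
  by symmetry; apply: (mlin0 (i := i) (@tpure_mlin _ _ _ d) e0).
by move/(_ x); rewrite funext_homog.
Qed.

Lemma blocks_invK : cancel (@blocks_inv K sym M A n) (@blocks_iso K sym M A n).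
Proof.
move=> y; rewrite /blocks_inv; case: pselect => [p|[]]; first by case: cid.
by exists (blocks_split y); apply: blocks_splitK.
Qed.

Lemma blocks_isoKinv : cancel (@blocks_iso K sym M A n) (@blocks_inv K sym M A n).
Proof. by move=> x; apply: (can_inj blocks_isoK); rewrite blocks_invK. Qed.

Lemma blocks_inv_lin : linear (@blocks_inv K sym M A n).
Proof.
move=> a x y; apply: (can_inj blocks_isoK).
by rewrite blocks_iso_lin !blocks_invK.
Qed.

Lemma blocks_inv_graded : graded 0 (@blocks_inv K sym M A n).
Proof.
split=> [|i x]; first exact: blocks_inv_lin.
apply: (can_inj blocks_isoK).
by rewrite (blocks_iso_graded M A n).2 !blocks_invK !addr0.
Qed.

End BlocksBijective.

(** * Thick maps between cofree coalgebras *)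

Section ThickEquivariance.
Variables (K : comPzRingType).

Lemma obij_mono_le n (b : obij false n n) (i : 'I_n) : (i <= b i)%N.
Proof.
case: i => k; elim: k => [|k IH] kn //=.
apply: leq_ltn_trans (IH (ltnW kn)) _.
by apply: omono.
Qed.

(** An increasing self-bijection and its inverse both lie above the identity. *)
Lemma obij_mono_id n (b : obij false n n) : b =1 id.
Proof.
move=> i; apply: ord_inj; apply/eqP; rewrite eqn_leq obij_mono_le andbT.
by have := obij_mono_le (obinv b) (b i); rewrite /= ofunK.
Qed.

Lemma pact_tpact sym (A : complex K) n (s : 'S_n) (b : obij sym n n) (t : tpow A n) :
  s =1 b -> pact s t = tpact A b t.
Proof.
move=> sb; have E : (fun i => (s^-1)%g i) = oinv b.
  by apply: funext => i; apply: (canLR (permK s)); rewrite sb oinvK.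
by rewrite /pact E.
Qed.

Variables (sym : bool) (A B : complex K) (F : thick A B).
Hypothesis F_sym : sym -> symmetric_thick F.

Lemma thick_tpact m n (b : obij sym m n) (t : tpow A m) :
  F (tpact A b t) = tpact B b (F t).
Proof.
have mn := obij_card b; subst n.
have [symT|symF] : sym \/ ~~ sym by apply/orP; rewrite orbN.
  have sE : perm (can_inj (ofunK b)) =1 b by move=> i; rewrite permE.
  by rewrite -!(pact_tpact _ sE) F_sym.
have b1 : b =1 id by move: b; rewrite (negbTE symF); apply: obij_mono_id.
by rewrite !tpact_id.
Qed.

End ThickEquivariance.

Section ThickSchur.
Variables (K : comPzRingType) (sym : bool) (M : sseq K sym).

Section Maps.
Variables (A B : complex K) (e : int) (F : thick A B).
Hypothesis F_gr : is_thick e F.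
Hypothesis F_sym : sym -> symmetric_thick F.

Lemma schur_map_arr m n u1 v1 : @schur_arr K sym M A m n u1 v1 -> exists u2 v2,
  [/\ @schur_arr K sym M B m n u2 v2, forall p, u1 p = u2 p & forall q, F (v1 q) = v2 (F q)].
Proof.
case=> m' n' b; exists (sact M b), (tpact B b); split=> //.
by move=> q; apply: thick_tpact.
Qed.

Lemma schur_map_graded : graded e (@schur_map K sym M A B e F).
Proof.
apply: qmap_graded => [m|m|]; [exact: graded_id | exact: F_gr | exact: schur_map_arr].
Qed.

Lemma schur_map_pure m a b (c : M m) t :
  schur_map e F (spure a b c t) = ksgn K (e * a) *: spure a (b + e) c (F t).
Proof.
apply: qmap_pure => [i|i|]; [exact: graded_id | exact: F_gr | exact: schur_map_arr].
Qed.

Definition blocks_map n : blocks M A n -> blocks M B n :=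
  qmap (@blocks_arr K sym M A n) (@blocks_arr K sym M B n) id e (fun=> id)
    (fun r => @F (\sum_i r i)%N).

Lemma blocks_map_arr n p p' u1 v1 : @blocks_arr K sym M A n p p' u1 v1 -> exists u2 v2,
  [/\ @blocks_arr K sym M B n p p' u2 v2, forall p, u1 p = u2 p & forall q, F (v1 q) = v2 (F q)].
Proof.
case=> rho b bE; do 2!eexists; split; first exact: (BlocksArr M B bE).
  by [].
by move=> q; apply: thick_tpact.
Qed.

Lemma blocks_map_graded n : graded e (@blocks_map n).
Proof.
apply: qmap_graded => [m|m|]; [exact: graded_id | exact: F_gr | exact: blocks_map_arr].
Qed.

Lemma blocks_map_pure n (p : 'I_n -> nat) a b c y :
  blocks_map (qpure (@blocks_arr K sym M A n) (i := p) a b c y) =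
  ksgn K (e * a) *: qpure (@blocks_arr K sym M B n) (i := p) a (b + e) c (F y).
Proof.
apply: qmap_pure => [i|i|]; [exact: graded_id | exact: F_gr | exact: blocks_map_arr].
Qed.

Lemma tsm_iso n x :
  thick_schur_map M e F n (blocks_iso x) = blocks_iso (@blocks_map n x).
Proof. by rewrite /thick_schur_map blocks_isoKinv. Qed.

Lemma tsm_pure n (p : 'I_n -> nat) a b c y :
  thick_schur_map M e F n (blocks_iso (qpure (@blocks_arr K sym M A n) (i := p) a b c y)) =
  ksgn K (e * a) *: blocks_iso (qpure (@blocks_arr K sym M B n) (i := p) a (b + e) c (F y)).
Proof. by rewrite tsm_iso blocks_map_pure (linZ blocks_iso_lin). Qed.

Lemma tsm_thick : is_thick e (thick_schur_map M e F).
Proof.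
move=> n; apply: graded_cast (addr0 e) _.
apply: (@graded_comp K _ _ _ 0 e); first exact: blocks_iso_graded.
apply: (graded_cast (add0r e)).
by apply: (@graded_comp K _ _ _ e 0); [exact: blocks_map_graded | exact: blocks_inv_graded].
Qed.

Lemma tsm_lin n : linear (@thick_schur_map K sym M A B e F n).
Proof. exact: (tsm_thick n).1. Qed.

End Maps.

Lemma tpow_schur_ext (A : complex K) n (W : lmodType K) (u v : tpow (schur M A) n -> W) :
  linear u -> linear v ->
  (forall (p : 'I_n -> nat) a b c y, homog a c -> homog b y ->
     u (blocks_iso (qpure (@blocks_arr K sym M A n) (i := p) a b c y)) =
     v (blocks_iso (qpure (@blocks_arr K sym M A n) (i := p) a b c y))) ->
  u =1 v.
Proof.
move=> lu lv uv x; rewrite -(blocks_invK x); move: (blocks_inv x).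
apply: (@qtens_ext _ _ _ _ _ _ (fun z => u (blocks_iso z)) (fun z => v (blocks_iso z))).
- exact: lin_comp lu blocks_iso_lin.
- exact: lin_comp lv blocks_iso_lin.
exact: uv.
Qed.

Lemma bdry_lin (A B : complex K) e (u : A -> B) : linear u -> linear (bdry e u).
Proof.
move=> lu; apply: lin_minus; first exact: lin_comp dif_lin lu.
apply: lin_scale; exact: lin_comp lu dif_lin.
Qed.

Lemma tsm_bdry (A B : complex K) e (F : thick A B) n (p : 'I_n -> nat) a b c y :
  is_thick e F -> (sym -> symmetric_thick F) ->
  bdry e (thick_schur_map M e F n)
    (blocks_iso (qpure (@blocks_arr K sym M A n) (i := p) a b c y)) =
  ksgn K ((e - 1) * a) *:
    blocks_iso (qpure (@blocks_arr K sym M B n) (i := p) a (b + (e - 1)) c (bdry e (@F _) y)).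
Proof.
move=> Fg Fs; rewrite /bdry -blocks_iso_dif !dif_qpure.
rewrite (linD blocks_iso_lin) (linZ blocks_iso_lin).
rewrite (linD (tsm_lin Fg Fs (n := n))) (linZ (tsm_lin Fg Fs (n := n))) !tsm_pure //.
rewrite (linZ dif_lin) -blocks_iso_dif dif_qpure.
rewrite (linD blocks_iso_lin) (linZ blocks_iso_lin).
rewrite !scalerDr opprD addrACA !scalerA.
(* The two terms in which the differential hits the operations now have the same coefficient and
   cancel. *)
have -> : ksgn K e * ksgn K (e * (a - 1)) = ksgn K (e * a).
  by rewrite -ksgnD; apply: ksgn_par_eq; rewrite !(parD, parN, parM); case: (par e); case: (par a).
rewrite subrr add0r.
have -> : ksgn K e * ksgn K a * ksgn K (e * a) = ksgn K (e * a) * ksgn K a * ksgn K e by ring.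
have -> : ksgn K ((e - 1) * a) = ksgn K (e * a) * ksgn K a.
  by rewrite -ksgnD; apply: ksgn_par_eq; rewrite !(parD, parN, parM); case: (par e); case: (par a).
set s := ksgn K (e * a) * ksgn K a; rewrite -(scalerA s) -scalerBr; congr (_ *: _).
rewrite -(linZ blocks_iso_lin) -(linB blocks_iso_lin).
congr blocks_iso; rewrite -[b + e - 1]addrA [b - 1 + e]addrAC -[b + e - 1]addrA.
by rewrite -(linZ (qpure_linr _ _ _ _)) -(linB (qpure_linr _ _ _ _)).
Qed.

Lemma tpow1_lin (A : complex K) : linear (@tpow1 K A).
Proof. by apply: tlift_lin => d i a x y z; rewrite (ord1 i). Qed.
Arguments tpow1_lin {A}.

Lemma tpow1_pure (A : complex K) d (x : 'I_1 -> A) :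
  tpow1 (tpurec d x) = prj (d ord0) (x ord0).
Proof. by rewrite /tpow1 tlift_pure // => d' i a x' y z; rewrite (ord1 i). Qed.

Lemma Rank_ord0 (p : 'I_1 -> nat) (k : 'I_(p ord0)) :
  tagnat.Rank ord0 k = cast_ord (esym (big_ord1 _ p)) k.
Proof. by apply: ord_inj; rewrite tagnat.RankEsum /= big_pred0. Qed.

Lemma tpow1_block_sep (A : complex K) (p : 'I_1 -> nat) dx x b (y : tpow A (\sum_i p i)%N) :
  (forall i, homog (dx i) (x i)) -> homog b y ->
  tpow1 (block_sep (M := M) (obid sym _) (tpure dx x) y) =
  spure (dx ord0) b (x ord0) (tpact A (obcast sym (big_ord1 _ p)) y).
Proof.
move=> hx; move: y; apply: tens_exth.
- exact: lin_comp tpow1_lin (block_sep_linr _ _).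
- exact: lin_comp (@spure_linr K sym M A _ (dx ord0) b (x ord0)) cfun_lin.
move=> dy y hy <-.
rewrite -/(tpurec dy y) block_sep_pure // (linZ tpow1_lin) tpow1_pure.
rewrite [prj _ _]homog_qpure tpact_pure koszul_mono; last by move=> i j /ltnW.
rewrite shuffle_signE koszul_id mul1r interleave_par [xsum2 _]big1 => [|i _]; last first.
  by apply: big1 => j _; rewrite (ord1 i) (ord1 j).
rewrite !scale1r.
have -> : block_deg (obid sym (\sum_i p i)%N) dy ord0 = \sum_w dy w.
  by rewrite -big_sum_block_deg [RHS]big_ord1.
congr (spure _ _ _ (tpurec _ _)); apply: dfunext => k /=.
  by rewrite Rank_ord0.
by rewrite Rank_ord0.
Qed.

Lemma tpow1_tsm (A B : complex K) e (F : thick A B) (t : tpow (schur M A) 1) :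
  is_thick e F -> (sym -> symmetric_thick F) ->
  tpow1 (thick_schur_map M e F 1 t) = schur_map e F (tpow1 t).
Proof.
move=> Fg Fs; move: t; apply: tpow_schur_ext.
- exact: lin_comp tpow1_lin (tsm_lin Fg Fs (n := 1)).
- exact: lin_comp (schur_map_graded Fg Fs).1 tpow1_lin.
move=> p a b c y hc hy; rewrite tsm_pure // (linZ tpow1_lin).
have hF : homog (b + e) (F _ y) by apply: graded_homog (Fg _) hy.
rewrite !blocks_iso_pure //; move: c hc; apply: tens_exth.
- apply: lin_scale; exact: lin_comp tpow1_lin (block_sep_linl _ _).
- apply: lin_comp (schur_map_graded Fg Fs).1 _; exact: lin_comp tpow1_lin (block_sep_linl _ _).
move=> dx x hx da; rewrite (tpow1_block_sep hx hF) (tpow1_block_sep hx hy) schur_map_pure //.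
have -> : dx ord0 = a by rewrite -da big_ord1.
by rewrite thick_tpact.
Qed.

End ThickSchur.
Arguments tpow1_lin {K A}.

Section ThickSchurProps.
Variables (K : comPzRingType) (sym : bool) (M : sseq K sym).

Section BlockPerm.
Variables (r r' : nat) (b : obij sym r r') (p : 'I_r -> nat).

Let bg : 'I_(\sum_i p (oinv b i))%N -> 'I_(\sum_i p i)%N :=
  unrank (fun i k => tagnat.Rank (oinv b i) k).

Let bgE i (k : 'I_(p (oinv b i))) : bg (tagnat.Rank i k) = tagnat.Rank (oinv b i) k.
Proof. exact: unrankE. Qed.

Let bg_inj : injective bg.
Proof.
apply: Rank_ind => i k; apply: Rank_ind => i' k'; rewrite !bgE => /(congr1 val)/eqP.
rewrite /= tagnat.eq_Rank => /andP[/eqP/(can_inj (oinvK b)) ii']; subst i'.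
by move=> /eqP/ord_inj ->.
Qed.

Let bg_surj v : exists z, bg z = v.
Proof.
move: v; apply: Rank_ind => j; rewrite -(ofunK b j) => k.
by exists (tagnat.Rank (b j) k); rewrite bgE.
Qed.

(** Moves whole blocks along [b] without reordering inside them. It is defined as an inverse because
    [bg] is the direction with an explicit formula. *)
Definition block_perm : obij sym (\sum_i p i)%N (\sum_i p (oinv b i))%N.
Proof.
apply: obinv; exists bg (fun v => projT1 (cid (bg_surj v))).
- by move=> z; apply: bg_inj; case: cid.
- by move=> v; case: cid.
move=> s; apply: Rank_ind => i k; apply: Rank_ind => i' k'; rewrite !bgE !Rank_lt.
case/orP=> [ii'|/andP[/eqP ii']]; first by rewrite (omono (obinv b) s ii').
by subst i' => kk'; rewrite eqxx kk' orbT.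
Defined.

Lemma block_permE i (k : 'I_(p (oinv b i))) :
  block_perm (tagnat.Rank (oinv b i) k) = tagnat.Rank i k.
Proof. by apply: bg_inj; rewrite bgE; apply: (oinvK (obinv block_perm)). Qed.

End BlockPerm.

(** Under [blocks_iso] a permutation of the factors permutes whole blocks, and [F] commutes with the
    induced permutation of the arguments. *)
Lemma tsm_sym (A B : complex K) e (F : thick A B) :
  is_thick e F -> (sym -> symmetric_thick F) ->
  sym -> symmetric_thick (thick_schur_map M e F).
Proof.
move=> Fg Fs symT n s; have mono : ~~ sym -> forall i j : 'I_n, (i < j)%N -> (s i < s j)%N.
  by rewrite symT.
pose b : obij sym n n := Obij (permK s) (permKV s) mono.
move=> t; rewrite !(@pact_tpact K sym _ _ s b) //; move: t; apply: tpow_schur_ext.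
- exact: lin_comp (tsm_lin (M := M) Fg Fs (n := n)) (@cfun_lin _ _ _ (tpact (schur M A) b)).
- exact: lin_comp (@cfun_lin _ _ _ (tpact (schur M B) b)) (tsm_lin (M := M) Fg Fs (n := n)).
move=> p a d c y hc hy; rewrite tsm_pure // (linZ cfun_lin).
have hF := graded_homog (Fg _) hy.
rewrite !blocks_iso_pure //.
have act (X : complex K) (z : tpow X (\sum_i p i)%N) := block_sep_act (M := M)
  (rho := fun i => obid sym (p (oinv b i))) c z (@block_permE _ _ b p).
rewrite -!act -(@blocks_iso_pure _ _ _ _ _ _ a d); [|exact: cmap_homog..].
rewrite tsm_pure // thick_tpact // blocks_iso_pure //; first exact: cmap_homog.
exact: cmap_homog.
Qed.

Lemma tsm_comp (A B D : complex K) e e' (F : thick B D) (G : thick A B) n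
    (p : 'I_n -> nat) a b c y :
  is_thick e F -> (sym -> symmetric_thick F) ->
  is_thick e' G -> (sym -> symmetric_thick G) ->
  thick_schur_map M e F n (thick_schur_map M e' G n
    (blocks_iso (qpure (@blocks_arr K sym M A n) (i := p) a b c y))) =
  ksgn K ((e + e') * a) *:
    blocks_iso (qpure (@blocks_arr K sym M D n) (i := p) a (b + e' + e) c (F _ (G _ y))).
Proof.
move=> Fg Fs Gg Gs; rewrite tsm_pure // (linZ (tsm_lin (M := M) Fg Fs (n := n))) tsm_pure //.
by rewrite scalerA mulrDl ksgnD mulrC.
Qed.

Lemma tsm_comp0 (A B D : complex K) e e' (F : thick B D) (G : thick A B) n t :
  is_thick e F -> (sym -> symmetric_thick F) ->
  is_thick e' G -> (sym -> symmetric_thick G) ->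
  (forall n t, F n (G n t) = 0) ->
  thick_schur_map M e F n (thick_schur_map M e' G n t) = 0.
Proof.
move=> Fg Fs Gg Gs FG; move: t; apply: tpow_schur_ext; last 1 first.
- move=> p a b c y hc hy; rewrite tsm_comp // FG (lin0 (qpure_linr _ _ _ _)).
  by rewrite (lin0 blocks_iso_lin) scaler0.
- exact: lin_comp (tsm_lin (M := M) Fg Fs (n := n)) (tsm_lin (M := M) Gg Gs (n := n)).
exact: lin_zero.
Qed.

Lemma tsm_comp1 (A B : complex K) (F : thick B A) (G : thick A B) n t :
  is_thick 0 F -> (sym -> symmetric_thick F) ->
  is_thick 0 G -> (sym -> symmetric_thick G) ->
  (forall n t, F n (G n t) = t) ->
  thick_schur_map M 0 F n (thick_schur_map M 0 G n t) = t.
Proof.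
move=> Fg Fs Gg Gs FG; move: t; apply: tpow_schur_ext; last 1 first.
- move=> p a b c y hc hy; rewrite tsm_comp // FG addr0 mul0r !addr0.
  by rewrite ksgn_par scale1r.
- exact: lin_comp (tsm_lin (M := M) Fg Fs (n := n)) (tsm_lin (M := M) Gg Gs (n := n)).
exact: lin_id.
Qed.

Lemma tsm_id (A : complex K) n t : thick_schur_map M 0 (fun n (t : tpow A n) => t) n t = t.
Proof.
move: t; apply: tpow_schur_ext; last 1 first.
- move=> p a b c y hc hy; rewrite tsm_pure //; last by move=> m; apply: graded_id.
  by rewrite mul0r addr0 ksgn_par scale1r.
- by apply: tsm_lin => [m|//]; apply: graded_id.
exact: lin_id.
Qed.

Lemma tsm_bdry0 (A B : complex K) (F : thick A B) n t :
  is_thick 0 F -> (sym -> symmetric_thick F) ->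
  (forall n t, bdry 0 (F n) t = 0) -> bdry 0 (thick_schur_map M 0 F n) t = 0.
Proof.
move=> Fg Fs F0; move: t; apply: tpow_schur_ext; last 1 first.
- move=> p a b c y hc hy; rewrite tsm_bdry // F0 (lin0 (qpure_linr _ _ _ _)).
  by rewrite (lin0 blocks_iso_lin) scaler0.
- exact/bdry_lin/tsm_lin.
exact: lin_zero.
Qed.

Lemma tsm_bdry1 (A B : complex K) (F : thick A B) (G : thick B A) (H : thick A A) n t :
  is_thick 0 F -> (sym -> symmetric_thick F) ->
  is_thick 0 G -> (sym -> symmetric_thick G) ->
  is_thick 1 H -> (sym -> symmetric_thick H) ->
  (forall n t, bdry 1 (H n) t = G n (F n t) - t) ->
  bdry 1 (thick_schur_map M 1 H n) t =
  thick_schur_map M 0 G n (thick_schur_map M 0 F n t) - t.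
Proof.
move=> Fg Fs Gg Gs Hg Hs Hb; move: t; apply: tpow_schur_ext; last 1 first.
- move=> p a b c y hc hy; rewrite tsm_bdry // Hb tsm_comp // subrr !addr0 mul0r.
  rewrite ksgn_par !scale1r (linB (qpure_linr _ _ _ _)).
  exact: (linB blocks_iso_lin).
- exact/bdry_lin/tsm_lin.
apply: lin_minus (@lin_id _ _).
exact: lin_comp (tsm_lin (M := M) Gg Gs (n := n)) (tsm_lin (M := M) Fg Fs (n := n)).
Qed.

End ThickSchurProps.

(** * Concatenation of tensors *)

Section Tcat.
Variables (K : comPzRingType).

Lemma split_lshift p q (j : 'I_p) : fintype.split (lshift q j) = inl j.
Proof. exact: (unsplitK (inl j)). Qed.

Lemma split_rshift p q (j : 'I_q) : fintype.split (rshift p j) = inr j.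
Proof. exact: (unsplitK (inr j)). Qed.

Lemma shift_ind p q (P : 'I_(p + q) -> Prop) :
  (forall j, P (lshift q j)) -> (forall j, P (rshift p j)) -> forall i, P i.
Proof. by move=> Pl Pr i; rewrite -(splitK i); case: (fintype.split i). Qed.

Definition scat (T : Type) p q (f : 'I_p -> T) (g : 'I_q -> T) (i : 'I_(p + q)) : T :=
  match fintype.split i with inl j => f j | inr j => g j end.

Lemma scat_l (T : Type) p q (f : 'I_p -> T) (g : 'I_q -> T) j : scat f g (lshift q j) = f j.
Proof. by rewrite /scat split_lshift. Qed.

Lemma scat_r (T : Type) p q (f : 'I_p -> T) (g : 'I_q -> T) j : scat f g (rshift p j) = g j.
Proof. by rewrite /scat split_rshift. Qed.

Lemma scat_shift (T : Type) p q (f : 'I_(p + q) -> T) :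
  scat (fun j => f (lshift q j)) (fun j => f (rshift p j)) = f.
Proof.
by apply: dfunext; apply: shift_ind => j; rewrite ?scat_l ?scat_r.
Qed.

Lemma xsum_shift p q (F : 'I_(p + q) -> bool) :
  xsum F = xsum (fun j => F (lshift q j)) (+) xsum (fun j => F (rshift p j)).
Proof. exact: big_split_ord. Qed.

Lemma sum_scat p q (f : 'I_p -> int) (g : 'I_q -> int) :
  \sum_i scat f g i = \sum_i f i + \sum_i g i.
Proof.
rewrite big_split_ord /=; congr (_ + _); apply: eq_bigr => j _; [exact: scat_l | exact: scat_r].
Qed.

Variable A : complex K.

Lemma scat_multilin_l p q ds dt (y : 'I_q -> A) :
  @multilin K p (fun=> A) _ (fun _ x => tpurec (scat ds dt) (scat x y)).
Proof.
move=> d i a x x1 x2 xE x1E x2E; apply: (@tgen_lin _ _ _ _ (lshift q i)).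
- by rewrite !scat_l.
- by apply: shift_ind => j ji; rewrite ?scat_l ?scat_r // x1E //; apply: contraNneq ji => ->.
by apply: shift_ind => j ji; rewrite ?scat_l ?scat_r // x2E //; apply: contraNneq ji => ->.
Qed.

Lemma scat_multilin_r p q ds (x : 'I_p -> A) :
  @multilin K q (fun=> A) _ (fun dt y => tpurec (scat ds dt) (scat x y)).
Proof.
move=> d i a y x1 x2 xE x1E x2E; apply: (@tgen_lin _ _ _ _ (rshift p i)).
- by rewrite !scat_r.
- by apply: shift_ind => j ji; rewrite ?scat_l ?scat_r // x1E //; apply: contraNneq ji => ->.
by apply: shift_ind => j ji; rewrite ?scat_l ?scat_r // x2E //; apply: contraNneq ji => ->.
Qed.

Lemma tcat_multilin p q (t : tpow A q) : @multilin K p (fun=> A) _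
  (fun ds x => tlift (fun dt (y : 'I_q -> A) => tpurec (scat ds dt) (scat x y)) t).
Proof.
move=> ds i a x x1 x2 xE x1E x2E; apply: tlift_linF => dt y.
exact: (@scat_multilin_l p q ds dt y ds i).
Qed.

Lemma tcatE p q (s : tpow A p) (t : tpow A q) : tcat s t =
  tlift (fun ds (x : 'I_p -> A) => tlift (fun dt (y : 'I_q -> A) =>
    tpurec (scat ds dt) (scat x y)) t) s.
Proof. by []. Qed.

Lemma tcat_linl p q (t : tpow A q) : linear (fun s : tpow A p => tcat s t).
Proof. by rewrite /tcat; apply/tlift_lin/tcat_multilin. Qed.

Lemma tcat_linr p q (s : tpow A p) : linear (fun t : tpow A q => tcat s t).
Proof.
move=> a t t'; rewrite !tcatE; apply: tlift_linF => ds x.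
by rewrite (tlift_lin (@scat_multilin_r _ _ _ _)).
Qed.

Lemma tcat_pure p q ds dt (x : 'I_p -> A) (y : 'I_q -> A) :
  (forall i, homog (ds i) (x i)) -> (forall i, homog (dt i) (y i)) ->
  tcat (tpurec ds x) (tpurec dt y) = tpurec (scat ds dt) (scat x y).
Proof.
move=> hx hy; rewrite tcatE tlift_pureh //; last exact: tcat_multilin.
by rewrite tlift_pureh //; apply: scat_multilin_r.
Qed.

Lemma tcat_ext p q (W : lmodType K) (u v : tpow A (p + q) -> W) :
  linear u -> linear v ->
  (forall s t, is_tpurec s -> is_tpurec t -> u (tcat s t) = v (tcat s t)) -> u =1 v.
Proof.
move=> lu lv uv; apply: tens_ext => // d x hx.
have -> : tpure d x = tcat (tpurec (fun j => d (lshift q j)) (fun j => x (lshift q j)))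
    (tpurec (fun j => d (rshift p j)) (fun j => x (rshift p j))).
  by rewrite tcat_pure // !scat_shift.
by apply: uv; do 2!eexists; (split; last reflexivity).
Qed.

Lemma is_tpurec_homog p (s : tpow A p) : is_tpurec s -> exists a, homog a s.
Proof. by case=> d [x [hx ->]]; exists (\sum_i d i); apply: homog_tpure. Qed.

Lemma tcat_homog p q a b (s : tpow A p) (t : tpow A q) :
  homog a s -> homog b t -> homog (a + b) (tcat s t).
Proof.
move: s t; apply: tens_ext2hh.
- move=> t; exact: lin_comp prj_lin (tcat_linl _).
- move=> s; exact: lin_comp prj_lin (tcat_linr _).
- exact: tcat_linl.
- exact: tcat_linr.
by move=> ds x dt y hx hy <- <-; rewrite tcat_pure // prj_tpure sum_scat eqxx.
Qed.

End Tcat.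

Section Tprod.
Variables (K : comPzRingType) (A B : complex K) (p q : nat) (e : int).
Variables (u : tpow A p -> tpow B p) (v : tpow A q -> tpow B q).
Hypotheses (lu : linear u) (lv : linear v).

Lemma tprod_multilin : @multilin K (p + q) (fun=> A) _ (fun deg (x : 'I_(p + q) -> A) =>
  ksgn K (e * \sum_(i < p) deg (lshift q i)) *:
    tcat (u (tpurec (deg \o @lshift p q) (x \o @lshift p q)))
         (v (tpurec (deg \o @rshift p q) (x \o @rshift p q)))).
Proof.
move=> deg i a x y z; elim/shift_ind: i => i xE yE zE; rewrite scaleCA -scalerDr;
  congr (_ *: _).
  have E w : (forall j, j != lshift q i -> w j = x j) -> w \o @rshift p q = x \o @rshift p q.
    by move=> wE; apply: funext => j /=; apply: wE; rewrite eq_rlshift.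
  rewrite (E y) // (E z) // -tcat_linl -lu; congr (tcat (u _) _).
  apply: (@tgen_lin _ _ _ _ i) => //= j ji; [apply: yE | apply: zE];
    by apply: contraNneq ji => /lshift_inj ->.
have E w : (forall j, j != rshift p i -> w j = x j) -> w \o @lshift p q = x \o @lshift p q.
  by move=> wE; apply: funext => j /=; apply: wE; rewrite eq_lrshift.
rewrite (E y) // (E z) // -tcat_linr -lv; congr (tcat _ (v _)).
apply: (@tgen_lin _ _ _ _ i) => //= j ji; [apply: yE | apply: zE];
  by apply: contraNneq ji => /rshift_inj ->.
Qed.

Lemma tprod_lin : linear (tprod e u v).
Proof. exact/tlift_lin/tprod_multilin. Qed.

Lemma tprod_tcat a s t : homog a s ->
  tprod e u v (tcat s t) = ksgn K (e * a) *: tcat (u s) (v t).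
Proof.
move: s t; apply: tens_ext2h.
- move=> t; exact: lin_comp tprod_lin (tcat_linl _).
- move=> s; exact: lin_comp tprod_lin (tcat_linr _).
- move=> t; apply: lin_scale; exact: lin_comp (tcat_linl _) lu.
- move=> s; apply: lin_scale; exact: lin_comp (tcat_linr _) lv.
move=> ds x dt y hx hy <-.
rewrite tcat_pure // /tprod /tpurec tlift_pureh //; first last.
- by apply: shift_ind => j; rewrite ?scat_l ?scat_r.
- exact: tprod_multilin.
congr (ksgn K (e * _) *: tcat (u (tpurec _ _)) (v (tpurec _ _))).
- by apply: eq_bigr => j _; rewrite scat_l.
- by apply: funext => j; rewrite /= scat_l.
- by apply: funext => j; rewrite /= scat_l.
- by apply: funext => j; rewrite /= scat_r.
by apply: funext => j; rewrite /= scat_r.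
Qed.

End Tprod.

(** * Concatenation of block data *)

Section BlocksConcat.
Variables (K : comPzRingType) (sym : bool) (M : sseq K sym) (p q : nat).
Variables (r : 'I_p -> nat) (r' : 'I_q -> nat).

Lemma sum_scat_nat : (\sum_i r i + \sum_i r' i = \sum_i scat r r' i)%N.
Proof.
rewrite [RHS]big_split_ord /=; congr (_ + _)%N; apply: eq_bigr => j _.
  by rewrite scat_l.
by rewrite scat_r.
Qed.

Definition cat_cast : obij sym (\sum_i r i + \sum_i r' i)%N (\sum_i scat r r' i)%N :=
  obcast sym sum_scat_nat.

Definition cat_rank (s : 'I_p + 'I_q) :
    'I_(match s with inl j => r j | inr j => r' j end) -> 'I_(\sum_i r i + \sum_i r' i)%N :=
  match s with
  | inl j => fun k => lshift _ (tagnat.Rank j k)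
  | inr j => fun k => rshift _ (tagnat.Rank j k)
  end.

(** A position is the total size of the preceding blocks plus the offset [k]; both sides are
    compared in this form. *)
Lemma Rank_scat i (k : 'I_(scat r r' i)) :
  cast_ord (esym sum_scat_nat) (tagnat.Rank i k) = @cat_rank (fintype.split i) k.
Proof.
apply: ord_inj; transitivity (nat_of_ord (tagnat.Rank i k)); first by [].
rewrite tagnat.RankEsum.
have -> (s : 'I_p + 'I_q) (k' : 'I_(match s with inl j => r j | inr j => r' j end)) :
    val (cat_rank k') = (match s with inl j => \sum_(j' < p | (j' < j)%N) r j'
      | inr j => \sum_i r i + \sum_(j' < q | (j' < j)%N) r' j' end + k')%N.
  case: s k' => j k'; first exact: tagnat.RankEsum.
  by rewrite -addnA -tagnat.RankEsum.
congr (_ + _)%N; rewrite big_split_ord /=.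
under eq_bigr do rewrite scat_l; under [X in (_ + X)%N]eq_bigr do rewrite scat_r.
case: fintype.splitP => j ->; last first.
  congr (_ + _)%N; last by apply: eq_bigl => j'; rewrite ltn_add2l.
  by apply: eq_bigl => j'; rewrite (leq_trans (ltn_ord j')) // leq_addr.
rewrite [X in (_ + X)%N]big_pred0 ?addn0 // => j'.
by apply/negbTE; rewrite -leqNgt ltnW // (leq_trans (ltn_ord j)) // leq_addr.
Qed.

Lemma Rank_scat_fun (T : Type) (G : 'I_(\sum_i r i + \sum_i r' i)%N -> T) i :
  (fun k => G (oinv cat_cast (tagnat.Rank i k))) =
  (fun k : 'I_(scat r r' i) => G (cat_rank k)).
Proof. by apply: dfunext => k; rewrite -Rank_scat. Qed.

(** The dependent version of [scat]: the arity of the value depends on the side, hence the annotated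
    match. *)
Definition hcat (x : forall j, M (r j)) (x' : forall j, M (r' j)) i : M (scat r r' i) :=
  match fintype.split i as s return M (match s with inl j => r j | inr j => r' j end) with
  | inl j => x j | inr j => x' j end.

Lemma hcat_homog dx dx' x x' i :
  (forall j, homog (dx j) (x j)) -> (forall j, homog (dx' j) (x' j)) ->
  homog (scat dx dx' i) (hcat x x' i).
Proof. by move=> hx hx'; rewrite /scat /hcat; case: (fintype.split i). Qed.

Lemma block_deg_scat dy dy' : block_deg id (fun w => scat dy dy' (oinv cat_cast w)) =
  scat (block_deg id dy) (block_deg id dy').
Proof.
apply: dfunext => i; rewrite /block_deg.
rewrite (eq_bigr (fun k : 'I_(scat r r' i) => scat dy dy' (cat_rank k))); last first.
  by move=> k _; rewrite -Rank_scat.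
rewrite /scat; case: (fintype.split i) => j; apply: eq_bigr => k _ /=.
  exact: (scat_l dy dy').
exact: (scat_r dy dy').
Qed.

(** The extra sign comes from moving the operations of the second group past the arguments of the
    first. *)
Lemma interleave_scat (a D : 'I_p -> int) (a' D' : 'I_q -> int) :
  interleave K a D * interleave K a' D' =
  ksgn K ((\sum_j D j) * \sum_j a' j) * interleave K (scat a a') (scat D D').
Proof.
rewrite !interleave_par ksgn_par -!signr_addb parM !par_xsumT; congr (_ ^+ nat_of_bool _).
rewrite [in RHS]/xsum2 xsum_shift.
have -> : xsum (fun j : 'I_p => xsum (fun i' : 'I_(p + q) => (lshift q j < i')%N &&
    (par (scat a a' i') && par (scat D D' (lshift q j))))) =
  xsum2 (fun i i' : 'I_p => (i < i')%N && (par (a i') && par (D i))) (+)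
  (xsum (fun j => par (D j)) && xsum (fun j => par (a' j))).
  rewrite xsum_andr -xsumD; apply: eq_xsum => j; rewrite xsum_shift scat_l; congr (_ (+) _).
    by apply: eq_xsum => j'; rewrite scat_l.
  rewrite xsum_andl; apply: eq_xsum => j'.
  by rewrite scat_r /= (leq_trans (ltn_ord j)) ?leq_addr //= andbC.
have -> : xsum (fun j : 'I_q => xsum (fun i' : 'I_(p + q) => (rshift p j < i')%N &&
    (par (scat a a' i') && par (scat D D' (rshift p j))))) =
  xsum2 (fun i i' : 'I_q => (i < i')%N && (par (a' i') && par (D' i))).
  apply: eq_xsum => j; rewrite xsum_shift [X in X (+) _](_ : _ = false) /=.
    by apply: eq_xsum => j'; rewrite !scat_r ltn_add2l.
  rewrite [xsum _]big1 // => j' _.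
  by rewrite /= ltnNge ltnW // (leq_trans (ltn_ord j')) ?leq_addr.
by case: (xsum2 _); case: (xsum2 _); case: (xsum _); case: (xsum _).
Qed.

Variables (dx : 'I_p -> int) (x : forall j, M (r j)).
Variables (dx' : 'I_q -> int) (x' : forall j, M (r' j)).
Hypotheses (hx : forall j, homog (dx j) (x j)) (hx' : forall j, homog (dx' j) (x' j)).

Lemma tcat_block_sep (A : complex K) b (y : tpow A (\sum_i r i)%N)
    (y' : tpow A (\sum_i r' i)%N) : homog b y ->
  tcat (block_sep (obid sym _) (tpure dx x) y) (block_sep (obid sym _) (tpure dx' x') y') =
  ksgn K (b * \sum_j dx' j) *:
    block_sep (obid sym _) (tpure (scat dx dx') (hcat x x')) (tpact A cat_cast (tcat y y')).
Proof.
move: y y'; apply: tens_ext2h.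
- move=> t; exact: lin_comp (tcat_linl _) (block_sep_linr _ _).
- move=> s; exact: lin_comp (tcat_linr _) (block_sep_linr _ _).
- move=> t; apply: lin_scale; apply: lin_comp (block_sep_linr _ _) _.
  exact: lin_comp (@cfun_lin _ _ _ (tpact A cat_cast)) (tcat_linl _).
- move=> s; apply: lin_scale; apply: lin_comp (block_sep_linr _ _) _.
  exact: lin_comp (@cfun_lin _ _ _ (tpact A cat_cast)) (tcat_linr _).
move=> dy y dy' y' hy hy' <-.
rewrite tcat_pure // tpact_pure koszul_mono; last by move=> i j /ltnW.
rewrite scale1r !block_sep_pure //; first last.
- by move=> w; move: (oinv cat_cast w); apply: shift_ind => j; rewrite ?scat_l ?scat_r.
- move=> i; exact: hcat_homog.
rewrite /sep_pure !shuffle_signE !koszul_id !mul1r.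
rewrite (linZ (tcat_linl _)) (linZ (tcat_linr _)) tcat_pure; try by move=> i; apply: homog_qpure.
rewrite !scalerA interleave_scat big_sum_block_deg block_deg_scat.
congr (_ *: tpurec _ _); apply: dfunext => i.
  by rewrite /scat; case: (fintype.split i).
rewrite (Rank_scat_fun (scat dy dy')) (Rank_scat_fun (scat y y')) /scat /hcat.
case: (fintype.split i) => j; congr (spure _ _ _ (tpurec _ _));
  apply: dfunext => k /=.
- by rewrite -/(scat _ _ _) scat_l.
- by rewrite -/(scat _ _ _) scat_l.
- by rewrite -/(scat _ _ _) scat_r.
by rewrite -/(scat _ _ _) scat_r.
Qed.

(** Elements given by two groups of block data; linear maps on the power of length [p + q] are
    determined by them ([cat_iso_ext]). *)
Definition cat_iso (A : complex K) b (y : tpow A (\sum_i r i + \sum_i r' i)%N) :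
    tpow (schur M A) (p + q) :=
  blocks_iso (qpure (@blocks_arr K sym M A (p + q)) (i := scat r r')
    (\sum_j dx j + \sum_j dx' j) b (tpure (scat dx dx') (hcat x x')) (tpact A cat_cast y)).

Lemma cat_iso_lin (A : complex K) b : linear (@cat_iso A b).
Proof.
apply: lin_comp blocks_iso_lin _.
apply: lin_comp (@qpure_linr K _ _ _ (@blocks_arr K sym M A (p + q)) (scat r r') _ b _) _.
exact: cfun_lin.
Qed.

Lemma tcat_iso (A : complex K) b b' (y : tpow A (\sum_i r i)%N)
    (y' : tpow A (\sum_i r' i)%N) : homog b y -> homog b' y' ->
  tcat
    (blocks_iso (qpure (@blocks_arr K sym M A p) (i := r) (\sum_j dx j) b (tpure dx x) y))
    (blocks_iso (qpure (@blocks_arr K sym M A q) (i := r') (\sum_j dx' j) b' (tpure dx' x') y')) =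
  ksgn K (b * \sum_j dx' j) *: cat_iso (b + b') (tcat y y').
Proof.
move=> hy hy'; rewrite /cat_iso !blocks_iso_pure //; try exact: homog_tpure.
- exact: tcat_block_sep.
- by rewrite -sum_scat; apply: homog_tpure.
by apply: cmap_homog; apply: tcat_homog.
Qed.

Variables (A B : complex K) (eu ev : int) (U V : thick A B).
Hypotheses (Ug : is_thick eu U) (Us : sym -> symmetric_thick U).
Hypotheses (Vg : is_thick ev V) (Vs : sym -> symmetric_thick V).

Lemma tsm_cat_iso b y : thick_schur_map M eu U (p + q) (cat_iso b y) =
  ksgn K (eu * (\sum_j dx j + \sum_j dx' j)) *: cat_iso (b + eu) (U y).
Proof. by rewrite tsm_pure // thick_tpact. Qed.

(** By [tcat_iso] the two groups of blocks can be pulled apart, each map applied to its own group,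
    and the results joined again. *)
Lemma tprod_tsm b y : homog b y ->
  tprod ev (thick_schur_map M eu U p) (thick_schur_map M ev V q) (cat_iso b y) =
  ksgn K ((eu + ev) * (\sum_j dx j + \sum_j dx' j)) *:
    cat_iso (b + (eu + ev)) (tprod ev (@U _) (@V _) y).
Proof.
move=> <-; have lU := tsm_lin (M := M) Ug Us; have lV := tsm_lin (M := M) Vg Vs.
move: y; apply: tcat_ext.
- exact: lin_comp (tprod_lin _ (lU p) (lV q)) (lin_comp (cat_iso_lin _) prj_lin).
- apply: lin_scale; apply: lin_comp (cat_iso_lin _) _.
  exact: lin_comp (tprod_lin _ (Ug _).1 (Vg _).1) prj_lin.
move=> s t /is_tpurec_homog [b1 h1] /is_tpurec_homog [b2 h2].
(* Concatenations of a degree other than [b] are killed by the projection, and both sides vanish. *)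
rewrite (homog_prj b (tcat_homog h1 h2)); case: eqP => [->|_]; last first.
  rewrite (lin0 (cat_iso_lin _)) (lin0 (tprod_lin _ (lU p) (lV q))).
  by rewrite (lin0 (tprod_lin _ (Ug _).1 (Vg _).1)) (lin0 (cat_iso_lin _)) scaler0.
have iso := tcat_iso h1 h2.
have -> : cat_iso (b1 + b2) (tcat s t) = ksgn K (b1 * \sum_j dx' j) *: (
  tcat
    (blocks_iso (qpure (@blocks_arr K sym M A p) (i := r) (\sum_j dx j) b1 (tpure dx x) s))
    (blocks_iso (qpure (@blocks_arr K sym M A q) (i := r') (\sum_j dx' j) b2 (tpure dx' x') t))).
  by rewrite iso scalerA ksgn_par sign_sq scale1r.
rewrite (linZ (tprod_lin _ (lU p) (lV q))).
rewrite (@tprod_tcat _ _ _ _ _ _ _ _ (lU p) (lV q) (\sum_j dx j + b1)); last first.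
  have := blocks_iso_graded M A p => /graded_homog; rewrite -[X in homog X]addr0; apply.
  exact: homog_qpure.
rewrite !tsm_pure // (linZ (tcat_linl _)) (linZ (tcat_linr _)).
rewrite tcat_iso; [|exact: graded_homog (Ug _) h1|exact: graded_homog (Vg _) h2].
rewrite (tprod_tcat _ (Ug _).1 (Vg _).1 _ h1) (linZ (cat_iso_lin _)) !scalerA.
rewrite addrACA; congr (_ *: _).
rewrite -!ksgnD; apply: ksgn_par_eq; rewrite !(parD, parM).
case: (par b1); case: (par eu); case: (par ev); case: (par (\sum_j dx j));
  by case: (par (\sum_j dx' j)).
Qed.

End BlocksConcat.
Arguments cat_iso_lin {K sym M p q r r' dx x dx' x' A b}.

Section ThickSchurProd.
Variables (K : comPzRingType) (sym : bool) (M : sseq K sym).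

Lemma cat_iso_ext (A : complex K) p q (W : lmodType K) (u v : tpow (schur M A) (p + q) -> W) :
  linear u -> linear v ->
  (forall (r : 'I_p -> nat) (r' : 'I_q -> nat) dx x dx' x' b y,
     (forall j, homog (dx j) (x j)) -> (forall j, homog (dx' j) (x' j)) -> homog b y ->
     u (@cat_iso K sym M p q r r' dx x dx' x' A b y) = v (cat_iso dx x dx' x' b y)) ->
  u =1 v.
Proof.
move=> lu lv uv; apply: tcat_ext => // s t _ _; move: s; apply: tpow_schur_ext.
- exact: lin_comp lu (tcat_linl _).
- exact: lin_comp lv (tcat_linl _).
move=> r a b c y hc hy; move: t; apply: tpow_schur_ext.
- exact: lin_comp lu (tcat_linr _).
- exact: lin_comp lv (tcat_linr _).
move=> r' a' b' c' y' hc' hy'; move: c c' hc hc'; apply: tens_ext2hh.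
- move=> c'; apply: lin_comp lu _; apply: lin_comp (tcat_linl _) _.
  exact: lin_comp blocks_iso_lin (@qpure_linl K _ _ _ (@blocks_arr K sym M A p) r a b y).
- move=> c; apply: lin_comp lu _; apply: lin_comp (tcat_linr _) _.
  exact: lin_comp blocks_iso_lin (@qpure_linl K _ _ _ (@blocks_arr K sym M A q) r' a' b' y').
- move=> c'; apply: lin_comp lv _; apply: lin_comp (tcat_linl _) _.
  exact: lin_comp blocks_iso_lin (@qpure_linl K _ _ _ (@blocks_arr K sym M A p) r a b y).
- move=> c; apply: lin_comp lv _; apply: lin_comp (tcat_linr _) _.
  exact: lin_comp blocks_iso_lin (@qpure_linl K _ _ _ (@blocks_arr K sym M A q) r' a' b' y').
move=> dx x dx' x' hx hx' <- <-.
rewrite tcat_iso // (linZ lu) (linZ lv) uv //; exact: tcat_homog.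
Qed.

Lemma tsm_morphism (A B : complex K) (F : thick A B) :
  is_thick 0 F -> (sym -> symmetric_thick F) -> is_morphism F ->
  is_morphism (thick_schur_map M 0 F).
Proof.
move=> Fg Fs Fm p q; apply: cat_iso_ext.
- exact: tsm_lin.
- by apply: tprod_lin; apply: tsm_lin.
move=> r r' dx x dx' x' b y hx hx' hy.
by rewrite tsm_cat_iso // tprod_tsm // Fm addr0.
Qed.

(** Every term of the pseudo-derivation identities is an instance of [tprod_tsm] combined with
    [tsm_cat_iso], and all terms carry the same sign. *)
Lemma tsm_pseudo (A : complex K) (H : thick A A) :
  is_thick 1 H -> (sym -> symmetric_thick H) -> pseudo_derivation H ->
  pseudo_derivation (thick_schur_map M 1 H).
Proof.
move=> Hg Hs Hp p q.
pose I : thick A A := fun n (t : tpow A n) => t.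
have Ig : is_thick 0 I by move=> n; apply: graded_id.
have Is : sym -> symmetric_thick I by [].
(* The identity must also be seen as a map induced from [A] for [tprod_tsm] to apply to it. *)
have idE n : id = thick_schur_map M 0 I n by apply: funext => t; rewrite tsm_id.
have lH n := tsm_lin (M := M) Hg Hs (n := n).
have lI n := tsm_lin (M := M) Ig Is (n := n).
rewrite !idE.
have L0 := tprod_lin 0 (lH p) (lI q); have L1 := tprod_lin 1 (lI p) (lH q).
have LH := tprod_lin 1 (lH p) (lH q).
move=> t; split; move: t; apply: cat_iso_ext.
- apply: lin_minus; [exact: lin_comp L0 (lH _) | exact: lin_comp L1 (lH _)].
- exact: LH.
- move=> r r' dx x dx' x' b y hx hx' hy.
  have hHy := graded_homog (Hg _) hy.
  rewrite tsm_cat_iso // (linZ L0) (linZ L1) !tprod_tsm // addr0 add0r -scalerBr -scalerBr.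
  rewrite -(linB cat_iso_lin) (Hp _ _ _).1 scalerA -ksgnD.
  by rewrite -mulrDl addrA.
- exact: lin_comp (lH _) (lin_minus L0 L1).
- exact: lin_opp.
move=> r r' dx x dx' x' b y hx hx' hy.
rewrite !tprod_tsm // addr0 add0r -scalerBr -(linB cat_iso_lin).
rewrite (linZ (lH _)) tsm_cat_iso // (Hp _ _ _).2 scalerA -ksgnD -mulrDl.
by rewrite (linN cat_iso_lin) scalerN -addrA.
Qed.

End ThickSchurProd.

(** * The comonad C[-] *)

Section SchurComp.
Variables (K : comPzRingType) (sym : bool) (M N : sseq K sym) (A : complex K).

Local Notation carr n := (@comp_arr K sym M N n).

Lemma lin_tlift n (V : 'I_n -> complex K) (W W' : lmodType K)
    (F : ('I_n -> int) -> (forall i, V i) -> W) (u : W -> W') t : linear u ->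
  u (tlift F t) = tlift (fun d x => u (F d x)) t.
Proof. by move=> lu; rewrite /tlift /plift (ev_lin _ _ lu). Qed.

Lemma qlift_linF (I : Type) (P Q : I -> complex K)
    (arr : forall i j, cmap (P i) (P j) -> cmap (Q i) (Q j) -> Prop) (W : lmodType K)
    (F G H : forall i, int -> int -> P i -> Q i -> W) k t :
  (forall i a b p q, F i a b p q = k *: G i a b p q + H i a b p q) ->
  @qlift _ _ _ _ arr W F t = k *: qlift G t + qlift H t.
Proof.
move=> FGH; rewrite /qlift /plift /ev scaler_sumr -big_split; apply: eq_bigr => kx _ /=.
by rewrite FGH scalerDr scaleCA.
Qed.

Definition sc_elt n (b : int) (y : tpow A n) (s : cidx sym n) (a' b' : int) (m : M (cr s))
    (x : tens (fun i => N (cbr i))) : schur M (schur N A) :=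
  spure a' (b' + b) m (block_sep (clab s) x y).

Lemma schur_compE : @schur_comp K sym M N A =
  qlift (fun n a b (q : scomp M N n) y => qlift (arr := carr n) (sc_elt b y) q).
Proof.
apply: funext => z; rewrite /schur_comp /slift /clift /qlift.
congr plift; apply: funext => -[n a b q y] /=.
congr plift; apply: funext => -[s a' b' m x] /=.
rewrite /sc_elt /block_sep (lin_tlift _ _ (spure_linr _ _ _)); congr tlift.
apply: dfunext => dx; apply: dfunext => x'.
rewrite (lin_tlift _ _ (spure_linr _ _ _)); congr tlift.
apply: dfunext => dy; apply: dfunext => y'.
by rewrite /sep_pure (linZ (spure_linr _ _ _)).
Qed.

(** An arrow between two summands changes the labelling by the bijection [beta]; once both
    labellings are moved into [y], this is [block_sep_act]. *)
Lemma sc_elt_bilin n b (y : tpow A n) : qbilin (carr n) (sc_elt b y).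
Proof.
split=> [s a' b' x _|s a' b' m _|s t u v a' b' m x uv _ _].
- exact: spure_linl.
- apply: lin_comp (spure_linr _ _ _) _; exact: block_sep_linl.
case: uv => c rho E.
pose beta := obcomp (obinv (clab t)) (clab s).
have betaE i k : beta (tagnat.Rank (oinv c i) k) = tagnat.Rank i (rho i k).
  by rewrite /= -E ofunK.
rewrite /sc_elt [in LHS]block_sep_relabel [in RHS]block_sep_relabel.
have -> : tpact A (obinv (clab t)) y = tpact A beta (tpact A (obinv (clab s)) y).
  by rewrite -tpact_comp; apply: tpact_eq => i /=; rewrite oinvK.
by rewrite (@block_sep_act _ _ _ _ _ _ c _ _ rho beta) // spure_act.
Qed.

Lemma schur_comp_bilin : qbilin (@schur_arr K sym (scomp M N) A)
  (fun n a b (q : scomp M N n) y => qlift (arr := carr n) (sc_elt b y) q).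
Proof.
split=> [n a b y _|n a b q _|m n u v a d q y uv _ _].
- exact/qlift_lin/sc_elt_bilin.
- move=> k y y'; apply: qlift_linF => s a' b' c x.
  by rewrite /sc_elt block_sep_linr spure_linr.
case: _ _ / uv q y => m' n' c q y; move: q; apply: qtens_ext.
- apply: lin_comp (qlift_lin (sc_elt_bilin _ _)) _.
  exact: (@cfun_lin _ _ _ (sact (scomp M N) c)).
- exact/qlift_lin/sc_elt_bilin.
move=> s a' b' x z hx hz.
rewrite [sact (scomp M N) c _]comp_act_gen -/(qpure _ _ _ _ _).
rewrite !(qlift_pureh (sc_elt_bilin _ _)) //.
rewrite /sc_elt [in LHS]block_sep_relabel [in RHS]block_sep_relabel; congr (spure _ _ _ _).
congr block_sep; rewrite -tpact_comp; apply: tpact_eq => i /=.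
by rewrite ofunK.
Qed.

Lemma schur_comp_lin : linear (@schur_comp K sym M N A).
Proof. rewrite schur_compE; apply: qlift_lin; exact: schur_comp_bilin. Qed.

Lemma cpureE n (s : cidx sym n) a b m x : @cpure K sym M N n s a b m x = qpure (carr n) a b m x.
Proof. by []. Qed.

Lemma schur_comp_pure n (s : cidx sym n) a b a' b' m x (y : tpow A n) :
  homog a' m -> homog b' x -> homog b y -> a = a' + b' ->
  schur_comp (spure a b (@cpure K sym M N n s a' b' m x) y) =
  spure a' (b' + b) m (block_sep (clab s) x y).
Proof.
move=> hm hx hy ->; rewrite schur_compE spureE (qlift_pureh schur_comp_bilin) //.
  by rewrite cpureE (qlift_pureh (sc_elt_bilin _ _)).
exact: homog_qpure.
Qed.

Lemma schur_scomp_ext (W : lmodType K) (u v : schur (scomp M N) A -> W) :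
  linear u -> linear v ->
  (forall n (s : cidx sym n) a' b' b m x y, homog a' m -> homog b' x -> homog b y ->
     u (spure (a' + b') b (@cpure K sym M N n s a' b' m x) y) =
     v (spure (a' + b') b (cpure a' b' m x) y)) ->
  u =1 v.
Proof.
move=> lu lv uv; apply: qtens_ext => // n a b q y hq hy.
rewrite -!spureE -hq; move: q {hq}; apply: qtens_ext.
- exact: lin_comp lu (lin_comp (spure_linl _ _ _) prj_lin).
- exact: lin_comp lv (lin_comp (spure_linl _ _ _) prj_lin).
move=> s a' b' m x hm hx; rewrite prj_qpure; case: eqP => [<-|_]; first exact: uv.
by rewrite (lin0 (spure_linl _ _ _)) (lin0 lu) (lin0 lv).
Qed.

Lemma block_sep_homog_l n (s : cidx sym n) a b (x : tens (fun i => N (cbr i))) (y : tpow A n) :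
  homog a x -> homog b y -> homog (a + b) (block_sep (clab s) x y).
Proof.
move=> hx hy; rewrite block_sep_relabel; apply: block_sep_homog => //.
exact: cmap_homog.
Qed.

Lemma schur_comp_graded : graded 0 (@schur_comp K sym M N A).
Proof.
split=> [|c]; first exact: schur_comp_lin.
rewrite addr0; apply: schur_scomp_ext.
- exact: lin_comp schur_comp_lin prj_lin.
- exact: lin_comp prj_lin schur_comp_lin.
move=> n s a' b' b m x y hm hx hy; rewrite spureE prj_qpure -spureE.
rewrite (schur_comp_pure hm hx hy) // spureE prj_qpure addrA.
case: ifP => _; last exact: (lin0 schur_comp_lin).
by rewrite -spureE (schur_comp_pure hm hx hy).
Qed.

Lemma schur_comp_dif z : schur_comp (dif z) = dif (@schur_comp K sym M N A z).
Proof.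
move: z; apply: schur_scomp_ext.
- exact: lin_comp schur_comp_lin dif_lin.
- exact: lin_comp dif_lin schur_comp_lin.
move=> n s a' b' b m x y hm hx hy; rewrite (schur_comp_pure hm hx hy) // !spureE !dif_qpure.
rewrite (linD schur_comp_lin) (linZ schur_comp_lin) -!spureE.
rewrite -!cpureE (linD (spure_linl _ _ _)) (linZ (spure_linl _ _ _)).
rewrite (linD schur_comp_lin) (linZ schur_comp_lin).
rewrite !schur_comp_pure //; try (by apply: dif_homog); try by ring.
rewrite -addrA; congr (_ + _).
rewrite [block_sep _ _ _ in RHS]block_sep_relabel (dif_block_sep _ hx) -cfun_dif.
rewrite -!block_sep_relabel (linD (spure_linr _ _ _)) (linZ (spure_linr _ _ _)) scalerDr scalerA.
have -> : b' - 1 + b = b' + b - 1 by ring.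
have -> : b' + (b - 1) = b' + b - 1 by ring.
by rewrite -ksgnD.
Qed.

End SchurComp.
Arguments schur_comp_lin {K sym M N A}.

Section SchurCompThick.
Variables (K : comPzRingType) (sym : bool) (M N : sseq K sym).
Variables (A B : complex K) (e : int) (F : thick A B).
Hypotheses (Fg : is_thick e F) (Fs : sym -> symmetric_thick F).

Lemma block_sep_thick n (s : cidx sym n) a b (x : tens (fun i => N (cbr i))) (y : tpow A n) :
  homog a x -> homog b y ->
  thick_schur_map N e F _ (block_sep (clab s) x y) =
  ksgn K (e * a) *: block_sep (clab s) x (F y).
Proof.
move=> hx hy; have hy' : homog b (tpact A (obinv (clab s)) y) by apply: cmap_homog.
rewrite block_sep_relabel -(blocks_iso_pure hx hy') tsm_pure // blocks_iso_pure //.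
  by rewrite thick_tpact // -block_sep_relabel.
exact: graded_homog (Fg _) hy'.
Qed.

(** Naturality of the comparison map: by [block_sep_thick], separating into blocks turns [F] into
    [thick_schur_map], and the signs on both sides record the total degree of the operations
    passed. *)
Lemma schur_comp_thick z :
  schur_comp (schur_map e F z) = schur_map e (thick_schur_map N e F) (@schur_comp K sym M N A z).
Proof.
have lF := (schur_map_graded (scomp M N) Fg Fs).1.
have lF' := (schur_map_graded M (tsm_thick N Fg Fs) (tsm_sym Fg Fs)).1.
move: z; apply: schur_scomp_ext.
- exact: lin_comp schur_comp_lin lF.
- exact: lin_comp lF' schur_comp_lin.
move=> n s a' b' b m x y hm hx hy; rewrite schur_map_pure // (linZ schur_comp_lin).
rewrite !schur_comp_pure //; last exact: graded_homog (Fg _) hy.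
rewrite schur_map_pure; [|exact: tsm_thick|exact: tsm_sym].
rewrite (block_sep_thick hx hy) (linZ (spure_linr _ _ _)) scalerA -ksgnD -mulrDr.
by rewrite addrA.
Qed.

End SchurCompThick.

Section SmapSchur.
Variables (K : comPzRingType) (sym : bool) (M M' : sseq K sym) (u : smap M M') (A : complex K).

Definition smap_schur : schur M A -> schur M' A :=
  qmap (@schur_arr K sym M A) (@schur_arr K sym M' A) id 0 (fun n => u n) (fun=> id).

Lemma smap_schur_arr m n u1 v1 : @schur_arr K sym M A m n u1 v1 -> exists u2 v2,
  [/\ @schur_arr K sym M' A m n u2 v2, forall p, u n (u1 p) = u2 (u m p) & forall q, v1 q = v2 q].
Proof.
case=> m' n' b; exists (sact M' b), (tpact A b); split=> // p.
exact: sfun_act.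
Qed.

Lemma smap_schur_graded : graded 0 smap_schur.
Proof.
by apply: qmap_graded => [n|n|]; [exact: cmap_graded | exact: graded_id | exact: smap_schur_arr].
Qed.

Lemma smap_schur_pure n a b (c : M n) (t : tpow A n) :
  smap_schur (spure a b c t) = spure a b (u n c) t.
Proof.
rewrite /smap_schur spureE qmap_pure => [|i|i|]; last 1 first.
- exact: smap_schur_arr.
- by rewrite mul0r addr0 ksgn_par scale1r.
- exact: cmap_graded.
exact: graded_id.
Qed.

Lemma smap_schur_dif x : smap_schur (dif x) = dif (smap_schur x).
Proof.
have l := smap_schur_graded.1; move: x; apply: qtens_ext.
- exact: lin_comp l dif_lin.
- exact: lin_comp dif_lin l.
move=> n a b c t hc ht; rewrite dif_qpure (linD l) (linZ l) -!spureE !smap_schur_pure.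
by rewrite spureE dif_qpure cfun_dif.
Qed.

End SmapSchur.

Section CompMapTransfer.
Variables (K : comPzRingType) (sym : bool) (M M' N N' : sseq K sym) (n : nat).
Variables (u : forall n, M n -> M' n) (v : forall n, N n -> N' n).
Hypotheses (ug : forall n, graded 0 (@u n)) (vg : forall n, graded 0 (@v n)).

Let vt (s : cidx sym n) := @tmap _ _ _ (fun i => N (cbr i)) (fun i => N' (@cbr _ _ s i))
                         id (fun=> 0) (fun i => @v (cbr i)).

(** [comp_map] is evaluated on a chosen representative; followed by [L], it is identified with a
    linear map [R] by comparison on homogeneous pure elements. *)
Lemma comp_map_transfer (W : lmodType K) (L : scomp M' N' n -> W) (R : scomp M N n -> W) q :
  linear L -> linear R ->
  (forall (s : cidx sym n) a m d x, homog a m -> (forall i, homog (d i) (x i)) ->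
     L (@cpure _ _ M' N' n s a (\sum_i d i) (u m) (tpure d (fun i => v (x i)))) =
     R (@cpure _ _ M N n s a (\sum_i d i) m (tpure d x))) ->
  L (comp_map u v q) = R q.
Proof.
move=> lL lR LR; apply: plift_transfer => // -[s a b m x].
have vtg : graded 0 (@vt s).
  apply: (graded_cast (e := \sum_(i < cr s) 0)); first by rewrite big1.
  by apply: tmap_graded => //; exists id.
rewrite (linZ lL) mul0r addr0 ksgn_par scale1r.
rewrite -/(@vt s x) -!/(qpure _ _ _ _ _) qpure_prj [in RHS]qpure_prj -/(cpure _ _ _ _).
have -> : prj a (u m) = u (prj a m) by rewrite (ug _).2 addr0.
have -> : prj b (@vt s x) = @vt s (prj b x) by rewrite vtg.2 addr0.
have l1 := lin_comp (@qpure_linr K _ _ _ (@comp_arr K sym M' N' n) s a b (u (prj a m))) vtg.1.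
have l2 := @qpure_linr K _ _ _ (@comp_arr K sym M N n) s a b (prj a m).
move: {x}(prj b x) (prj_homog b x); apply: tens_exth.
- exact: lin_comp lL l1.
- exact: lin_comp lR l2.
move=> d z hz <-.
rewrite -!cpureE -LR //; last exact: prj_homog.
rewrite /vt tmap0_pure //; last by exists id.
by rewrite koszul_id scale1r.
Qed.

End CompMapTransfer.

(** * Compatibility of the comparison map with the associator *)

Section Coassociativity.
Variables (K : comPzRingType) (sym : bool).

Lemma interleave_addl n (a a' D : 'I_n -> int) :
  interleave K (fun i => a i + a' i) D = interleave K a D * interleave K a' D.
Proof.
rewrite !interleave_par -signr_addb -xsum2D; congr (_ ^+ nat_of_bool _).
by apply: eq_xsum2 => i j; rewrite parD; case: ltnP => //= _; rewrite andb_addl.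
Qed.

Lemma interleave_addr n (a D D' : 'I_n -> int) :
  interleave K a (fun i => D i + D' i) = interleave K a D * interleave K a D'.
Proof.
rewrite !interleave_par -signr_addb -xsum2D; congr (_ ^+ nat_of_bool _).
by apply: eq_xsum2 => i j; rewrite parD; case: ltnP => //= _; rewrite andb_addr.
Qed.

Lemma interleave_Rank r (phi : 'I_r -> nat) (a D : 'I_(\sum_i phi i)%N -> int) :
  interleave K a D = interleave K (block_deg id a) (block_deg id D) *
    \prod_i interleave K (fun k => a (tagnat.Rank i k)) (fun k => D (tagnat.Rank i k)).
Proof.
rewrite [\prod_i _](eq_bigr _ (fun i _ => interleave_par K _ _)) prod_sign !interleave_par.
rewrite -signr_addb; congr (_ ^+ nat_of_bool _).
rewrite -xsum2_diag -xsum2D xsum2_Rank; apply: eq_xsum2 => i i'.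
case: (eqVneq i' i) => [->|ne].
  rewrite !ltnn /=; apply: eq_xsum => k; apply: eq_xsum => k'.
  by rewrite Rank_lt ltnn eqxx.
rewrite addbF !par_block_deg !xsum_andl; apply: eq_xsum => k.
rewrite xsum_andr xsum_andl; apply: eq_xsum => k'.
by rewrite Rank_lt eq_sym (negbTE ne) orbF.
Qed.

(** The regrouping moves whole blocks and keeps the order inside each, so its sign is that of [l]
    with the block degrees as weights. *)
Lemma koszul_rg r s (phi : 'I_r -> nat) (psi : 'I_s -> nat)
    (l : obij sym (\sum_i phi i)%N s) (d : 'I_(\sum_j psi j)%N -> int) :
  koszul K (@rg sym r s phi psi l) d = koszul K l (block_deg id d).
Proof.
rewrite !koszul_par; congr (_ ^+ nat_of_bool _).
rewrite xsum2_Rank [RHS]xsum2_Rank; apply: eq_xsum2 => i i'.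
rewrite xsum_Rank; apply: eq_xsum => k; rewrite xsumC xsum_Rank; apply: eq_xsum => k'.
rewrite xsumC !par_block_deg xsum_andr xsum_andl; apply: eq_xsum => w.
rewrite !xsum_andl; apply: eq_xsum => w'; rewrite !rgE !Rank_lt.
case: (eqVneq i i') k k' w w' => [<-|ne] k k' w w'; last first.
  rewrite !andFb !orbF; case: (ltnP i i') => //= ii'.
  have nl : l (tagnat.Rank i' k') != l (tagnat.Rank i k).
    rewrite (inj_eq (can_inj (ofunK l))) -val_eqE /= tagnat.eq_Rank.
    by rewrite eq_sym (negbTE ne).
  by rewrite (negbTE nl) orbF.
rewrite ltnn !andTb !orFb Rank_lt.
case: (eqVneq k k') w w' => [<-|ne] w w'.
  by rewrite ltnn !eqxx ltnn !andTb !orFb; case: ltngtP; rewrite ?andbF.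
have nl : l (tagnat.Rank i k') != l (tagnat.Rank i k).
  rewrite (inj_eq (can_inj (ofunK l))) -val_eqE /= tagnat.eq_Rank eqxx val_eqE.
  by rewrite eq_sym.
by rewrite (negbTE nl) !andFb !orbF.
Qed.

(** Both sides sort x's, y's and z's into nested blocks: the left side first attaches the y's to the
    x's, the right side first attaches the z's to the y's. *)
Lemma assoc_sign r s n (phi : 'I_r -> nat) (psi : 'I_s -> nat)
    (t : obij sym (\sum_i phi i)%N s) (c : obij sym (\sum_j psi j)%N n)
    (dx : 'I_r -> int) (dy : 'I_s -> int) (dz : 'I_n -> int) :
  let outer := obcomp c (obregroup psi t) in
  shuffle_sign K t dx dy *
    (shuffle_sign K outer (fun i => dx i + block_deg t dy i) dz *
     \prod_i interleave K (fun k => dy (t (tagnat.Rank i k)))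
                (fun k => block_deg c dz (t (tagnat.Rank i k)))) =
  shuffle_sign K c dy dz * shuffle_sign K t dx (fun j => dy j + block_deg c dz j).
Proof.
move=> outer; rewrite !shuffle_signE.
set D := block_deg t dy; set Z := block_deg c dz.
have EE : block_deg outer dz = block_deg t Z.
  apply: funext => i; rewrite /block_deg big_Rank; apply: eq_bigr => k _.
  by apply: eq_bigr => u _; rewrite /= rgE.
have -> : block_deg t (fun j => dy j + Z j) = (fun i => D i + block_deg t Z i).
  by apply: funext => i; apply: big_split.
rewrite EE interleave_addl interleave_addr.
have -> : koszul K outer dz = koszul K c dz * koszul K t Z.
  rewrite (koszul_comp _ _ (ofun_bij c) (ofun_bij (obregroup psi t))); congr (_ * _).
  exact: koszul_rg.
have := koszul_add K dy Z (ofun_bij t); rewrite interleave_Rank.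
have -> : block_deg id (dy \o t) = D by [].
have -> : block_deg id (Z \o t) = block_deg t Z by [].
set P := \prod_i _;
set a1 := koszul K t dy; set a2 := koszul K t Z; set a3 := interleave K D (block_deg t Z).
set a4 := interleave K dy Z; set a5 := koszul K t _ => E.
transitivity (koszul K c dz * interleave K dx D * interleave K dx (block_deg t Z) *
  (a1 * a2 * (a3 * P))); first by ring.
by rewrite E; ring.
Qed.

End Coassociativity.

Section Tpower.
Variables (K : comPzRingType).

Lemma tpower_pure (A B : complex K) (f : A -> B) n d (x : 'I_n -> A) : graded 0 f ->
  tpower f (tpurec d x) = tpurec d (fun i => f (x i)).
Proof.
by move=> fg; rewrite /tpower tmap0_pure //; [rewrite koszul_id scale1r | exists id].
Qed.

Lemma tpower_thick (A B : complex K) (f : A -> B) : graded 0 f -> is_thick 0 (tpower f).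
Proof.
move=> fg n; apply: (graded_cast (e := \sum_(i < n) 0)); first by rewrite big1.
by apply: tmap_graded => //; exists id.
Qed.

Lemma perm_inv_bij n (s : 'S_n) : bijective (fun i => (s^-1)%g i).
Proof. by exists s => i; rewrite ?permK ?permKV. Qed.

Lemma pact_pure (A : complex K) n (s : 'S_n) d (x : 'I_n -> A) :
  pact s (tpurec d x) = koszul K (fun i => (s^-1)%g i) d *:
    tpurec (fun i => d ((s^-1)%g i)) (fun i => x ((s^-1)%g i)).
Proof. by apply: tmap0_pure; [exact: perm_inv_bij | move=> i; apply: graded_id]. Qed.

Lemma pact_graded (A : complex K) n (s : 'S_n) : graded 0 (@pact K A n s).
Proof.
apply: (graded_cast (e := \sum_(i < n) 0)); first by rewrite big1.
by apply: tmap_graded; [exact: perm_inv_bij | move=> i; apply: graded_id].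
Qed.

Lemma tpower_sym (A B : complex K) (f : A -> B) : graded 0 f -> symmetric_thick (tpower f).
Proof.
move=> fg n s; have lf := (tpower_thick fg n).1; apply: tens_ext.
- exact: lin_comp lf (pact_graded _ _).1.
- exact: lin_comp (pact_graded _ _).1 lf.
move=> d x hx; rewrite -/(tpurec d x) pact_pure (linZ lf) !tpower_pure // pact_pure //.
Qed.

End Tpower.

Section AssocPure.
Variables (K : comPzRingType) (sym : bool) (M N P : sseq K sym) (A : complex K) (n : nat).
Variables (s : cidx sym n) (t : cidx sym (cr s)) (a' : int) (m : M (cr t)).
Variables (dx : 'I_(cr t) -> int) (x : forall i, N (@cbr _ _ t i)).
Variables (dy : 'I_(cr s) -> int) (y : forall j, P (@cbr _ _ s j)).
Variables (dz : 'I_n -> int) (z : 'I_n -> A).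
Hypotheses (hm : homog a' m) (hx : forall i, homog (dx i) (x i)).
Hypotheses (hy : forall j, homog (dy j) (y j)) (hz : forall k, homog (dz k) (z k)).

Let l i k := clab t (tagnat.Rank i k).
Let D := block_deg (clab t) dy.
Let Z := block_deg (clab s) dz.
Let sc := @schur_comp K sym N P A.

Let inner i : scomp N P (\sum_(k < cbr i) @cbr _ _ s (l k))%N :=
  @cpure K sym N P _ (@assoc_inner sym n s t i) (dx i) (D i) (x i)
    (tpure (fun k => dy (l k)) (fun k => y (l k))).

Let inner_homog i : homog (dx i + D i) (inner i).
Proof. exact: homog_qpure. Qed.

Lemma sum_block_deg : \sum_i D i = \sum_j dy j.
Proof.
rewrite [RHS](reindex (clab t)); last exact/onW_bij/ofun_bij.
by rewrite big_Rank.
Qed.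

(** On pure tensors both routes produce the same nested blocks, and [assoc_sign] compares their
    signs. *)
Lemma assoc_pure :
  shuffle_sign K (clab t) dx dy *:
  schur_map 0 (tpower sc) (schur_comp (spure (a' + \sum_i dx i + \sum_j dy j) (\sum_k dz k)
     (@cpure K sym M (scomp N P) n (assoc_outer t) a' (\sum_i dx i + \sum_j dy j) m
        (tpure (fun i => dx i + D i) inner)) (tpurec dz z))) =
  schur_comp (schur_comp (spure (a' + \sum_i dx i + \sum_j dy j) (\sum_k dz k)
    (@cpure K sym (scomp M N) P n s (a' + \sum_i dx i) (\sum_j dy j)
       (@cpure K sym M N _ t a' (\sum_i dx i) m (tpure dx x)) (tpure dy y)) (tpurec dz z))).
Proof.
have scg : graded 0 sc by apply: schur_comp_graded.
have hz' : homog (\sum_k dz k) (tpurec dz z) by apply: homog_tpure.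
have hQ : homog (\sum_i dx i + \sum_j dy j) (tpure (fun i => dx i + D i) inner).
  by rewrite -sum_block_deg -big_split; apply: homog_tpure.
rewrite (@schur_comp_pure K sym M (scomp N P) A n (assoc_outer t) _ _ _ _ _ _ _ hm hQ hz');
  last by rewrite addrA.
have hin : homog (a' + \sum_i dx i) (@cpure K sym M N _ t a' (\sum_i dx i) m (tpure dx x)).
  exact: homog_qpure.
rewrite (@schur_comp_pure K sym (scomp M N) P A n s _ _ _ _ _ _ _ hin (homog_tpure _ _) hz') //.
rewrite (block_sep_pure _ hy hz) /sep_pure (linZ (spure_linr _ _ _)).
rewrite (linZ schur_comp_lin).
have hW j : homog (dy j + Z j) (spure (dy j) (Z j) (y j)
    (tpurec (fun k => dz (clab s (tagnat.Rank j k))) (fun k => z (clab s (tagnat.Rank j k))))).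
  exact: homog_qpure.
rewrite (schur_comp_pure hm (homog_tpure _ _)) //; last first.
  have -> : \sum_j dy j + \sum_k dz k = \sum_j (dy j + Z j).
    rewrite big_split; congr (_ + _); rewrite (reindex (clab s)) ?big_Rank //.
    exact/onW_bij/ofun_bij.
  exact: homog_tpure.
rewrite (block_sep_pure _ hx hW).
rewrite (@block_sep_pure K sym (scomp N P) A _ _ _ (clab (assoc_outer t)) _ _ _ _ inner_homog hz).
rewrite /sep_pure !(linZ (spure_linr _ _ _)).
have DZE i : D i + block_deg (clab (assoc_outer t)) dz i =
    block_deg (clab t) (fun j => dy j + Z j) i.
  rewrite [RHS]big_split; congr (_ + _); rewrite /block_deg big_Rank; apply: eq_bigr => k _.
  by apply: eq_bigr => u _; rewrite /= rgE.
have lS := (schur_map_graded M (tpower_thick scg) (fun=> tpower_sym scg)).1.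
rewrite (linZ lS) schur_map_pure; [|exact: tpower_thick|by move=> _; apply: tpower_sym].
rewrite mul0r addr0 ksgn_par scale1r tpower_pure //.
have -> : (fun i => sc (spure (dx i + D i) (block_deg (clab (assoc_outer t)) dz i) (inner i)
      (tpurec (fun k => dz (clab (assoc_outer t) (tagnat.Rank i k)))
              (fun k => z (clab (assoc_outer t) (tagnat.Rank i k)))))) =
  (fun i => interleave K (fun k : 'I_(@cbr _ _ t i) => dy (l k)) (fun k => Z (l k)) *:
    spure (dx i) (block_deg (clab t) (fun j => dy j + Z j) i) (x i)
      (tpurec (fun k : 'I_(@cbr _ _ t i) => dy (l k) + Z (l k))
         (fun k => spure (dy (l k)) (Z (l k)) (y (l k))
        (tpurec (fun u => dz (clab s (tagnat.Rank (l k) u)))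
                (fun u => z (clab s (tagnat.Rank (l k) u))))))).
  apply: dfunext => i.
  have hy' : homog (D i) (tpure (fun k : 'I_(@cbr _ _ t i) => dy (l k)) (fun k => y (l k))).
    exact: homog_tpure.
  have hz'' : homog (block_deg (clab (assoc_outer t)) dz i)
      (tpurec (fun k => dz (clab (assoc_outer t) (tagnat.Rank i k)))
              (fun k => z (clab (assoc_outer t) (tagnat.Rank i k)))).
    exact: homog_tpure.
  rewrite /sc /inner (@schur_comp_pure K sym N P A _ (@assoc_inner sym n s t i) _ _ _ _ _ _ _
    (hx i) hy' hz'') //.
  rewrite (@block_sep_pure K sym P A _ _ _ (clab (@assoc_inner sym n s t i)) _ _ _ _
    (fun k => hy (l k)) (fun w => hz _)).
  rewrite /sep_pure (linZ (spure_linr _ _ _)) shuffle_signE koszul_id mul1r.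
  have ZE (k : 'I_(@cbr _ _ t i)) : block_deg (clab (@assoc_inner sym n s t i))
      (fun w => dz (clab (assoc_outer t) (tagnat.Rank i w))) k = Z (l k).
    by apply: eq_bigr => u _; rewrite /= rgE.
  rewrite (funext ZE) DZE; congr (_ *: spure _ _ _ (tpurec _ _)).
  apply: dfunext => k.
  congr (spure _ _ _ (tpurec _ _)); apply: dfunext => u.
    by rewrite /= rgE.
  by rewrite /= rgE.
rewrite /tpurec tpure_scale (linZ (spure_linr _ _ _)) !scalerA -addrA.
congr (_ *: _).
  exact: (assoc_sign K (clab t) (clab s) dx dy dz).
congr spure; congr tpure.
by apply: dfunext => i; rewrite -addrA DZE.
Qed.

End AssocPure.

Section AssocSchur.
Variables (K : comPzRingType) (sym : bool) (M N P : sseq K sym) (A : complex K) (n : nat).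
Variables (dz : 'I_n -> int) (z : 'I_n -> A).
Hypothesis hz : forall k, homog (dz k) (z k).

Local Notation sc := (@schur_comp K sym N P A).
Local Notation b0 := (\sum_k dz k).

Let Lm a0 (w : scomp (scomp M N) P n) : schur M (schur N (schur P A)) :=
  schur_comp (schur_comp (spure a0 b0 w (tpurec dz z))).
Let Rm a0 (w : scomp M (scomp N P) n) : schur M (schur N (schur P A)) :=
  schur_map 0 (tpower sc) (schur_comp (spure a0 b0 w (tpurec dz z))).

Let lL a0 : linear (Lm a0).
Proof.
apply: lin_comp schur_comp_lin _.
apply: lin_comp schur_comp_lin _.
exact: spure_linl.
Qed.

Let lR a0 : linear (Rm a0).
Proof.
have scg := schur_comp_graded N P A.
apply: lin_comp (schur_map_graded M (tpower_thick scg) (fun=> tpower_sym scg)).1 _.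
apply: lin_comp schur_comp_lin _.
exact: spure_linl.
Qed.

Let Lm0 (a0 : int) (s : cidx sym n) (a b : int) q y :
  a + b != a0 -> Lm a0 (@cpure K sym (scomp M N) P n s a b q y) = 0.
Proof.
move=> ne; rewrite /Lm spureE qpure_prj cpureE prj_qpure (negbTE ne).
by rewrite (lin0 (@qpure_linl _ _ _ _ _ _ _ _ _)) !(lin0 schur_comp_lin).
Qed.

Let Rm0 (a0 : int) (s : cidx sym n) (a b : int) q y :
  a + b != a0 -> Rm a0 (@cpure K sym M (scomp N P) n s a b q y) = 0.
Proof.
move=> ne; have scg := schur_comp_graded N P A.
rewrite /Rm spureE qpure_prj cpureE prj_qpure (negbTE ne).
rewrite (lin0 (@qpure_linl _ _ _ _ _ _ _ _ _)) (lin0 schur_comp_lin).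
exact: (lin0 (schur_map_graded M (tpower_thick scg) (fun=> tpower_sym scg)).1).
Qed.

Let cpure0 (M' N' : sseq K sym) m' (s : cidx sym m') (a b a1 b1 : int) q y :
  homog a1 q -> homog b1 y ->
  (a, b) != (a1, b1) -> @cpure K sym M' N' m' s a b q y = 0.
Proof. exact: (@qpure0 K _ _ _ (@comp_arr K sym M' N' m') s a b q y a1 b1). Qed.

Let cpurel0 (s : cidx sym n) a b y : @cpure K sym (scomp M N) P n s a b 0 y = 0.
Proof. exact: (lin0 (@qpure_linl K _ _ _ (@comp_arr K sym (scomp M N) P n) s a b y)). Qed.

Let G (s : cidx sym n) (t : cidx sym (cr s)) (a' b' b : int) (m : M (cr t))
    (dx : 'I_(cr t) -> int) (x : forall i, N (@cbr _ _ t i))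
    (dy : 'I_(cr s) -> int) (y : forall j, P (@cbr _ _ s j)) : scomp M (scomp N P) n :=
  let l i k := clab t (tagnat.Rank i k) in
  let D i := \sum_(k < cbr i) dy (l i k) in
  shuffle_sign K (clab t) dx dy *:
  @cpure K sym M (scomp N P) n (assoc_outer t) a' (b' + b) m
    (tpure (fun i => dx i + D i) (fun i =>
      @cpure K sym N P _ (@assoc_inner sym n s t i) (dx i) (D i) (x i)
        (tpure (fun k => dy (l i k)) (fun k => y (l i k))))).

Let assocE w : @assoc K sym M N P n w =
  qlift (arr := @comp_arr K sym (scomp M N) P n) (fun s a b q y =>
    qlift (arr := @comp_arr K sym M N (cr s)) (fun t a' b' m x =>
      tlift (fun dx x => tlift (fun dy y => G a' b' b m dx x dy y) y) x) q) w.
Proof. by []. Qed.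

(* Not every summand chosen to represent a homogeneous element is itself     *)
(* homogeneous; to identify both sides summand by summand, the bidegree      *)
(* under which the left-hand side sees one tensor factor is computed from    *)
(* the total degree a0 and the degree of the other factor.                   *)
Lemma assoc_schur (a0 : int) (w : scomp (scomp M N) P n) :
  schur_map 0 (tpower sc) (schur_comp (spure a0 b0 (assoc w) (tpurec dz z))) =
  schur_comp (schur_comp (spure a0 b0 w (tpurec dz z))).
Proof.
rewrite -/(Rm a0 (assoc w)) -/(Lm a0 w) assocE; move: w.
apply: (qlift_transfer (lR a0) (lL a0)) => s a b q y hq hy; rewrite -cpureE.
have -> : Lm a0 (cpure a b q y) = Lm a0 (@cpure K sym (scomp M N) P n s (a0 - b) b q y).
  have [->//|ne] := eqVneq a (a0 - b).
  rewrite Lm0; last by apply: contraNneq ne => <-; rewrite addrK.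
  by rewrite (cpure0 hq hy) ?(lin0 (lL _)) // xpair_eqE eqxx andbT eq_sym.
move: q {hq}; apply: qlift_transfer; first exact: lR.
  exact: lin_comp (lL a0) (@qpure_linl K _ _ _ (@comp_arr K sym (scomp M N) P n) s (a0 - b) b y).
move=> t a' b' m x hm hx; rewrite -(@cpureE K sym M N).
have [a0E|ne] := eqVneq (a' + (b' + b)) a0; last first.
  rewrite (cpure0 (homog_qpure _ _ _ _ _ : homog (a' + b') (@cpure K sym M N _ t a' b' m x)) hy);
    last first.
    rewrite xpair_eqE eqxx andbT; apply: contraNneq ne => /eqP.
    by rewrite subr_eq => /eqP ->; rewrite addrA.
  rewrite (lin0 (lL _)); move: x {hx}; apply: tlift_transfer; first exact: lR.
    exact: lin_zero.
  move=> dx x hx; move: y {hy}; apply: tlift_transfer; first exact: lR.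
    exact: lin_zero.
  by move=> dy y hy; rewrite /G (linZ (lR _)) Rm0 ?scaler0.
have -> : a0 - b = a' + b' by rewrite -a0E addrA addrK.
move: x {hx}; apply: tlift_transfer; first exact: lR.
  apply: lin_comp (lL a0) _.
  apply: lin_comp (@qpure_linl K _ _ _ (@comp_arr K sym (scomp M N) P n) s (a' + b') b y) _.
  exact: (@qpure_linr K _ _ _ (@comp_arr K sym M N (cr s)) t a' b' m).
move=> dx x hx.
have htx : homog (\sum_i dx i) (tpure dx x) by apply: homog_tpure.
have -> : Lm a0 (@cpure K sym (scomp M N) P n s (a' + b') b (cpure a' b' m (tpure dx x)) y) =
    Lm a0 (@cpure K sym (scomp M N) P n s (a' + \sum_i dx i) (b' + b - \sum_i dx i)
      (@cpure K sym M N _ t a' (\sum_i dx i) m (tpure dx x)) y).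
  have [->|ne] := eqVneq b' (\sum_i dx i); first by rewrite addrAC subrr add0r.
  rewrite (cpure0 hm htx) ?xpair_eqE ?(negbTE ne) ?andbF //.
  rewrite cpurel0.
  rewrite [in RHS](cpure0 (homog_qpure _ _ _ _ _ :
    homog (a' + \sum_i dx i) (@cpure K sym M N _ t a' (\sum_i dx i) m (tpure dx x))) hy) //.
  rewrite xpair_eqE eqxx /= addrAC -subr_eq0 addrK subr_eq0; exact: ne.
move: y {hy}; apply: tlift_transfer; first exact: lR.
  apply: lin_comp (lL a0) _.
  exact: (@qpure_linr K _ _ _ (@comp_arr K sym (scomp M N) P n) s).
move=> dy y hy.
have [bE|ne] := eqVneq (\sum_j dy j) (b' + b - \sum_i dx i); last first.
  rewrite [in RHS](cpure0 (homog_qpure _ _ _ _ _ :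
    homog (a' + \sum_i dx i) (@cpure K sym M N _ t a' (\sum_i dx i) m (tpure dx x)))
    (homog_tpure _ _)); last first.
    by rewrite xpair_eqE eqxx /= eq_sym.
  rewrite /G (lin0 (lL _)) (linZ (lR _)).
  rewrite (@cpure0 M (scomp N P) n (assoc_outer t) a' (b' + b) a' _ m _ hm (homog_tpure _ _)).
    by rewrite (lin0 (lR _)) scaler0.
  rewrite xpair_eqE eqxx /= big_split (sum_block_deg t dy) /=.
  by apply: contraNneq ne => ->; rewrite addrAC subrr add0r.
have bE' : b' + b = \sum_i dx i + \sum_j dy j by rewrite bE addrCA subrr addr0.
rewrite /G -bE bE' (linZ (lR _)) -a0E bE' addrA.
exact: assoc_pure.
Qed.

End AssocSchur.

(** * The cofree coalgebra *)

Section CofreeCoalgebra.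
Variables (K : comPzRingType) (sym : bool) (C : cooperad K sym) (A : complex K).

Lemma schur_comultE (B : complex K) (x : schur C B) :
  schur_comult C B x = schur_comp (smap_schur (comult C) x).
Proof. by []. Qed.

Lemma schur_comult_graded (B : complex K) : graded 0 (schur_comult C B).
Proof.
apply: (graded_cast (addr0 0)).
exact: (graded_comp (schur_comp_graded _ _ _) (smap_schur_graded _ _)).
Qed.

Lemma schur_comult_dif (B : complex K) x : schur_comult C B (dif x) = dif (schur_comult C B x).
Proof. by rewrite !schur_comultE smap_schur_dif schur_comp_dif. Qed.

Lemma schur_comult_pure (B : complex K) n a b (c : C n) (t : tpow B n) :
  schur_comult C B (spure a b c t) = schur_comp (spure a b (comult C n c) t).
Proof. by rewrite schur_comultE smap_schur_pure. Qed.

Lemma spure_cpure0 (M N : sseq K sym) (B : complex K) n (s : cidx sym n) a b a1 b1 m x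
    (t : tpow B n) : a1 + b1 != a -> spure a b (@cpure K sym M N n s a1 b1 m x) t = 0.
Proof.
move=> ne; rewrite spureE qpure_prj cpureE prj_qpure (negbTE ne).
exact: (lin0 (@spure_linl K sym (scomp M N) B n a b _)).
Qed.

(** Both iterated comultiplications are computed from [comult n c]; [assoc_schur] turns
    coassociativity of the cooperad into coassociativity of the comonad. *)
Lemma schur_comult_assoc x :
  schur_comult C (schur C A) (schur_comult C A x) =
  schur_map 0 (tpower (schur_comult C A)) (schur_comult C A x).
Proof.
have Dg := schur_comult_graded A; have scg := schur_comp_graded C C A.
have Ds : sym -> symmetric_thick (tpower (schur_comult C A)) by move=> _; apply: tpower_sym.
have scs : sym -> symmetric_thick (tpower (@schur_comp K sym C C A)).
  by move=> _; apply: tpower_sym.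
have lSD := (schur_map_graded C (tpower_thick Dg) Ds).1.
have lSs := (schur_map_graded C (tpower_thick scg) scs).1.
have lsc (M N : sseq K sym) B := @schur_comp_lin K sym M N B.
move: x; apply: sp_ext.
- exact: lin_comp (schur_comult_graded _).1 Dg.1.
- exact: lin_comp lSD Dg.1.
case=> n a c dz z hc hz; rewrite /sp_elt /= !schur_comult_pure.
set b := \sum_k dz k; have hz' : homog b (tpurec dz z) by apply: homog_tpure.
have lsp (M : sseq K sym) := @spure_linl K sym M A n a b (tpurec dz z).
pose q := comult C n c.
(* Comultiplying the outer operation commutes with the first comparison map. *)
transitivity (schur_comp (schur_comp (spure a b
  (comp_map (fun k => comult C k) (fun=> id) q) (tpurec dz z)))).
  apply: esym; apply: (@comp_map_transfer _ _ _ _ _ _ _ _ _ _ _ _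
    (fun w => schur_comp (schur_comp (spure a b w (tpurec dz z))))
    (fun w => schur_comult C _ (schur_comp (spure a b w (tpurec dz z))))).
  - by move=> m; apply: cmap_graded.
  - by move=> m; apply: graded_id.
  - exact: lin_comp (lsc _ _ _) (lin_comp (lsc _ _ _) (lsp _)).
  - exact: lin_comp (schur_comult_graded _).1 (lin_comp (lsc _ _ _) (lsp _)).
  move=> s a1 m d x hm hx; have [aE|ne] := eqVneq (a1 + \sum_i d i) a; last first.
    rewrite !(spure_cpure0 _ _ _ _ ne) !(lin0 (lsc _ _ _)).
    by rewrite (lin0 (schur_comult_graded _).1).
  rewrite !(schur_comp_pure (s := s) _ (homog_tpure _ _) hz' (esym aE)) //.
    by rewrite schur_comult_pure.
  exact: cmap_homog.
(* Coassociativity of [C] replaces the comultiplication of the outer operation by that of the inner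
   ones. *)
rewrite -(assoc_schur hz) comult_assoc; apply: (@comp_map_transfer _ _ _ _ _ _ _ _ _ _ _ _
  (fun w => schur_map 0 _ (schur_comp (spure a b w (tpurec dz z))))
  (fun w => schur_map 0 _ (schur_comp (spure a b w (tpurec dz z))))).
- by move=> m; apply: graded_id.
- by move=> m; apply: cmap_graded.
- exact: lin_comp lSs (lin_comp (lsc _ _ _) (lsp _)).
- exact: lin_comp lSD (lin_comp (lsc _ _ _) (lsp _)).
move=> s a1 m d x hm hx; have [aE|ne] := eqVneq (a1 + \sum_i d i) a; last first.
  by rewrite !(spure_cpure0 _ _ _ _ ne) !(lin0 (lsc _ _ _)) (lin0 lSs) (lin0 lSD).
rewrite !(schur_comp_pure (s := s) hm (homog_tpure _ _) hz' (esym aE)).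
rewrite !schur_map_pure //; [|exact: tpower_thick..].
congr (_ *: spure _ _ _ _).
rewrite !block_sep_pure //; last by move=> i; apply: cmap_homog.
rewrite /sep_pure (linZ (tpower_thick Dg _).1) (linZ (tpower_thick scg _).1) !tpower_pure //.
congr (_ *: tpurec _ _); apply: dfunext => i.
by rewrite schur_comult_pure.
Qed.

(** The comultiplication of the cooperad acts on operations only and hence commutes with [F]; the
    rest is [schur_comp_thick]. *)
Lemma schur_comult_thick (B : complex K) e (F : thick A B) x :
  is_thick e F -> (sym -> symmetric_thick F) ->
  schur_comult C B (schur_map e F x) =
  schur_map e (thick_schur_map C e F) (schur_comult C A x).
Proof.
move=> Fg Fs; rewrite !schur_comultE -schur_comp_thick //; congr schur_comp.
have lF := (schur_map_graded C Fg Fs).1.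
have lF' := (schur_map_graded (scomp C C) Fg Fs).1.
have lc X := (smap_schur_graded (comult C) X).1.
move: x; apply: qtens_ext.
- exact: lin_comp (lc B) lF.
- exact: lin_comp lF' (lc A).
move=> n a b c t hc ht; rewrite -!spureE schur_map_pure // (linZ (lc B)) !smap_schur_pure.
by rewrite schur_map_pure.
Qed.

End CofreeCoalgebra.

Section CofreeCounit.
Variables (K : comPzRingType) (sym : bool) (M : sseq K sym) (u : smap M (sunit K sym)).
Variable X : complex K.

Definition smap_eval_elt n (a b : int) : M n -> tpow X n -> X :=
  match n return M n -> tpow X n -> X with
  | 1%N => fun c t => (u 1%N c : K) *: tpow1 t
  | _ => fun _ _ => 0
  end.

(** The counit of the comonad, formed for an arbitrary map to the unit so that it also covers the
    unit itself with its identity map. *)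
Definition smap_eval : schur M X -> X := slift smap_eval_elt.

Lemma smap_eval_bilin : qbilin (@schur_arr K sym M X) smap_eval_elt.
Proof.
split=> [[|[|n]] a b t _|[|[|n]] a b c _|m n v w a b c t vw _ _] /=;
  try exact: lin_zero.
- by move=> k c c'; rewrite cfun_lin scalerDl scalerA.
- exact/lin_scale/tpow1_lin.
case: _ _ / vw c t => m' n' r c t; have mn := obij_card r; subst n'.
case: m' r c t => [|[|m']] r c t //=.
rewrite sfun_act; congr (_ *: tpow1 _); apply: tpact_id => i.
by rewrite (ord1 i) (ord1 (r _)).
Qed.

Lemma smap_eval_lin : linear smap_eval.
Proof. exact: (qlift_lin smap_eval_bilin). Qed.

Lemma smap_eval_pure n a b (c : M n) t : homog a c -> homog b t ->
  smap_eval (spure a b c t) = smap_eval_elt a b c t.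
Proof. exact: (qlift_pureh smap_eval_bilin). Qed.

End CofreeCounit.

Section CofreeCounitLaw.
Variables (K : comPzRingType) (sym : bool) (C : cooperad K sym) (A : complex K).

Definition sid (M : sseq K sym) : smap M M :=
  @SMap K sym M M (fun n => idcmap (M n)) (fun _ _ _ _ => erefl).

Lemma smap_eval_elt_sid (M : sseq K sym) (u : smap M (sunit K sym)) (X : complex K) n a b
    (c : M n) (t : tpow X n) :
  smap_eval_elt (sid (sunit K sym)) a b (u n c) t = smap_eval_elt u a b c t.
Proof. by case: n c t => [|[|n]]. Qed.

Lemma schur_comult_counit x : schur_counit (schur_comult C A x) = x.
Proof.
rewrite -[schur_counit _]/(smap_eval (counit C) _).
have lev := @smap_eval_lin K sym C (counit C) (schur C A).
have lev1 := @smap_eval_lin K sym _ (sid (sunit K sym)) (schur C A).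
have lsc (M N : sseq K sym) B := @schur_comp_lin K sym M N B.
move: x; apply: sp_ext.
- exact: lin_comp lev (schur_comult_graded C A).1.
- exact: lin_id.
case=> n a c dz z hc hz; rewrite /sp_elt /= schur_comult_pure.
set b := \sum_k dz k; have hz' : homog b (tpurec dz z) by apply: homog_tpure.
have lsp (M : sseq K sym) := @spure_linl K sym M A n a b (tpurec dz z).
transitivity (smap_eval (sid (sunit K sym)) (schur_comp (spure a b
  (comp_map (fun k => counit C k) (fun=> id) (comult C n c)) (tpurec dz z)))).
  apply: esym; apply: (@comp_map_transfer _ _ _ _ _ _ _ _ _ _ _ _
    (fun w => smap_eval _ (schur_comp (spure a b w (tpurec dz z))))
    (fun w => smap_eval _ (schur_comp (spure a b w (tpurec dz z))))).
  - by move=> m; apply: cmap_graded.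
  - by move=> m; apply: graded_id.
  - exact: lin_comp lev1 (lin_comp (lsc _ _ _) (lsp _)).
  - exact: lin_comp lev (lin_comp (lsc _ _ _) (lsp _)).
  move=> s a1 m d x hm hx; have [aE|ne] := eqVneq (a1 + \sum_i d i) a; last first.
    by rewrite !(spure_cpure0 _ _ _ _ ne) !(lin0 (lsc _ _ _)) (lin0 lev) (lin0 lev1).
  rewrite !(schur_comp_pure (s := s) _ (homog_tpure _ _) hz' (esym aE)) //; last exact: cmap_homog.
  have hB := block_sep_homog_l (homog_tpure d x) hz'.
  rewrite !smap_eval_pure //; last exact: cmap_homog.
  exact: smap_eval_elt_sid.
(* After the left counit law a single block is left, which contains the whole tensor; [tpow1]
   extracts it. *)
rewrite (counit_l hc).
set s := CIdx _.
have h1 : homog 0 (1 : Kcomplex K) by [].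
have htc : homog a (tpure (V := fun _ : 'I_1 => C n) (fun=> a) (fun=> c)).
  by have := homog_tpure (V := fun _ : 'I_1 => C n) (fun=> a) (fun=> c); rewrite big_ord1.
rewrite (@schur_comp_pure K sym (sunit K sym) C A n s _ _ _ _ _ _ _ h1 htc hz');
  last by rewrite add0r.
rewrite smap_eval_pure //; last exact: (@block_sep_homog_l K sym C A n s).
have hz'' : homog b (tpact A (obinv (clab s)) (tpurec dz z)) by apply: cmap_homog.
rewrite [smap_eval_elt _ _ _ _ _]scale1r block_sep_relabel.
rewrite (@tpow1_block_sep K sym C A (fun=> n) (fun=> a) (fun=> c) b _ (fun=> hc) hz'').
congr spure; rewrite -tpact_comp tpact_id // => i.
by apply: ord_inj.
Qed.

End CofreeCounitLaw.

(** * The contraction of cofree coalgebras *)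

Section Contraction.
Variables (K : comPzRingType) (sym : bool) (C : cooperad K sym).
Variables (A B : complex K) (f : A -> B) (g : B -> A) (h : A -> A) (H : thick A A).
Hypotheses (fgh : contraction f g h) (HP : good_pseudo_derivation f g h H).
Hypothesis Hs : sym -> symmetric_thick H.

Lemma schur_is_coalgebra (X : complex K) : is_coalgebra (schur_comult C X).
Proof.
split.
- exact: schur_comult_graded.
- move=> x; rewrite /bdry schur_comult_dif ksgn_par scale1r; exact: subrr.
- exact: schur_comult_assoc.
exact: schur_comult_counit.
Qed.

Lemma tsm_coalgebra (X Y : complex K) e (F : thick X Y) :
  is_thick e F -> (sym -> symmetric_thick F) ->
  coalgebra_thick_map (schur_comult C X) (schur_comult C Y) e (thick_schur_map C e F).
Proof.
move=> Fg Fs; split.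
- exact: tsm_thick.
- exact: tsm_sym.
by move=> t; rewrite tpow1_tsm // schur_comult_thick.
Qed.

Lemma tpower_comp (X Y Z : complex K) (u : Y -> Z) (v : X -> Y) n t :
  graded 0 u -> graded 0 v -> tpower u (tpower (n := n) v t) = tpower (u \o v) t.
Proof.
move=> ug vg; have uvg : graded 0 (u \o v) by apply: (graded_cast (addr0 0)); apply: graded_comp.
move: t; apply: tens_ext.
- exact: lin_comp (tpower_thick ug _).1 (tpower_thick vg _).1.
- exact: (tpower_thick uvg _).1.
by move=> d x hx; rewrite !tpower_pure.
Qed.

Lemma tpower_morphism (X Y : complex K) (u : X -> Y) : graded 0 u -> is_morphism (tpower u).
Proof.
move=> ug p q; have lu n := (tpower_thick ug n).1.
apply: tcat_ext; [exact: lu | exact: tprod_lin |].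
move=> s t [ds [x [hx ->]]] [dt [y [hy ->]]].
rewrite (tprod_tcat _ (lu p) (lu q) _ (homog_tpure _ _)) mul0r ksgn_par scale1r.
rewrite tcat_pure // !tpower_pure // tcat_pure => [|i|i]; last first.
- by have := graded_homog ug (hy i); rewrite addr0.
- by have := graded_homog ug (hx i); rewrite addr0.
congr tpurec; apply: dfunext; apply: shift_ind => j.
  by rewrite !scat_l.
by rewrite !scat_r.
Qed.

Lemma tpower_bdry (X Y : complex K) (u : X -> Y) n t : graded 0 u ->
  (forall x, bdry 0 u x = 0) -> bdry 0 (tpower u (n := n)) t = 0.
Proof.
move=> ug u0; have lu := (tpower_thick ug n).1; move: t; apply: tens_ext.
- exact: bdry_lin.
- exact: lin_zero.
move=> d x hx; rewrite /bdry ksgn_par scale1r tpower_pure // -/(tpurec d x) !dif_tpurec.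
rewrite (lin_sumE _ _ _ lu); apply/eqP; rewrite subr_eq0; apply/eqP; apply: eq_bigr => i _.
rewrite (linZ lu) tpower_pure //; congr (_ *: tpurec _ _); apply: funext => j.
case: ifP => // _; have := u0 (x j); rewrite /bdry ksgn_par scale1r.
by move/eqP; rewrite subr_eq0 => /eqP.
Qed.

(** Serves both (a) and (b): the hypothesis [Hs] is vacuous when [sym] is false. *)
Lemma contraction_schur : coalgebra_contraction
  (schur_comult C A) (schur_comult C B)
  (thick_schur_map C 0 (tpower f)) (thick_schur_map C 0 (tpower g))
  (thick_schur_map C 1 H).
Proof.
have [fg gg _ f0 g0 _ fgK _ _ _] := fgh; have [Hg Hp _ Hb HH fH Hgg] := HP.
have Fg := tpower_thick fg; have Fs : sym -> _ := fun=> tpower_sym fg.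
have Gg := tpower_thick gg; have Gs : sym -> _ := fun=> tpower_sym gg.
split; try exact: schur_is_coalgebra; try exact: tsm_coalgebra.
- by move=> n t; apply: tsm_bdry0 => // m s; apply: tpower_bdry.
- by move=> n t; apply: tsm_bdry0 => // m s; apply: tpower_bdry.
- by move=> n t; apply: tsm_bdry1.
- move=> n t; apply: tsm_comp1 => // m s; rewrite tpower_comp //.
  have -> : f \o g = id by apply: funext.
  move: s; apply: tens_ext; [exact: (tpower_thick (@graded_id _ _) _).1 | exact: lin_id |].
  by move=> d x hx; rewrite tpower_pure //; apply: graded_id.
- by move=> n t; apply: tsm_comp0.
- by move=> n t; apply: tsm_comp0.
- by move=> n t; apply: tsm_comp0.
- by apply: tsm_morphism => //; apply: tpower_morphism.
- by apply: tsm_morphism => //; apply: tpower_morphism.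
exact: tsm_pseudo.
Qed.

End Contraction.

(** * Pseudo-derivations given by weights *)

Section Hat.
Variables (K : comPzRingType) (A B : complex K) (f : A -> B) (g : B -> A) (h : A -> A).
Hypothesis fgh : contraction f g h.

Let fg := contr_f_deg fgh.
Let gg := contr_g_deg fgh.
Let hg := contr_h_deg fgh.

(** The two complementary idempotents that split [A] into the kernel and the image of [g f]. *)
Definition keep (b : bool) (x : A) : A := if b then x - g (f x) else g (f x).

Lemma gf_graded : graded 0 (g \o f).
Proof. by apply: (graded_cast (addr0 0)); apply: graded_comp. Qed.

Lemma keep_lin b : linear (keep b).
Proof. by case: b; [apply: lin_minus (@lin_id _ _) gf_graded.1 | exact: gf_graded.1]. Qed.

Lemma keep_graded b : graded 0 (keep b).
Proof.
split=> [|i x]; first exact: keep_lin.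
have := gf_graded.2 i x; rewrite addr0 /= => E.
by rewrite /keep E; case: b; rewrite ?(linB prj_lin).
Qed.

Lemma keep_keep b x : keep b (keep b x) = keep b x.
Proof.
have fgK := contr_fg fgh.
case: b; rewrite /keep ?fgK //.
by rewrite (linB fg.1) fgK subrr (lin0 gg.1) subr0.
Qed.

Lemma keep_h b x : keep b (h (keep b x)) = h (keep b x).
Proof.
rewrite /keep (contr_fh fgh) (lin0 gg.1).
by case: b; rewrite ?subr0 // (contr_hg fgh).
Qed.

Lemma h_keepF x : h (keep false x) = 0.
Proof. exact: (contr_hg fgh). Qed.

Lemma gf_keep b x : g (f (keep b x)) = if b then 0 else keep b x.
Proof.
case: b; rewrite /keep ?(contr_fg fgh) //.
by rewrite (linB fg.1) (contr_fg fgh) subrr (lin0 gg.1).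
Qed.

Lemma dif_gf x : dif (g (f x)) = g (f (dif x)).
Proof.
have := contr_g_bdry fgh (f x); have := contr_f_bdry fgh x.
rewrite /bdry !ksgn_par !scale1r => /eqP; rewrite subr_eq0 => /eqP <-.
by move/eqP; rewrite subr_eq0 => /eqP.
Qed.

Lemma dif_keep b x : dif (keep b x) = keep b (dif x).
Proof. by rewrite /keep; case: b; rewrite ?(linB dif_lin) dif_gf. Qed.

Lemma dif_h x : dif (h x) + h (dif x) = g (f x) - x.
Proof. by rewrite -(contr_h_bdry fgh) /bdry ksgn1 scaleN1r opprK. Qed.

(* The projection onto the tensors whose i-th factor is in the kernel of g f *)
(* when R i, and in its image otherwise                                      *)
Definition sel n (R : pred 'I_n) : tpow A n -> tpow A n :=
  @tmap K n n (fun=> A) (fun=> A) id (fun=> 0) (fun i => keep (R i)).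

Lemma id_bij n : bijective (fun i : 'I_n => i). Proof. by exists id. Qed.

Lemma sel_pure n (R : pred 'I_n) d x :
  sel R (tpurec d x) = tpurec d (fun i => keep (R i) (x i)).
Proof.
rewrite /sel tmap0_pure; [|exact: id_bij|by move=> i; apply: keep_graded].
by rewrite koszul_id scale1r.
Qed.

Lemma sel_graded n (R : pred 'I_n) : graded 0 (sel R).
Proof.
apply: (graded_cast (e := \sum_(i < n) 0)); first by rewrite big1.
by apply: tmap_graded; [exact: id_bij | move=> i; apply: keep_graded].
Qed.

Lemma sel_lin n (R : pred 'I_n) : linear (sel R).
Proof. exact: (sel_graded R).1. Qed.

(** Each vector is the sum of its two components under [keep], so by multilinearity the images of
    all [sel R] together span. *)
Lemma sel_ext n (W : lmodType K) (u v : tpow A n -> W) : linear u -> linear v ->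
  (forall R d x, (forall i, homog (d i) (x i)) ->
     u (sel R (tpurec d x)) = v (sel R (tpurec d x))) -> u =1 v.
Proof.
move=> lu lv uv; apply: tens_ext => // d x hx.
have : forall x : 'I_n -> A, u (tpurec d (fun i => prj (d i) (x i))) =
    v (tpurec d (fun i => prj (d i) (x i))); last by move/(_ x); rewrite funext_homog.
have mP (w : tpow A n -> W) : linear w ->
    @mlin K n (fun=> A) W (fun x => w (tpurec d (fun i => prj (d i) (x i)))).
  move=> lw; apply: mlin_lin lw _.
  apply: (@mlin_pre K n (fun=> A) (fun=> A) _ (tpure d) (fun i => prj (d i))).
    by move=> i; apply: prj_lin.
  exact: tpure_mlin.
apply: (@mlin_ext K n (fun=> A) W (fun _ x => exists b y, x = keep b y)); try exact: mP.
  move=> _ u1 v1 lu1 lv1 E y.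
  have -> : y = keep true y + keep false y by rewrite /keep subrK.
  by rewrite (linD lu1) (linD lv1) !E //; [exists false, y | exists true, y].
move=> y /fin_all_exists [b /fin_all_exists [y' yE]].
have -> : (fun i => prj (d i) (y i)) = (fun i => keep (b i) (prj (d i) (y' i))).
  by apply: funext => i; rewrite yE (keep_graded _).2 addr0.
by rewrite -(sel_pure b) uv // => i; apply: prj_homog.
Qed.

(** [h] in the i-th place, with the Koszul sign for passing the earlier factors. *)
Definition hat n (i : 'I_n) : tpow A n -> tpow A n :=
  @tmap K n n (fun=> A) (fun=> A) id (fun j => if j == i then 1 else 0)
    (fun j => if j == i then h else id).

Definition hat_deg n (i : 'I_n) (d : 'I_n -> int) j := if j == i then d j + 1 else d j.
Definition hat_vec n (i : 'I_n) (x : 'I_n -> A) j := if j == i then h (x j) else x j.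

Lemma hat_comp_graded n (i j : 'I_n) :
  graded (if j == i then 1 else 0) (if j == i then h else id).
Proof. by case: ifP => _; [exact: hg | exact: graded_id]. Qed.

Lemma hat_lin n (i : 'I_n) : linear (hat i).
Proof. by apply: tmap_linear; [exact: id_bij | move=> j; apply: hat_comp_graded]. Qed.

Lemma hat_graded n (i : 'I_n) : graded 1 (hat i).
Proof.
apply: (graded_cast (e := \sum_j if j == i then 1 else 0)).
  by rewrite (bigD1 i) //= eqxx big1 ?addr0 // => j /negbTE ->.
by apply: tmap_graded; [exact: id_bij | move=> j; apply: hat_comp_graded].
Qed.

Lemma hat_pure n (i : 'I_n) d x : hat i (tpurec d x) =
  ksgn K (\sum_(j < n | (j < i)%N) d j) *: tpurec (hat_deg i d) (hat_vec i x).
Proof.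
rewrite /hat /tpurec tmap_pure; [|exact: id_bij|by move=> j; apply: hat_comp_graded].
rewrite koszul_id mul1r; congr (ksgn K _ *: tpure _ _).
- rewrite [RHS]big_mkcond; apply: eq_bigr => j _; rewrite big_mkcond (bigD1 i) //= eqxx mul1r.
  rewrite big1 ?addr0 // => k /negbTE ki; rewrite ki mul0r.
  by case: ifP.
- by apply: funext => j; rewrite /hat_deg; case: ifP; rewrite ?addr0.
by apply: funext => j; rewrite /hat_vec; case: ifP.
Qed.

Lemma hat_homog n (i : 'I_n) d x : (forall j, homog (d j) (x j)) ->
  forall j, homog (hat_deg i d j) (hat_vec i x j).
Proof.
by move=> hx j; rewrite /hat_deg /hat_vec; case: ifP => _ //; apply: graded_homog hg (hx j).
Qed.

Lemma tpurec0 (X : complex K) n (i : 'I_n) d (x : 'I_n -> X) : x i = 0 -> tpurec d x = 0.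
Proof. exact: tgen0. Qed.

Lemma hat_hat n (i : 'I_n) t : hat i (hat i t) = 0.
Proof.
move: t; apply: tens_ext; [exact: lin_comp (hat_lin i) (hat_lin i) | exact: lin_zero |].
move=> d x hx; rewrite -/(tpurec d x) hat_pure (linZ (hat_lin i)) hat_pure.
by rewrite (@tpurec0 _ _ i) ?scaler0 // /hat_vec eqxx (contr_hh fgh).
Qed.

Lemma hatC n (i j : 'I_n) t : i != j -> hat i (hat j t) = - hat j (hat i t).
Proof.
move=> ne; move: t; apply: tens_ext.
- exact: lin_comp (hat_lin i) (hat_lin j).
- exact/lin_opp/(lin_comp (hat_lin j) (hat_lin i)).
move=> d x hx; rewrite -/(tpurec d x) !hat_pure (linZ (hat_lin i)) (linZ (hat_lin j)) !hat_pure.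
rewrite !scalerA -scaleNr.
have -> : hat_deg i (hat_deg j d) = hat_deg j (hat_deg i d).
  apply: funext => k; rewrite /hat_deg; case: eqP => [->|//].
  by rewrite (negbTE ne).
have -> : hat_vec i (hat_vec j x) = hat_vec j (hat_vec i x).
  apply: funext => k; rewrite /hat_vec; case: eqP => [->|//].
  by rewrite (negbTE ne).
congr (_ *: _); wlog ij : i j ne / (i < j)%N => [W|].
  have [ij|] := ltnP i j; first exact: W.
  rewrite leq_eqVlt => /orP[/eqP/ord_inj ji|ji]; first by rewrite ji eqxx in ne.
  by rewrite (W j i) ?opprK // eq_sym.
have -> : \sum_(k < n | (k < i)%N) hat_deg j d k = \sum_(k < n | (k < i)%N) d k.
  apply: eq_bigr => k ki; rewrite /hat_deg; case: eqP => // kj.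
  by move: ki; rewrite kj ltnNge ltnW.
(* [hat i] raises the degree of a factor before [j], which produces the minus sign. *)
have -> : \sum_(k < n | (k < j)%N) hat_deg i d k = \sum_(k < n | (k < j)%N) d k + 1.
  rewrite (bigD1 i) //= [in RHS](bigD1 i) //= /hat_deg eqxx [RHS]addrAC; congr (_ + _).
  by apply: eq_bigr => k /andP[_ /negbTE ->].
by rewrite ksgnD ksgn1 mulrN1 mulrN opprK mulrC.
Qed.

Lemma sel_hat n (R : pred 'I_n) i t : sel R (hat i (sel R t)) = hat i (sel R t).
Proof.
have lS := sel_lin R; move: t; apply: tens_ext.
- exact: lin_comp lS (lin_comp (hat_lin i) lS).
- exact: lin_comp (hat_lin i) lS.
move=> d x hx; rewrite -/(tpurec d x) sel_pure hat_pure (linZ lS) sel_pure.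
congr (_ *: tpurec _ _); apply: funext => j; rewrite /hat_vec.
by case: ifP => _; rewrite ?keep_h ?keep_keep.
Qed.

Lemma hat_selF n (R : pred 'I_n) i t : ~~ R i -> hat i (sel R t) = 0.
Proof.
move=> Ri; move: t; apply: tens_ext; [exact: lin_comp (hat_lin i) (sel_lin R) | exact: lin_zero |].
move=> d x hx; rewrite -/(tpurec d x) sel_pure hat_pure (@tpurec0 _ _ i) ?scaler0 //.
by rewrite /hat_vec eqxx (negbTE Ri) h_keepF.
Qed.

Lemma dif_sel n (R : pred 'I_n) t : dif (sel R t) = sel R (dif t).
Proof.
have lS := sel_lin R; move: t; apply: tens_ext.
- exact: lin_comp dif_lin lS.
- exact: lin_comp lS dif_lin.
move=> d x hx; rewrite -/(tpurec d x) sel_pure !dif_tpurec (lin_sumE _ _ _ lS).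
apply: eq_bigr => i _; rewrite (linZ lS) sel_pure; congr (_ *: tpurec _ _).
by apply: funext => j; case: ifP => // _; rewrite dif_keep.
Qed.

Lemma tpower_f_hat n (i : 'I_n) t : tpower f (hat i t) = 0.
Proof.
have lf := (tpower_thick fg n).1.
move: t; apply: tens_ext; [exact: lin_comp lf (hat_lin i) | exact: lin_zero |].
move=> d x hx; rewrite -/(tpurec d x) hat_pure (linZ lf) tpower_pure //.
by rewrite (@tpurec0 _ _ i) ?scaler0 // /hat_vec eqxx (contr_fh fgh).
Qed.

Lemma sel_tpower_g n t : sel (fun _ : 'I_n => false) (tpower g t) = tpower g t.
Proof.
have lg := (tpower_thick gg n).1; move: t; apply: tens_ext => //.
  exact: lin_comp (sel_lin _) lg.
move=> d x hx; rewrite tpower_pure // sel_pure; congr tpurec; apply: funext => i.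
by rewrite /keep (contr_fg fgh).
Qed.

Lemma tpower_gf_sel n (R : pred 'I_n) t :
  tpower g (tpower f (sel R t)) = if [exists i, R i] then 0 else sel R t.
Proof.
have lf := (tpower_thick fg n).1; have lg := (tpower_thick gg n).1; move: t; apply: tens_ext.
- exact: lin_comp lg (lin_comp lf (sel_lin _)).
- by case: [exists i, R i]; [exact: lin_zero | exact: sel_lin].
move=> d x hx; rewrite -/(tpurec d x) sel_pure !tpower_pure //.
case: ifP => [/existsP[i Ri]|/negbT/existsPn R0].
  by rewrite (@tpurec0 _ _ i) // gf_keep Ri.
by congr tpurec; apply: funext => i; rewrite gf_keep (negbTE (R0 i)).
Qed.

Lemma tpow1_hat t : tpow1 (hat ord0 t) = h (tpow1 t).
Proof.
move: t; apply: tens_ext.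
- exact: lin_comp tpow1_lin (hat_lin _).
- exact: lin_comp hg.1 tpow1_lin.
move=> d x hx; rewrite -/(tpurec d x) hat_pure (linZ tpow1_lin) !tpow1_pure hx.
rewrite big_pred0 // ksgn_par scale1r; exact: (hat_homog ord0 hx ord0).
Qed.

(** The graded commutator of [hat i] with the differential is [g f - 1] in the i-th place, where
    [g f] acts as zero or as the identity according to [R i]. *)
Lemma dif_hat n (R : pred 'I_n) (i : 'I_n) t :
  dif (hat i (sel R t)) + hat i (dif (sel R t)) = if R i then - sel R t else 0.
Proof.
move: t; apply: tens_ext.
- apply: lin_plus; first exact: lin_comp dif_lin (lin_comp (hat_lin i) (sel_lin R)).
  exact: lin_comp (hat_lin i) (lin_comp dif_lin (sel_lin R)).
- by case: (R i); [exact/lin_opp/sel_lin | exact: lin_zero].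
move=> d x hx; rewrite -/(tpurec d x) sel_pure; set X := fun i => keep (R i) (x i).
rewrite hat_pure (linZ dif_lin) !dif_tpurec (lin_sumE _ _ _ (hat_lin i)).
rewrite scaler_sumr.
pose F1 (k : 'I_n) := ksgn K (\sum_(j < n | (j < i)%N) d j) *:
  (ksgn K (\sum_(j < n | (j < k)%N) hat_deg i d j) *:
   tpurec (fun j => if j == k then hat_deg i d j - 1 else hat_deg i d j)
          (fun j => if j == k then dif (hat_vec i X j) else hat_vec i X j)).
pose F2 (k : 'I_n) := hat i (ksgn K (\sum_(j < n | (j < k)%N) d j) *:
   tpurec (fun j => if j == k then d j - 1 else d j)
          (fun j => if j == k then dif (X j) else X j)).
rewrite -[LHS]/(\sum_k F1 k + \sum_k F2 k) -big_split (bigD1 i) //=.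
(* For [k] different from [i], differentiating in place [k] anticommutes with applying [h] in place
   [i]. *)
rewrite [X in _ + X]big1 => [|k ki]; rewrite /F1 /F2; last first.
  rewrite (linZ (hat_lin i)) hat_pure !scalerA.
  set Y1 := tpurec _ _; set Y2 := tpurec _ _; have -> : Y1 = Y2.
    congr tpurec; apply: funext => j; rewrite /hat_deg /hat_vec.
      by case: (eqVneq j k) => [->|//]; rewrite (negbTE ki).
    by case: (eqVneq j k) => [->|//]; rewrite (negbTE ki).
  rewrite -scalerDl [X in X *: _](_ : _ = 0) ?scale0r //.
  have [lt|gt|/ord_inj ik] := ltngtP i k; last by rewrite ik eqxx in ki.
    have -> : \sum_(j < n | (j < k)%N) hat_deg i d j = \sum_(j < n | (j < k)%N) d j + 1.
      rewrite (bigD1 i) //= [in RHS](bigD1 i) //= /hat_deg eqxx [RHS]addrAC; congr (_ + _).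
      by apply: eq_bigr => j /andP[_ /negbTE ->].
    rewrite [X in _ + _ * ksgn K X](_ : _ = \sum_(j < n | (j < i)%N) d j).
      by rewrite ksgnD ksgn1 mulrN1 mulrN mulrC addNr.
    apply: eq_bigr => j ji; case: eqP => // jk.
    by move: ji; rewrite jk ltnNge ltnW.
  have -> : \sum_(j < n | (j < k)%N) hat_deg i d j = \sum_(j < n | (j < k)%N) d j.
    apply: eq_bigr => j jk; rewrite /hat_deg; case: eqP => // ji.
    by move: jk; rewrite ji ltnNge ltnW.
  rewrite [X in _ + _ * ksgn K X](_ : _ = \sum_(j < n | (j < i)%N) d j - 1).
    by rewrite ksgnD ksgnN ksgn1 mulrN1 mulrN mulrC subrr.
  rewrite (bigD1 k) //= [in RHS](bigD1 k) //= eqxx [RHS]addrAC; congr (_ + _).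
  by apply: eq_bigr => j /andP[_ /negbTE ->].
rewrite addr0 (linZ (hat_lin i)) hat_pure !scalerA.
have sE (d' : 'I_n -> int) : (forall j, j != i -> d' j = d j) ->
    \sum_(j < n | (j < i)%N) d' j = \sum_(j < n | (j < i)%N) d j.
  by move=> E; apply: eq_bigr => j ji; apply: E; rewrite neq_ltn ji.
rewrite !sE; [|by move=> j /negbTE; rewrite /hat_deg => ->..].
rewrite ksgn_par sign_sq !scale1r.
pose T z := tpurec d (fun j => if j == i then z else X j).
have lT : linear T by apply: tpure_set_lin.
rewrite [X in X + _](_ : _ = T (dif (h (X i)))); last first.
  congr tpurec; apply: funext => j; rewrite /hat_deg /hat_vec.
    by have [->|/negbTE ji] := eqVneq j i; rewrite ?eqxx ?addrK ?ji.
  by have [->|/negbTE ji] := eqVneq j i; rewrite ?eqxx ?ji.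
rewrite [X in _ + X](_ : _ = T (h (dif (X i)))); last first.
  congr tpurec; apply: funext => j; rewrite /hat_deg /hat_vec.
    by have [->|/negbTE ji] := eqVneq j i; rewrite ?eqxx ?subrK ?ji.
  by have [->|/negbTE ji] := eqVneq j i; rewrite ?eqxx ?ji.
rewrite -(linD lT) dif_h gf_keep -/(X i).
have [Ri|Ri] := boolP (R i); last by rewrite subrr (lin0 lT).
rewrite sub0r (linN lT); congr (- tpurec _ _); apply: funext => j.
by case: eqP => [->|].
Qed.

End Hat.

Section HatTcat.
Variables (K : comPzRingType) (A B : complex K) (f : A -> B) (g : B -> A) (h : A -> A).
Hypothesis fgh : contraction f g h.

Lemma sel_tcat p q (R : pred 'I_(p + q)) (s : tpow A p) (t : tpow A q) :
  sel f g R (tcat s t) =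
  tcat (sel f g (fun i => R (lshift q i)) s) (sel f g (fun j => R (rshift p j)) t).
Proof.
have lS n Q := @sel_lin _ _ _ _ _ _ fgh n Q.
move: s t; apply: tens_ext2.
- move=> t; exact: lin_comp (lS _ _) (tcat_linl _).
- move=> s; exact: lin_comp (lS _ _) (tcat_linr _).
- move=> t; exact: lin_comp (tcat_linl _) (lS _ _).
- move=> s; exact: lin_comp (tcat_linr _) (lS _ _).
move=> ds x dt y hx hy; rewrite tcat_pure // !(sel_pure fgh) tcat_pure.
- congr tpurec; apply: dfunext; apply: shift_ind => j.
    by rewrite !scat_l.
  by rewrite !scat_r.
- by move=> i; have := graded_homog (keep_graded fgh (R (lshift q i))) (hx i); rewrite addr0.
by move=> i; have := graded_homog (keep_graded fgh (R (rshift p i))) (hy i); rewrite addr0.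
Qed.

Lemma hat_tcat_l p q (i : 'I_p) (s : tpow A p) (t : tpow A q) :
  hat h (lshift q i) (tcat s t) = tcat (hat h i s) t.
Proof.
have lH n j := @hat_lin _ _ _ _ _ _ fgh n j.
move: s t; apply: tens_ext2.
- move=> t; exact: lin_comp (lH _ _) (tcat_linl _).
- move=> s; exact: lin_comp (lH _ _) (tcat_linr _).
- move=> t; exact: lin_comp (tcat_linl _) (lH _ _).
- move=> s; exact: tcat_linr.
move=> ds x dt y hx hy; rewrite tcat_pure // !(hat_pure fgh) (linZ (tcat_linl _)) tcat_pure //.
  congr (ksgn K _ *: tpurec _ _).
  - rewrite big_mkcond big_split_ord /= [X in _ + X]big1 ?addr0 => [|j _].
      by rewrite [RHS]big_mkcond; apply: eq_bigr => j _; rewrite scat_l.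
    by rewrite ltnNge ltnW // (leq_trans (ltn_ord i)) // leq_addr.
  - apply: funext; apply: shift_ind => j; rewrite /hat_deg ?scat_l ?scat_r ?eq_lshift //.
    by rewrite eq_rlshift.
  apply: funext; apply: shift_ind => j; rewrite /hat_vec ?scat_l ?scat_r ?eq_lshift //.
  by rewrite eq_rlshift.
exact: (hat_homog fgh).
Qed.

Lemma hat_tcat_r p q a (j : 'I_q) (s : tpow A p) (t : tpow A q) : homog a s ->
  hat h (rshift p j) (tcat s t) = ksgn K a *: tcat s (hat h j t).
Proof.
have lH n i := @hat_lin _ _ _ _ _ _ fgh n i.
move: s t; apply: tens_ext2h.
- move=> t; exact: lin_comp (lH _ _) (tcat_linl _).
- move=> s; exact: lin_comp (lH _ _) (tcat_linr _).
- by move=> t; apply/lin_scale/tcat_linl.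
- move=> s; apply: lin_scale; exact: lin_comp (tcat_linr _) (lH _ _).
move=> ds x dt y hx hy <-.
rewrite tcat_pure // !(hat_pure fgh) (linZ (tcat_linr _)) tcat_pure //; last exact: (hat_homog fgh).
rewrite scalerA -ksgnD; congr (ksgn K _ *: tpurec _ _).
- rewrite big_mkcond big_split_ord /=; congr (_ + _).
    by apply: eq_bigr => i _; rewrite scat_l (leq_trans (ltn_ord i)) ?leq_addr.
  by rewrite [RHS]big_mkcond; apply: eq_bigr => i _; rewrite scat_r ltn_add2l.
- apply: funext; apply: shift_ind => i; rewrite /hat_deg ?scat_l ?scat_r ?eq_rshift //.
  by rewrite eq_lrshift.
apply: funext; apply: shift_ind => i; rewrite /hat_vec ?scat_l ?scat_r ?eq_rshift //.
by rewrite eq_lrshift.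
Qed.

Definition hsum n (w : 'I_n -> K) (t : tpow A n) : tpow A n := \sum_i w i *: hat h i t.

Lemma hsum_lin n (w : 'I_n -> K) : linear (hsum w).
Proof. by apply: lin_sum => i; apply/lin_scale/(hat_lin fgh). Qed.

Lemma hsum_graded n (w : 'I_n -> K) : graded 1 (hsum w).
Proof.
split=> [|i x]; first exact: hsum_lin.
rewrite /hsum (lin_sumE _ _ _ prj_lin); apply: eq_bigr => j _.
by rewrite (hat_graded fgh _).2 (linZ prj_lin).
Qed.

Lemma eq_hsum n (v w : 'I_n -> K) t : v =1 w -> hsum v t = hsum w t.
Proof. by move=> vw; apply: eq_bigr => i _; rewrite vw. Qed.

Lemma hsumD n (v w : 'I_n -> K) t : hsum (fun i => v i + w i) t = hsum v t + hsum w t.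
Proof. by rewrite -big_split; apply: eq_bigr => i _; rewrite scalerDl. Qed.

Lemma hsumN n (w : 'I_n -> K) t : hsum (fun i => - w i) t = - hsum w t.
Proof. by rewrite -sumrN; apply: eq_bigr => i _; rewrite scaleNr. Qed.

Lemma hsum_hsum n (v w : 'I_n -> K) t :
  hsum v (hsum w t) = \sum_i \sum_j (v i * w j) *: hat h i (hat h j t).
Proof.
apply: eq_bigr => i _; rewrite (lin_sumE _ _ _ (hat_lin fgh i)) scaler_sumr.
by apply: eq_bigr => j _; rewrite (linZ (hat_lin fgh i)) scalerA.
Qed.

Lemma hat_anti n (i j : 'I_n) t : hat h i (hat h j t) = - hat h j (hat h i t).
Proof.
have [->|ij] := eqVneq i j; first by rewrite (hat_hat fgh) oppr0.
exact: (hatC fgh).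
Qed.

Lemma hsumC n (v w : 'I_n -> K) t : hsum v (hsum w t) = - hsum w (hsum v t).
Proof.
rewrite !hsum_hsum exchange_big -sumrN; apply: eq_bigr => i _; rewrite -sumrN.
by apply: eq_bigr => j _; rewrite hat_anti scalerN mulrC.
Qed.

(** Symmetric coefficients meet antisymmetric products of [hat] operators with zero diagonal; the
    terms cancel in pairs, so no division by 2 is involved. *)
Lemma hsum_sym0 n (v w : 'I_n -> K) t :
  (forall i j, v i * w j = v j * w i) -> hsum v (hsum w t) = 0.
Proof.
move=> vw; rewrite hsum_hsum.
under eq_bigr => i _ do rewrite (bigID (fun j : 'I_n => (j < i)%N)) /=.
rewrite big_split /= [X in X + _](exchange_big_dep predT) //=.
apply/eqP; rewrite addr_eq0 -sumrN; apply/eqP; apply: eq_bigr => i _.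
rewrite [in RHS](bigD1 i) ?ltnn //= (hat_hat fgh) scaler0 add0r -sumrN.
apply: eq_big => j; last by rewrite hat_anti vw scalerN.
by rewrite -leqNgt ltn_neqAle eq_sym andbC.
Qed.

Lemma sel_hsum n (R : pred 'I_n) w t :
  sel f g R (hsum w (sel f g R t)) = hsum w (sel f g R t).
Proof.
rewrite (lin_sumE _ _ _ (sel_lin fgh R)); apply: eq_bigr => i _.
by rewrite (linZ (sel_lin fgh R)) (sel_hat fgh).
Qed.

(** Weights for one group of factors, extended by zero to the concatenation. *)
Definition lpad p q (w : 'I_p -> K) : 'I_(p + q) -> K := scat w (fun=> 0).
Definition rpad p q (w : 'I_q -> K) : 'I_(p + q) -> K := scat (fun=> 0) w.

Lemma hsum_lpad p q (w : 'I_p -> K) t :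
  hsum (@lpad p q w) t = \sum_i w i *: hat h (lshift q i) t.
Proof.
rewrite /hsum big_split_ord /= [X in _ + X]big1 ?addr0 => [|j _].
  by apply: eq_bigr => i _; rewrite /lpad scat_l.
by rewrite /lpad scat_r scale0r.
Qed.

Lemma hsum_rpad p q (w : 'I_q -> K) t :
  hsum (@rpad p q w) t = \sum_i w i *: hat h (rshift p i) t.
Proof.
rewrite /hsum big_split_ord /= [X in X + _]big1 ?add0r => [|j _].
  by apply: eq_bigr => i _; rewrite /rpad scat_r.
by rewrite /rpad scat_l scale0r.
Qed.

End HatTcat.

Section Weights.
Variables (K : comPzRingType) (A B : complex K) (f : A -> B) (g : B -> A) (h : A -> A).
Hypothesis fgh : contraction f g h.

Let sel n (R : pred 'I_n) := sel f g R.

(* W R i is the coefficient of hat i on the image of sel R. *)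
Record is_weight (W : forall n, pred 'I_n -> 'I_n -> K) : Prop := {
  weight_supp : forall n (R : pred 'I_n) i, ~~ R i -> W n R i = 0;
  weight_sum : forall n (R : pred 'I_n) i, R i -> \sum_j W n R j = 1;
  weight_l : forall p q (R : pred 'I_(p + q)) i i',
    let W' := W p (fun i => R (lshift q i)) in
    W' i * W _ R (lshift q i') = W' i' * W _ R (lshift q i);
  weight_r : forall p q (R : pred 'I_(p + q)) j j',
    let W' := W q (fun j => R (rshift p j)) in
    W' j * W _ R (rshift p j') = W' j' * W _ R (rshift p j);
  weight_lr : forall p q (R : pred 'I_(p + q)) i j,
    let Wl := W p (fun i => R (lshift q i)) in let Wr := W q (fun j => R (rshift p j)) in
    Wl i * W _ R (rshift p j) + Wr j * W _ R (lshift q i) = Wl i * Wr j }.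

Variables (W : forall n, pred 'I_n -> 'I_n -> K) (H : thick A A).
Arguments H : clear implicits.
Arguments W : clear implicits.
Hypotheses (HW : is_weight W) (lH : forall n, linear (H n)).
Hypothesis HE : forall n R t, H n (sel R t) = hsum h (W n R) (sel R t).

Arguments lH : clear implicits.

Let lS n R : linear (@sel n R) := sel_lin fgh R.
Let lh n w := @hsum_lin _ _ _ _ _ _ fgh n w.

Lemma weight_graded : is_thick 1 H.
Proof.
move=> n; split=> // i; apply: (sel_ext fgh).
- exact: lin_comp (lH _) prj_lin.
- exact: lin_comp prj_lin (lH _).
move=> R d x hx; have := (sel_graded fgh R).2 i (tpurec d x); rewrite addr0 => <-.
by rewrite !HE -(hsum_graded fgh _).2 /sel (sel_graded fgh _).2 addr0.
Qed.

Lemma weight_tprod_l p q (R : pred 'I_(p + q)) t :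
  tprod 0 (H p) id (sel R t) = hsum h (@lpad _ p q (W p (fun i => R (lshift q i)))) (sel R t).
Proof.
have lT := tprod_lin 0 (lH p) (@lin_id _ (tpow A q)).
move: t; apply: tcat_ext; [exact: lin_comp lT (lS _) | exact: lin_comp (lh _) (lS _) |].
move=> s t /is_tpurec_homog[a hs] _; rewrite /sel (sel_tcat fgh) -!/(sel _ _).
rewrite (tprod_tcat 0 (lH p) (@lin_id _ _) (a := a)); last first.
  by have := graded_homog (sel_graded fgh (fun i => R (lshift q i))) hs; rewrite addr0.
rewrite mul0r ksgn_par scale1r HE hsum_lpad (lin_sumE _ _ _ (tcat_linl _)).
by apply: eq_bigr => i _; rewrite (linZ (tcat_linl _)) (hat_tcat_l fgh).
Qed.

Lemma weight_tprod_r p q (R : pred 'I_(p + q)) t :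
  tprod 1 id (H q) (sel R t) = hsum h (@rpad _ p q (W q (fun j => R (rshift p j)))) (sel R t).
Proof.
have lT := tprod_lin 1 (@lin_id _ (tpow A p)) (lH q).
move: t; apply: tcat_ext; [exact: lin_comp lT (lS _) | exact: lin_comp (lh _) (lS _) |].
move=> s t /is_tpurec_homog[a hs] _; rewrite /sel (sel_tcat fgh) -!/(sel _ _).
have hs' : homog a (sel (fun i => R (lshift q i)) s).
  by have := graded_homog (sel_graded fgh (fun i => R (lshift q i))) hs; rewrite addr0.
rewrite (tprod_tcat 1 (@lin_id _ _) (lH q) _ hs') mul1r HE hsum_rpad.
rewrite (lin_sumE _ _ _ (tcat_linr _)) scaler_sumr; apply: eq_bigr => i _.
by rewrite (linZ (tcat_linr _)) (hat_tcat_r fgh _ _ hs') scaleCA.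
Qed.

Lemma tprod_comp p q t : tprod 1 (H p) (H q) t = tprod 0 (H p) id (tprod 1 id (H q) t).
Proof.
have lr := tprod_lin 1 (@lin_id _ (tpow A p)) (lH q).
have ll := tprod_lin 0 (lH p) (@lin_id _ (tpow A q)).
move: t; apply: tcat_ext; [exact: (tprod_lin 1 (lH p) (lH q)) | exact: lin_comp ll lr |].
move=> s t /is_tpurec_homog[a hs] _.
rewrite (tprod_tcat 1 (lH p) (lH q) _ hs) (tprod_tcat 1 (@lin_id _ _) (lH q) _ hs) (linZ ll).
by rewrite (tprod_tcat 0 (lH p) (@lin_id _ _) _ hs) mul0r (ksgn_par _ 0) scale1r.
Qed.

(** On an R-part, let [cl] and [cr] be the weights of the homotopies on the two groups and [wl] and
    [wr] the restrictions of [W R]. In the product of [cl - cr] with [wl + wr], the terms [cl wl]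
    and [cr wr] vanish by [weight_l], [weight_r] and [hsum_sym0]. The mixed terms combine to [cl cr]
    by anticommutation and [weight_lr]. The second identity is the first with the two operators
    exchanged. *)
Lemma weight_pseudo : pseudo_derivation H.
Proof.
move=> p q t0.
have lr := tprod_lin 1 (@lin_id _ (tpow A p)) (lH q).
have ll := tprod_lin 0 (lH p) (@lin_id _ (tpow A q)).
have lb := tprod_lin 1 (lH p) (lH q).
have key R t : let u := sel R t in
    (tprod 0 (H p) id (H (p + q)%N u) - tprod 1 id (H q) (H (p + q)%N u)
      = tprod 1 (H p) (H q) u) /\
    (H (p + q)%N (tprod 0 (H p) id u - tprod 1 id (H q) u) = - tprod 1 (H p) (H q) u).
  set cl := @lpad _ p q (W p (fun i => R (lshift q i))).
  set cr := @rpad _ p q (W q (fun j => R (rshift p j))).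
  pose c i := cl i - cr i; move=> u.
  have Hu : H (p + q)%N u = hsum h (W (p + q)%N R) u by rewrite HE.
  have hsumB v : hsum h c v = hsum h cl v - hsum h cr v by rewrite hsumD hsumN.
  (* Weighted sums preserve the image of [sel R], so the weight formulas apply again after a first
     operator. *)
  have uE w : hsum h w u = sel R (hsum h w u) by rewrite [RHS](sel_hsum fgh).
  have -> : tprod 1 (H p) (H q) u = hsum h cl (hsum h cr u).
    by rewrite tprod_comp weight_tprod_r -/u -/cr uE weight_tprod_l.
  have key : hsum h c (hsum h (W _ R) u) = hsum h cl (hsum h cr u).
    pose wl := @lpad _ p q (fun i => W _ R (lshift q i)).
    pose wr := @rpad _ p q (fun j => W _ R (rshift p j)).
    have -> : hsum h (W _ R) u = hsum h wl u + hsum h wr u.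
      rewrite -hsumD; apply: eq_hsum; apply: shift_ind => i.
        by rewrite /wl /wr /lpad /rpad !scat_l addr0.
      by rewrite /wl /wr /lpad /rpad !scat_r add0r.
    rewrite hsumB !(linD (lh _)).
    rewrite (hsum_sym0 fgh (v := cl) (w := wl)); last first.
      apply: shift_ind => i; apply: shift_ind => i'; rewrite /cl /wl /lpad ?scat_l ?scat_r.
      - exact: (weight_l HW).
      - by rewrite mulr0 mul0r.
      - by rewrite mulr0 mul0r.
      by [].
    rewrite (hsum_sym0 fgh (v := cr) (w := wr)); last first.
      apply: shift_ind => i; apply: shift_ind => i'; rewrite /cr /wr /rpad ?scat_l ?scat_r.
      - by [].
      - by rewrite mulr0 mul0r.
      - by rewrite mulr0 mul0r.
      exact: (weight_r HW).
    rewrite add0r addr0 [X in _ - X](hsumC fgh) opprK !(hsum_hsum fgh) -big_split.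
    apply: eq_bigr => i _; rewrite -big_split; apply: eq_bigr => j _ /=.
    rewrite -scalerDl; congr (_ *: _); move: i j; apply: shift_ind => i; apply: shift_ind => j;
      rewrite /cl /cr /wl /wr /lpad /rpad ?scat_l ?scat_r ?mulr0 ?mul0r ?addr0 //.
    by rewrite -(weight_lr HW) [X in _ + X]mulrC.
  split.
    by rewrite Hu uE weight_tprod_l weight_tprod_r -uE -hsumB.
  rewrite weight_tprod_l weight_tprod_r -/u -hsumB uE HE -uE.
  by rewrite (hsumC fgh) key.
have E1 : linear (fun t : tpow A (p + q) =>
    tprod 0 (H p) id (H (p + q)%N t) - tprod 1 id (H q) (H (p + q)%N t)).
  by apply: lin_minus; [exact: lin_comp ll (lH _) | exact: lin_comp lr (lH _)].
have E2 : linear (fun t : tpow A (p + q) =>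
    H (p + q)%N (tprod 0 (H p) id t - tprod 1 id (H q) t)).
  exact: lin_comp (lH _) (lin_minus ll lr).
split; move: t0; apply: (sel_ext fgh) => //.
- by move=> R d x hx; have [] := key R (tpurec d x).
- exact: lin_opp.
by move=> R d x hx; have [] := key R (tpurec d x).
Qed.

(** By [dif_hat] the boundary is minus the total weight: -1 for nonempty [R], where [g f] on all
    factors gives 0, and 0 for empty [R], where it gives the identity. *)
Lemma weight_bdry n t : bdry 1 (@H n) t = tpower g (tpower f t) - t.
Proof.
have fg := contr_f_deg fgh; have gg := contr_g_deg fgh.
have lgf : linear (fun t : tpow A n => tpower g (tpower f t)).
  exact: lin_comp (tpower_thick gg n).1 (tpower_thick fg n).1.
move: t; apply: (sel_ext fgh); [exact: bdry_lin | exact: lin_minus lgf (@lin_id _ _) |].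
move=> R d x hx; set y := tpurec d x; rewrite -/(sel R y) (tpower_gf_sel fgh) -/(sel R).
rewrite /bdry ksgn1 scaleN1r opprK (dif_sel fgh) !HE [X in _ + hsum _ _ X](esym (dif_sel fgh R y)).
rewrite (lin_sumE _ _ _ dif_lin) -big_split /=.
have -> : \sum_i (dif (W _ R i *: hat h i (sel R y)) + W _ R i *: hat h i (dif (sel R y))) =
    - \sum_i W _ R i *: sel R y.
  rewrite -sumrN; apply: eq_bigr => i _.
  rewrite (linZ dif_lin) -scalerDr (dif_hat fgh) -scalerN.
  by case: ifP => // /negbT Ri; rewrite (weight_supp HW) // !scale0r.
rewrite -scaler_suml; case: existsP => [[i Ri]|R0].
  by rewrite (weight_sum HW Ri) scale1r sub0r.
rewrite subrr big1 ?scale0r ?oppr0 // => i _; apply: (weight_supp HW).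
by apply/negP => Ri; apply: R0; exists i.
Qed.

Lemma weight_good : good_pseudo_derivation f g h H.
Proof.
have fg := contr_f_deg fgh; have gg := contr_g_deg fgh.
split.
- exact: weight_graded.
- exact: weight_pseudo.
- apply: (sel_ext fgh).
  + exact: lin_comp tpow1_lin (lH _).
  + exact: lin_comp (contr_h_deg fgh).1 tpow1_lin.
  move=> R d x hx; rewrite -(tpow1_hat fgh) -/(sel R _) HE /hsum big_ord_recl big_ord0 addr0.
  have [Ri|Ri] := boolP (R ord0); last by rewrite (hat_selF fgh) ?scaler0.
  by have := weight_sum HW Ri; rewrite big_ord_recl big_ord0 addr0 => ->; rewrite scale1r.
- exact: weight_bdry.
- move=> n; apply: (sel_ext fgh); [exact: lin_comp (lH _) (lH _) | exact: lin_zero |].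
  move=> R d x hx; rewrite -/(sel R _) HE -(sel_hsum fgh) -/(sel R _) HE /sel (sel_hsum fgh).
  by apply: (hsum_sym0 fgh) => i j; rewrite mulrC.
- move=> n; have lf := (tpower_thick fg n).1.
  apply: (sel_ext fgh); [exact: lin_comp lf (lH _) | exact: lin_zero |].
  move=> R d x hx; rewrite -/(sel R _) HE (lin_sumE _ _ _ lf) big1 // => i _.
  by rewrite (linZ lf) (tpower_f_hat fgh) scaler0.
move=> n t; rewrite -(sel_tpower_g fgh) -/(sel _ _) HE /hsum big1 // => i _.
by rewrite (hat_selF fgh) ?scaler0.
Qed.

End Weights.

(** * The tensor trick and its symmetrization *)

Section TensorTrick.
Variables (K : comPzRingType) (A B : complex K) (f : A -> B) (g : B -> A) (h : A -> A).
Hypothesis fgh : contraction f g h.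

Definition is_last n (R : pred 'I_n) (i : 'I_n) := R i && [forall j : 'I_n, (i < j)%N ==> ~~ R j].
Definition last_weight n (R : pred 'I_n) (i : 'I_n) : K := (is_last R i)%:R.

Lemma is_last_inj n (R : pred 'I_n) i i' : is_last R i -> is_last R i' -> i = i'.
Proof.
move=> /andP[Ri /forallP Li] /andP[Ri' /forallP Li'].
have := Li i'; have := Li' i; rewrite Ri Ri' !implybF -!leqNgt => h1 h2.
by apply/ord_inj/eqP; rewrite eqn_leq h1 h2.
Qed.

Lemma is_last_rshift p q (R : pred 'I_(p + q)) j :
  is_last R (rshift p j) = is_last (fun j => R (rshift p j)) j.
Proof.
congr (_ && _); apply/forallP/forallP => L; last apply: shift_ind.
- by move=> k; have := L (rshift p k); rewrite /= ltn_add2l.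
- by move=> k; rewrite /= ltnNge ltnW // (leq_trans (ltn_ord k)) // leq_addr.
by move=> k; rewrite /= ltn_add2l; apply: L.
Qed.

Lemma is_last_lshift p q (R : pred 'I_(p + q)) i : is_last R (lshift q i) =
  is_last (fun i => R (lshift q i)) i && [forall j, ~~ R (rshift p j)].
Proof.
rewrite /is_last -andbA; congr (_ && _).
apply/forallP/andP => [L|[/forallP L1 /forallP L2]]; last apply: shift_ind => // k.
  split; apply/forallP => k; first exact: L (lshift q k).
  have := L (rshift p k); rewrite /= (leq_trans (ltn_ord i)) ?leq_addr //.
by apply/implyP => _; apply: L2.
Qed.

(** The weight sits at the maximum of [R], which lies in the right group as soon as that group meets
    [R], and otherwise is the maximum of the left group. *)
Lemma last_weightP : is_weight last_weight.
Proof.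
rewrite /last_weight; split.
- by move=> n R i /negbTE Ri; rewrite /is_last Ri.
- move=> n R i Ri; pose k := [arg max_(j > i | R j) (j : nat)].
  have Lk : is_last R k.
    rewrite /k; case: arg_maxnP => // j Rj jP; rewrite /is_last Rj; apply/forallP => j'.
    by apply/implyP => jj'; apply/negP => /jP; rewrite /= leqNgt jj'.
  rewrite (bigD1 k) //= Lk big1 ?addr0 // => j jk.
  by case: (boolP (is_last R j)) => // /is_last_inj/(_ Lk) jk'; rewrite jk' eqxx in jk.
- move=> p q R i i' /=; have [->//|ii'] := eqVneq i i'.
  rewrite -!natrM !mulnb !is_last_lshift.
  have : ~~ (is_last (fun i => R (lshift q i)) i && is_last (fun i => R (lshift q i)) i').
    by apply/negP => /andP[Li Li']; rewrite (is_last_inj Li Li') eqxx in ii'.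
  by case: (is_last _ i); case: (is_last _ i').
- by move=> p q R j j' /=; rewrite !is_last_rshift mulrC.
move=> p q R i j /=; rewrite is_last_rshift is_last_lshift.
case: (boolP (is_last (fun j => R (rshift p j)) j)) => [/andP[Rj _]|_]; last first.
  by rewrite mul0r mulr0 addr0.
rewrite mul1r [X in _ && X](_ : _ = false) ?andbF ?addr0 //.
by apply/negP => /forallP/(_ j); rewrite Rj.
Qed.

Let gh n (p i : 'I_n) : graded (if i == p then 1 else 0)
  (if (i < p)%N then id else if i == p then h else g \o f).
Proof.
case: ltnP => [ip|_]; first by rewrite -val_eqE /= ltn_eqF //; apply: graded_id.
by case: ifP => _; [apply: contr_h_deg fgh | apply: gf_graded fgh].
Qed.

Lemma tensor_trick_lin n : linear (@tensor_trick K A B f g h n).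
Proof.
by apply: lin_sum => p; apply: tmap_linear; [exact: id_bij | move=> i; apply: gh].
Qed.

(** In the summand with [h] at [p], [g f] gives zero if [R] has an element beyond [p], and [h] gives
    zero if [p] is not in [R]. Only the maximum of [R] survives, and [g f] is the identity to its
    right. *)
Lemma tensor_trick_sel n (R : pred 'I_n) t :
  tensor_trick f g h (sel f g R t) = hsum h (last_weight R) (sel f g R t).
Proof.
have lS := sel_lin fgh R; move: t; apply: tens_ext.
- exact: lin_comp (@tensor_trick_lin n) lS.
- exact: lin_comp (hsum_lin fgh _) lS.
move=> d x hx; rewrite -/(tpurec d x) (sel_pure fgh); apply: eq_bigr => p _.
rewrite /last_weight /is_last; set X := fun i => keep f g (R i) (x i).
rewrite /tpurec tmap_pure; [|exact: id_bij|exact: gh].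
rewrite koszul_id mul1r -/(tpurec _ _).
case: forallP => [Lp|nL] /=; last first.
  rewrite andbF scale0r.
  have [i] : exists i : 'I_n, (p < i)%N && R i.
    apply: contrapT => nE; apply: nL => i; apply/implyP => pi; apply/negP => Ri.
    by apply: nE; exists i; rewrite pi.
  move=> /andP[pi Ri]; rewrite (@tpurec0 _ _ _ i) ?scaler0 //.
  by rewrite ltnNge ltnW // -val_eqE /= gtn_eqF //= (gf_keep fgh) Ri.
rewrite andbT; have [Rp|Rp] := boolP (R p); last first.
  rewrite scale0r (@tpurec0 _ _ _ p) ?scaler0 // ltnn eqxx /X (negbTE Rp).
  exact: (h_keepF fgh).
rewrite scale1r (hat_pure fgh); congr (ksgn K _ *: tpurec _ _).
- rewrite [RHS]big_mkcond; apply: eq_bigr => j _; rewrite big_mkcond (bigD1 p) //= eqxx mul1r.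
  rewrite big1 ?addr0 // => k /negbTE kp; rewrite kp mul0r.
  by case: ifP.
- by apply: funext => j; rewrite /hat_deg; case: ifP; rewrite ?addr0.
apply: funext => j; rewrite /hat_vec; case: (ltngtP j p) => [jp|jp|/ord_inj ->].
- by rewrite -val_eqE /= ltn_eqF.
- rewrite -val_eqE /= gtn_eqF //= (gf_keep fgh).
  by have := Lp j; rewrite jp /= => /negbTE Rj; rewrite /X Rj.
by rewrite eqxx.
Qed.

Lemma tensor_trick_good : good_pseudo_derivation f g h (tensor_trick f g h).
Proof. exact: (weight_good fgh last_weightP tensor_trick_lin tensor_trick_sel). Qed.

End TensorTrick.

(** * Permutations acting on the parts and on the operators *)

Section PermAction.
Variables (K : comPzRingType) (A : complex K) (n : nat).

Lemma pact_lin (s : 'S_n) : linear (@pact K A n s).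
Proof. exact: (pact_graded _ _).1. Qed.

Lemma pact_mul (s u : 'S_n) (t : tpow A n) : pact (s * u)%g t = pact u (pact s t).
Proof.
move: t; apply: tens_ext; [exact: pact_lin | exact: lin_comp (pact_lin u) (pact_lin s) |].
move=> d x hx; rewrite -/(tpurec d x) !pact_pure (linZ (pact_lin u)) pact_pure scalerA.
have E i : ((s * u)^-1)%g i = (s^-1)%g ((u^-1)%g i) by rewrite invMg permM.
rewrite -(koszul_comp K d (perm_inv_bij s) (perm_inv_bij u)).
have -> : (fun i => ((s * u)^-1)%g i) = (fun i => (s^-1)%g i) \o (fun i => (u^-1)%g i).
  exact: funext.
by congr (_ *: tpurec _ _); apply: funext => i; rewrite /= E.
Qed.

Lemma pact1 (t : tpow A n) : pact 1%g t = t.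
Proof.
move: t; apply: tens_ext; [exact: pact_lin | exact: lin_id |].
move=> d x hx; rewrite -/(tpurec d x) pact_pure koszul_mono; last first.
  by move=> i j /ltnW; rewrite invg1 !perm1.
by rewrite scale1r; congr tpurec; apply: funext => i; rewrite invg1 perm1.
Qed.

Lemma pactVK (s : 'S_n) (t : tpow A n) : pact s^-1%g (pact s t) = t.
Proof. by rewrite -pact_mul mulgV pact1. Qed.

Variables (B : complex K) (f : A -> B) (g : B -> A) (h : A -> A).
Hypothesis fgh : contraction f g h.

Lemma pact_sel (s : 'S_n) (R : pred 'I_n) t :
  pact s (sel f g R t) = sel f g (fun i => R ((s^-1)%g i)) (pact s t).
Proof.
have lS Q := @sel_lin _ _ _ _ _ _ fgh n Q; move: t; apply: tens_ext.
- exact: lin_comp (pact_lin s) (lS _).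
- exact: lin_comp (lS _) (pact_lin s).
move=> d x hx; rewrite -/(tpurec d x) (sel_pure fgh) !pact_pure (linZ (lS _)).
by rewrite (sel_pure fgh).
Qed.

(** The two sides are the signs of applying [h] before and after the permutation; only pairs that
    contain the place of [h] are affected. *)
Lemma koszul_hat_deg (c : 'I_n -> 'I_n) (k : 'I_n) d : bijective c ->
  ksgn K (\sum_(j < n | (j < c k)%N) d j) * koszul K c (hat_deg (c k) d) =
  koszul K c d * ksgn K (\sum_(j < n | (j < k)%N) d (c j)).
Proof.
move=> cb; rewrite !koszul_par !ksgn_par !par_xsum -!signr_addb; congr (_ ^+ nat_of_bool _).
(* Single sums are placed in row [k] of a double sum so that [xsum2_pair] applies. *)
have E F : xsum F = xsum2 (fun a b : 'I_n => (a == k) && F b).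
  by rewrite -(xsum1 k (fun=> xsum F)); apply: eq_xsum => a; rewrite xsum_andl.
rewrite (xsum_bij _ cb) addbC [X in _ (+) X = _]E [X in _ = _ (+) X]E -!xsum2D.
apply: xsum2_pair => [i|i j ij] /=.
  by rewrite !ltnn /=; case: eqP => [->|//]; rewrite !ltnn.
rewrite (ltnNge j i) (ltnW ij) ij /= /hat_deg !(inj_eq (bij_inj cb)).
have : c i != c j by rewrite (inj_eq (bij_inj cb)) neq_ltn ij.
have [ik|nik] := eqVneq i k; have [jk|njk] := eqVneq j k; rewrite ?ik ?jk ?parD /=.
- by move: ij; rewrite ik jk ltnn.
- rewrite -ik [(j < i)%N]ltnNge (ltnW ij) -val_eqE /=.
  by case: ltngtP => //=; case: (par (d (c i))); case: (par (d (c j))).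
- rewrite -jk ij -val_eqE /=.
  by case: ltngtP => //=; case: (par (d (c i))); case: (par (d (c j))).
by [].
Qed.

Lemma pact_hat (s : 'S_n) i t : pact s (hat h i t) = hat h (s i) (pact s t).
Proof.
have lH j := @hat_lin _ _ _ _ _ _ fgh n j; move: t; apply: tens_ext.
- exact: lin_comp (pact_lin s) (lH i).
- exact: lin_comp (lH _) (pact_lin s).
move=> d x hx; rewrite -/(tpurec d x) (hat_pure fgh) !pact_pure (linZ (lH _)) (linZ (pact_lin s)).
rewrite pact_pure (hat_pure fgh) !scalerA.
have := koszul_hat_deg (s i) d (perm_inv_bij s); rewrite permK => ->.
have E j : ((s^-1)%g j == i) = (j == s i) by rewrite (canF_eq (permKV s)).
by congr (_ *: tpurec _ _); apply: funext => j; rewrite /hat_deg /hat_vec E.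
Qed.

End PermAction.

Section Symmetrization.
Variables (K : comPzRingType) (iota : {rmorphism rat -> K}).

Definition mean_weight n (R : pred 'I_n) (i : 'I_n) : K :=
  if R i then iota (#|R|%:R^-1) else 0.

Lemma iota_natV m n : (m > 0)%N -> m%:R * n = 1 :> K -> n = iota (m%:R^-1).
Proof.
move=> m0 mn; have : iota (m%:R^-1) * m%:R = 1.
  by rewrite -(rmorph_nat iota) -rmorphM mulVf ?rmorph1 // pnatr_eq0 -lt0n.
by move=> E; rewrite -[LHS]mul1r -E -mulrA mn mulr1.
Qed.

Lemma card_shift p q (R : pred 'I_(p + q)) :
  #|R| = (#|[pred i | R (lshift q i)]| + #|[pred j | R (rshift p j)]|)%N.
Proof.
by rewrite -!sum1_card big_mkcond big_split_ord /= -!big_mkcond.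
Qed.

Lemma mean_weightP : is_weight mean_weight.
Proof.
rewrite /mean_weight; split.
- by move=> n R i /negbTE ->.
- move=> n R i Ri; rewrite -big_mkcond sumr_const -[LHS]mulr_natl.
  set m := #|_|; have -> : m = #|R| by apply: eq_card.
  rewrite -(rmorph_nat iota) -rmorphM divff ?rmorph1 // pnatr_eq0 -lt0n.
  by apply/card_gt0P; exists i.
- move=> p q R i i' W'; rewrite /W'; case: (R (lshift q i)); case: (R (lshift q i')) => //.
    by rewrite mulr0 mul0r.
  by rewrite mulr0 mul0r.
- move=> p q R i i' W'; rewrite /W'; case: (R (rshift p i)); case: (R (rshift p i')) => //.
    by rewrite mulr0 mul0r.
  by rewrite mulr0 mul0r.
move=> p q R i j /=; rewrite (card_shift R).
(* With [a] and [b] the numbers of elements of [R] in the two groups, the mixed identity is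
   1/(a(a+b)) + 1/(b(a+b)) = 1/(ab). *)
set a := #|_|; set b := #|_|.
case Ri: (R (lshift q i)); case Rj: (R (rshift p j)); rewrite ?mulr0 ?mul0r ?addr0 //.
have a0 : (0 < a)%N by apply/card_gt0P; exists i.
have b0 : (0 < b)%N by apply/card_gt0P; exists j.
rewrite -!rmorphM -rmorphD natrD; congr (iota _).
have : (a%:R : rat) != 0 by rewrite pnatr_eq0 -lt0n.
have : (b%:R : rat) != 0 by rewrite pnatr_eq0 -lt0n.
have : (a%:R + b%:R : rat) != 0 by rewrite -natrD pnatr_eq0 -lt0n addn_gt0 a0.
by move=> ? ? ?; field; apply/and3P.
Qed.

Variables (A B : complex K) (f : A -> B) (g : B -> A) (h : A -> A).
Hypothesis fgh : contraction f g h.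
Variables (W : forall n, pred 'I_n -> 'I_n -> K) (H : thick A A).
Arguments H : clear implicits.
Arguments W : clear implicits.
Hypotheses (HW : is_weight W) (lH : forall n, linear (H n)).
Hypothesis HE : forall n R t, H n (sel f g R t) = hsum h (W n R) (sel f g R t).
Arguments lH : clear implicits.

Lemma symmetrization_lin n : linear (@symmetrization K iota A H n).
Proof.
apply/lin_scale/lin_sum => s.
exact: lin_comp (pact_lin _) (lin_comp (lH n) (pact_lin _)).
Qed.

(** Let [T j] be the undivided sum at [j]. Multiplying permutations by the transposition of two
    elements of [R] shows that [T] is constant on [R]. Each permutation contributes total weight 1
    to the sum of [T] over [R], which is therefore n!. Hence #|R| times [T i] is n!. *)
Lemma mean_weightE n (R : pred 'I_n) i :
  iota (n`!%:R^-1) * \sum_(s : 'S_n) W n (fun j => R ((s^-1)%g j)) (s i) = mean_weight R i.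
Proof.
pose T j := \sum_(s : 'S_n) W n (fun k => R ((s^-1)%g k)) (s j).
rewrite /mean_weight -/(T i); have [Ri|Ri] := boolP (R i); last first.
  by rewrite /T big1 ?mulr0 // => s _; apply: (weight_supp HW); rewrite permK.
have TE j : R j -> T j = T i.
  move=> Rj; rewrite /T (reindex_inj (mulgI (tperm i j))) /=; apply: eq_bigr => s _.
  rewrite permM tpermR; congr (W n _ _); apply: funext => k.
  rewrite invMg permM tpermV; case: tpermP => // ->; first by rewrite Ri Rj.
  by rewrite Ri Rj.
apply: iota_natV; first by apply/card_gt0P; exists i.
have ST : #|R|%:R * T i = (n`!)%:R.
  rewrite mulr_natl -sumr_const.
  transitivity (\sum_(j in R) T j); first by apply: eq_bigr => j Rj; rewrite TE.
  rewrite exchange_big /= -(card_Sn n) -sum1_card natr_sum.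
  apply: eq_bigr => s _.
  pose Rs : pred 'I_n := fun k => R ((s^-1)%g k).
  have Rsi : Rs (s i) by rewrite /Rs permK.
  rewrite -[RHS](weight_sum HW Rsi) [RHS](reindex_inj (@perm_inj _ s)) /= big_mkcond.
  apply: eq_bigr => j _; case: ifP => // /negbT Rj.
  by rewrite (weight_supp HW) // /Rs permK.
rewrite mulrCA ST -(rmorph_nat iota) -rmorphM mulVf ?rmorph1 //.
by rewrite pnatr_eq0 -lt0n fact_gt0.
Qed.

(** Conjugation by [s] carries [hat (s i)] back to [hat i] and the part of the permuted set to the
    part of [R], so averaging affects only the weights. *)
Lemma symmetrization_sel n (R : pred 'I_n) t :
  symmetrization iota H (sel f g R t) = hsum h (mean_weight R) (sel f g R t).
Proof.
rewrite /symmetrization; transitivity (iota (n`!%:R^-1) *: \sum_(s : 'S_n)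
    \sum_i W n (fun j => R ((s^-1)%g j)) (s i) *: hat h i (sel f g R t)).
  congr (_ *: _); apply: eq_bigr => s _.
  rewrite (pact_sel fgh) HE -(pact_sel fgh) (lin_sumE _ _ _ (pact_lin _)).
  rewrite (reindex_inj (@perm_inj _ s)) /=; apply: eq_bigr => i _.
  by rewrite (linZ (pact_lin _)) -(pact_hat fgh) pactVK.
rewrite exchange_big scaler_sumr; apply: eq_bigr => i _.
by rewrite -scaler_suml scalerA mean_weightE.
Qed.

Lemma symmetrization_good : good_pseudo_derivation f g h (symmetrization iota H).
Proof. exact: (weight_good fgh mean_weightP symmetrization_lin symmetrization_sel). Qed.

Lemma symmetrization_sym : symmetric_thick (symmetrization iota H).
Proof.
move=> n u t; rewrite /symmetrization (linZ (pact_lin u)) (lin_sumE _ _ _ (pact_lin u)).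
congr (_ *: _); rewrite [RHS](reindex_inj (mulgI u)) /=; apply: eq_bigr => s _.
by rewrite -!pact_mul invMg mulgKV.
Qed.

End Symmetrization.

Theorem theorem9p5 (K : comPzRingType) (A B : complex K)
    (f : A -> B) (g : B -> A) (h : A -> A) (fgh : contraction f g h) :
  (* (a) *)
  (forall (C : cooperad K true) (H : thick A A),
     good_pseudo_derivation f g h H -> symmetric_thick H ->
     coalgebra_contraction
       (schur_comult C A) (schur_comult C B)
       (thick_schur_map C 0 (tpower f)) (thick_schur_map C 0 (tpower g))
       (thick_schur_map C 1 H)) /\
  (* (b) *)
  (forall (C : cooperad K false) (H : thick A A),
     good_pseudo_derivation f g h H ->
     coalgebra_contraction
       (schur_comult C A) (schur_comult C B)
       (thick_schur_map C 0 (tpower f)) (thick_schur_map C 0 (tpower g))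
       (thick_schur_map C 1 H)) /\
  (* (c) *)
  good_pseudo_derivation f g h (tensor_trick f g h) /\
  (* (d) *)
  (forall iota : {rmorphism rat -> K},
     good_pseudo_derivation f g h (symmetrization iota (tensor_trick f g h)) /\
     symmetric_thick (symmetrization iota (tensor_trick f g h))).
Proof.
split; last split; last split.
- by move=> C H HP Hs; apply: (contraction_schur C fgh HP) => _.
- by move=> C H HP; apply: (contraction_schur C fgh HP).
- exact: tensor_trick_good.
move=> iota; split.
  exact (symmetrization_good iota fgh (last_weightP K) (tensor_trick_lin fgh)
    (tensor_trick_sel fgh)).
exact: symmetrization_sym.
Qed.
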